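(* Let $(\Omega,\mu)$ be a $\sigma$-finite measure space, let $1\leq p<\infty$ and assume that $(e_k)_{k\geq1}$ is an unconditional basis of $L^p(\Omega,\mu)$. Then there exists a density $g$ on $\Omega$ such that $\phi_{p,g}(e_k)\in L^2(g\,d\mu)$ for any $k\geq1$, and the sequence $(\phi_{p,g}(e_k))_{k\geq1}$ is an unconditional basis of $L^2(g\,d\mu)$.
   Context: All spaces are complex. A density on $(\Omega,\mu)$ is a measurable function $g\colon\Omega\to(0,\infty)$ with $\Vert g\Vert_{L^1(\mu)}=1$. For such $g$ and $1\leq p<\infty$, $\phi_{p,g}\colon L^p(\Omega,\mu)\to L^p(\Omega,g\,d\mu)$ is the isometric isomorphism $\phi_{p,g}(h)=g^{-1/p}h$. $L^2(g\,d\mu)$ means $L^2(\Omega,g\,d\mu)$. A sequence $(e_k)_{k\geq1}$ in a Banach space $X$ is a basis if for every $x\in X$ there is a unique scalar sequence $(a_k)_{k\geq1}$ such that $\sum_k a_ke_k$ converges to $x$; it is an unconditional basis if this convergence is unconditional for all $x\in X$. *)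

(* Defs.v *)
From HB Require Import structures.
From mathcomp Require Import all_boot all_order all_algebra.
From mathcomp Require Import complex.
From mathcomp Require Import all_classical all_reals all_analysis.
From mathcomp Require Import measurable_realfun.

Set Implicit Arguments.
Unset Strict Implicit.
Unset Printing Implicit Defensive.

Import Order.TTheory GRing.Theory Num.Theory.
Import numFieldNormedType.Exports.

Local Open Scope classical_set_scope.
Local Open Scope ring_scope.
Local Open Scope complex_scope.

(* Bases of a normed space presented as a subspace [X] of [V] with a seminorm
   [N] that is finite on [X]: vectors of [V] at distance 0 stand for the same
   point. Sequences are indexed from 0. *)
Section bases.
Context {R : realType} {V : lmodType R[i]}.
Variables (X : set V) (N : V -> \bar R).

Definition sums_to (u : nat -> V) (x : V) : Prop :=
  N (x - \sum_(k < n) u k) @[n --> \oo] --> 0%E.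

Definition unconditionally_sums_to (u : nat -> V) (x : V) : Prop :=
  forall s : nat -> nat, bijective s -> sums_to (u \o s) x.

Definition is_basis (e : nat -> V) : Prop :=
  (forall k, X (e k)) /\
  (forall x, X x -> exists! a : nat -> R[i], sums_to (fun k => a k *: e k) x).

Definition is_unconditional_basis (e : nat -> V) : Prop :=
  is_basis e /\
  (forall x (a : nat -> R[i]), X x -> sums_to (fun k => a k *: e k) x ->
    unconditionally_sums_to (fun k => a k *: e k) x).

End bases.

Section complex_Lp.
Context {d : measure_display} {T : measurableType d} {R : realType}.
Implicit Types (mu : {measure set T -> \bar R}) (p : R).

Local Notation cfun := (T -> R[i]).

Definition cmeasurable (f : cfun) : Prop :=
  measurable_fun [set: T] (fun x => complex.Re (f x)) /\
  measurable_fun [set: T] (fun x => complex.Im (f x)).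

Definition cLnorm mu p (f : cfun) : \bar R :=
  'N[mu]_(p%:E)[(fun x => (ComplexField.Normc.normc (f x))%:E)]%E.

Definition cLp mu p : set cfun :=
  [set f | cmeasurable f /\ (cLnorm mu p f < +oo)%E].

Definition is_Lp_unconditional_basis mu p (e : nat -> cfun) : Prop :=
  is_unconditional_basis (cLp mu p) (cLnorm mu p) e.

End complex_Lp.

Record density d (T : measurableType d) (R : realType)
    (mu : {measure set T -> \bar R}) := Density {
  density_fun :> T -> R ;
  density_measurable : measurable_fun [set: T] density_fun ;
  density_gt0 : forall x, 0 < density_fun x ;
  density_Lnorm1 : ('N[mu]_1[EFin \o density_fun])%E = 1%E }.

Section density_measure.
Context {d : measure_display} {T : measurableType d} {R : realType}.
Variables (mu : {measure set T -> \bar R}) (g : density mu).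

Definition density_measure (A : set T) : \bar R :=
  (\int[mu]_(x in A) (g x)%:E)%E.

Let density_measure0 : density_measure set0 = 0%E.
Proof. by rewrite /density_measure integral_set0. Qed.

Let density_measure_ge0 A : (0 <= density_measure A)%E.
Proof.
by apply: integral_ge0 => x _; rewrite lee_fin; exact/ltW/density_gt0.
Qed.

Let density_measure_sigma_additive : semi_sigma_additive density_measure.
Proof.
apply: semi_sigma_additive_nng_induced.
- by apply/measurable_EFinP; exact: density_measurable.
- by move=> x; rewrite lee_fin; exact/ltW/density_gt0.
Qed.

HB.instance Definition _ := isMeasure.Build _ _ _ density_measure
  density_measure0 density_measure_ge0 density_measure_sigma_additive.

Definition phi (p : R) (h : T -> R[i]) : T -> R[i] :=
  fun x => (g x `^ (- p^-1))%:C * h x.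

End density_measure.

(* Main.v *)
(* Put [q = p / 2]. Averaging over signs (Khintchine) and unconditionality of the
   basis give, for coordinate projections [P_j] and any [f_j] in L^p,
     \int (\sum_j |P_j f_j|^2)^q <= K \int (\sum_j |f_j|^2)^q.
   A convexity argument turns this into a single weight [v] with [\int v^q] finite
   and [\int |P f|^2 v^(q-1) <= C \int |f|^2 v^(q-1)] for all coordinate projections
   [P]: one minimises a strictly convex functional over the cone generated by the
   functions [K0 \sum_j |f_j|^2 - \sum_j |P_j f_j|^2], and the weight is read off
   the first-order condition. This treats p < 2 and p > 2 at once. For the density
   [g = v^q / \int v^q], [|phi f|^2 g] is a constant multiple of [|f|^2 v^(q-1)], so
   the coordinate projections are uniformly bounded in the L^2(g dmu)-norm on the
   span of the [phi e_k]. This span is dense by truncation, and both facts together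
   characterise unconditional bases. *)
From HB Require Import structures.
From mathcomp Require Import all_boot all_order all_algebra.
From mathcomp Require Import complex ring lra.
From mathcomp Require Import all_classical all_reals all_analysis.
From mathcomp Require Import measurable_realfun.
Require Import Defs.

Set Implicit Arguments.
Unset Strict Implicit.
Unset Printing Implicit Defensive.
Import Order.TTheory GRing.Theory Num.Theory.
Import numFieldNormedType.Exports.
Local Open Scope classical_set_scope.
Local Open Scope ring_scope.
Local Open Scope complex_scope.
Import ComplexField.Normc.

(** The square function bound is needed for finite families rather than single functions: the
    expressions K0 |f|^2 - |P f|^2 are not closed under addition, and the minimisation requires a
    cone. The bound then serves to keep the functional bounded below. Since q < 1 is allowed, L^q
    may lack a useful dual, which is why the weight comes from a minimisation. A reference density
    u^q is fixed beforehand. It makes the measure finite, and u^(q-1) integrates every |e_k|^2; the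
    weight is v = u x with x >= 1. The inequality u <= v is what controls v^(q-1) when q - 1 is
    negative. The projection estimate is obtained for functions lying both in L^p and in L^2(u^(q-1)
    dmu), so a general element of the weighted space is first truncated to such a function, whose
    expansion is then shown to converge in the weighted norm. *)

Section real_integrals.
Context {d : measure_display} {T : measurableType d} {R : realType}.
Variable mu : {measure set T -> \bar R}.
Implicit Types f g : T -> R.

(** * Integrable real functions and limit theorems for their integrals *)

Definition itg f := mu.-integrable [set: T] (EFin \o f).
Notation J f := (Rintegral mu [set: T] f).

Lemma itg_measurable f : itg f -> measurable_fun [set: T] f.
Proof. by move=> /measurable_int /measurable_EFinP. Qed.

Lemma itg_ge0P f : measurable_fun [set: T] f -> (forall x, 0 <= f x) ->
  itg f <-> (\int[mu]_x (f x)%:E < +oo)%E.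
Proof.
move=> mf f0.
have E : (\int[mu]_x `|(EFin \o f) x|)%E = (\int[mu]_x (f x)%:E)%E.
  by apply: eq_integral => x _ /=; rewrite ger0_norm.
split=> [/integrableP[_]|h]; first by rewrite E.
by apply/integrableP; split; [exact/measurable_EFinP|rewrite E].
Qed.

Lemma EFin_Rintegral f : itg f -> (\int[mu]_x (f x)%:E)%E = (J f)%:E.
Proof. by move=> fi; rewrite /Rintegral fineK//; exact: integrable_fin_num. Qed.

Lemma itg_le f g : measurable_fun [set: T] f -> itg g ->
  (forall x, `|f x| <= g x) -> itg f.
Proof.
move=> mf gi fg; apply: le_integrable gi => //; first exact/measurable_EFinP.
by move=> x _ /=; rewrite lee_fin (le_trans (fg x))// ler_norm.
Qed.

Lemma itg_ae_le f g : measurable_fun [set: T] f -> itg g ->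
  {ae mu, forall x, `|f x| <= g x} -> itg f.
Proof.
move=> mf gi fg; apply/integrableP; split; first exact/measurable_EFinP.
move/integrableP : gi => [mg]; apply: le_lt_trans.
apply: ae_ge0_le_integral => //.
- by apply: measurableT_comp => //; exact/measurable_EFinP.
- exact: measurableT_comp.
- by apply: filterS fg => x h _ /=; rewrite lee_fin (le_trans h)// ler_norm.
Qed.

Lemma itg_cst (c : R) : (mu [set: T] < +oo)%E -> itg (cst c).
Proof.
move=> muT; apply/integrableP; split; first exact/measurable_EFinP/measurable_cst.
rewrite (_ : (fun x => _) = cst `|c|%:E)//.
by rewrite integral_cst// lte_mul_pinfty.
Qed.

Lemma itgD f g : itg f -> itg g -> itg (f \+ g).
Proof. by move=> fi gi; exact: integrableD fi gi. Qed.

Lemma itgB f g : itg f -> itg g -> itg (f \- g).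
Proof. by move=> fi gi; exact: integrableB fi gi. Qed.

Lemma itgZ (c : R) f : itg f -> itg (fun x => c * f x).
Proof. by move=> fi; exact: integrableZl fi. Qed.

Lemma itg_sum (I : Type) (s : seq I) (P : pred I) (F : I -> T -> R) :
  (forall i, P i -> itg (F i)) -> itg (fun x => \sum_(i <- s | P i) F i x).
Proof.
move=> Fi; have := @integrable_sum _ _ _ mu _ measurableT I s P
  (fun i => EFin \o F i) Fi.
apply: eq_integrable => // x _ /=; exact: sumEFin.
Qed.

Lemma itg_norm f : itg f -> itg (fun x => `|f x|).
Proof. exact: integrable_norm. Qed.

Lemma JD f g : itg f -> itg g -> J (f \+ g) = J f + J g.
Proof. by move=> fi gi; exact: RintegralD. Qed.

Lemma JB f g : itg f -> itg g -> J (f \- g) = J f - J g.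
Proof. by move=> fi gi; exact: RintegralB. Qed.

Lemma JZ (c : R) f : itg f -> J (fun x => c * f x) = c * J f.
Proof. by move=> fi; exact: RintegralZl. Qed.

Lemma J_sum (I : Type) (s : seq I) (P : pred I) (F : I -> T -> R) :
  (forall i, P i -> itg (F i)) ->
  J (fun x => \sum_(i <- s | P i) F i x) = \sum_(i <- s | P i) J (F i).
Proof.
move=> Fi; elim: s => [|i s IH].
  rewrite big_nil; under eq_Rintegral do rewrite big_nil.
  by rewrite /Rintegral integral0.
rewrite big_cons; under eq_Rintegral do rewrite big_cons.
case: ifPn => // Pi; rewrite -IH -JD//; first exact: Fi.
exact: itg_sum.
Qed.

Lemma J_le f g : itg f -> itg g -> (forall x, f x <= g x) -> J f <= J g.
Proof. by move=> fi gi fg; exact: le_Rintegral. Qed.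

Lemma J_ae_le f g : itg f -> itg g -> {ae mu, forall x, f x <= g x} ->
  J f <= J g.
Proof.
move=> fi gi fg.
(* The positive part of [f - g] is null a.e. but dominates [f - g] everywhere, which reduces the
   claim to a pointwise inequality. *)
have h : J (fun x => Num.max 0 (f x - g x)) = 0.
  rewrite /Rintegral (@ae_eq_integral _ _ _ mu setT (cst 0)%E)//.
  - by rewrite integral0.
  - apply/measurable_EFinP/measurable_maxr => //.
    by apply: measurable_funB; exact: itg_measurable.
  - apply: filterS fg => x h _ /=; congr EFin.
    by apply/max_idPl; rewrite subr_le0.
have mi : itg (fun x => Num.max 0 (f x - g x)).
  apply: (itg_le _ (itg_norm (itgB fi gi))) => [|x].
    apply/measurable_maxr => //.
    by apply: measurable_funB; exact: itg_measurable.
  by rewrite ger0_norm ?le_max ?lexx// ge_max normr_ge0 ler_norm.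
rewrite -subr_le0 -JB// -h; apply: J_le => //; first exact: itgB.
by move=> x /=; rewrite le_max lexx orbT.
Qed.

Lemma J_ge0 f : (forall x, 0 <= f x) -> 0 <= J f.
Proof. by move=> f0; exact: Rintegral_ge0. Qed.

Lemma J_eq f g : f =1 g -> J f = J g.
Proof. by move=> /funext ->. Qed.

(* Beppo Levi's theorem. *)
Lemma itg_series (F : nat -> T -> R) (M : R) :
  (forall n, itg (F n)) -> (forall n x, 0 <= F n x) ->
  (forall n, \sum_(k < n) J (F k) <= M) ->
  exists E : T -> R, [/\ itg E, forall x, 0 <= E x, J E <= M &
    {ae mu, forall x, forall n, \sum_(k < n) F k x <= E x}].
Proof.
move=> Fi F0 FM.
pose G x := (\sum_(n <oo) (F n x)%:E)%E.
have mF n : measurable_fun [set: T] (EFin \o F n).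
  by apply/measurable_EFinP; exact: itg_measurable.
have G0 x : (0 <= G x)%E by apply: nneseries_ge0 => n _ _; rewrite lee_fin.
have GM : (\int[mu]_x G x <= M%:E)%E.
  rewrite integral_nneseries//; last by move=> n x _; rewrite lee_fin.
  apply: lime_le.
    by apply: is_cvg_nneseries => n _ _; apply: integral_ge0 => x _; rewrite lee_fin.
  apply: nearW => n; rewrite big_mkord.
  under eq_bigr do rewrite EFin_Rintegral//.
  by rewrite sumEFin lee_fin.
have mG : measurable_fun [set: T] G.
  apply: (@emeasurable_fun_cvg _ _ _ _ (fun n x => (\sum_(0 <= k < n) (F k x)%:E)%E)).
    by move=> n; exact: emeasurable_sum.
  by move=> x _; apply: is_cvg_nneseries => n _ _; rewrite lee_fin.
have iG : mu.-integrable [set: T] G.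
  apply/integrableP; split => //.
  under eq_integral do rewrite gee0_abs//.
  by rewrite (le_lt_trans GM)// ltry.
have aeG := integrable_ae measurableT iG.
have mE : measurable_fun [set: T] (fine \o G) by exact: measurableT_comp.
have E0 x : 0 <= (fine \o G) x by rewrite /= fine_ge0.
have EG : (\int[mu]_x ((fine \o G) x)%:E)%E = (\int[mu]_x G x)%E.
  apply: ae_eq_integral => //; first exact/measurable_EFinP.
  by apply: filterS aeG => x /(_ I) h _ /=; rewrite fineK.
have iE : itg (fine \o G) by apply/itg_ge0P => //; rewrite EG (le_lt_trans GM)// ltry.
exists (fine \o G); split => //.
  by rewrite -lee_fin -EFin_Rintegral// EG.
apply: filterS aeG => x /(_ I) h n /=.
rewrite -lee_fin fineK// -sumEFin /G.
have := @nneseries_lim_ge R (fun k => (F k x)%:E) xpredT 0%N n.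
by rewrite big_mkord; apply => k _ _; rewrite lee_fin.
Qed.

Lemma itg_fatou (F : nat -> T -> R) f (M : R) :
  (forall n, itg (F n)) -> (forall n x, 0 <= F n x) ->
  (forall n, J (F n) <= M) ->
  measurable_fun [set: T] f -> (forall x, 0 <= f x) ->
  {ae mu, forall x, F ^~ x @ \oo --> f x} -> itg f /\ J f <= M.
Proof.
move=> Fi F0 FM mf f0 Ff.
have mF n : measurable_fun [set: T] (EFin \o F n).
  by apply/measurable_EFinP; exact: itg_measurable.
have fM : (\int[mu]_x (f x)%:E <= M%:E)%E.
  (* The pointwise lower limit exists everywhere and is measurable, and it equals [f] a.e.; Fatou's
     lemma applies to it. *)
  rewrite (@ae_eq_integral _ _ _ mu setT
    (fun x => limn_einf (fun n => (F n x)%:E)))//; last 3 first.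
  - exact/measurable_EFinP.
  - apply: (@emeasurable_fun_cvg _ _ _ _ (fun n x => einfs (fun k => (F k x)%:E) n)).
      by move=> n; exact: measurable_fun_einfs.
    by move=> x _; rewrite limn_einf_lim; exact: is_cvg_einfs.
  - apply: filterS Ff => x h _ /=.
    apply/esym; rewrite is_cvg_limn_einfE.
      by apply/cvg_lim => //; apply: cvg_EFin => //; exact: nearW.
    by apply/cvg_ex; exists (f x)%:E; apply: cvg_EFin => //; exact: nearW.
  apply: le_trans (fatou _ _ _ _) _ => //; first by move=> n x _; rewrite lee_fin.
  rewrite limn_einf_lim; apply: lime_le; first exact: is_cvg_einfs.
  apply: nearW => n; apply: (@le_trans _ _ (\int[mu]_x (F n x)%:E)%E).
    by apply: ereal_inf_lbound; exists n => /=.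
  by rewrite EFin_Rintegral// lee_fin.
have fi : itg f by apply/itg_ge0P => //; rewrite (le_lt_trans fM)// ltry.
by split=> //; rewrite -lee_fin -EFin_Rintegral.
Qed.

Lemma itg_dominated (F : nat -> T -> R) f g :
  (forall n, measurable_fun [set: T] (F n)) -> measurable_fun [set: T] f ->
  itg g -> {ae mu, forall x, forall n, `|F n x| <= g x} ->
  {ae mu, forall x, F ^~ x @ \oo --> f x} ->
  itg f /\ J (F n) @[n --> \oo] --> J f.
Proof.
move=> mF mf gi Fg Ff.
have [] := @dominated_convergence _ _ _ mu _ measurableT
  (fun n => EFin \o F n) (EFin \o f) (EFin \o g).
- by move=> n; exact/measurable_EFinP.
- exact/measurable_EFinP.
- by apply: filterS Ff => x h _; apply: cvg_EFin => //; exact: nearW.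
- exact: gi.
- by apply: filterS Fg => x h n _ /=; rewrite lee_fin.
move=> fi _ cv; split => //; apply: fine_cvg.
rewrite fineK; last exact: integrable_fin_num.
exact: cv.
Qed.

End real_integrals.

(** * Inequalities for real powers and a uniformly convex potential *)

Section scalar_inequalities.
Context {R : realType}.
Implicit Types a b q r s t x y m : R.

Lemma powR_le2 q s t : 0 <= q -> 0 <= s -> s <= t -> s `^ q <= t `^ q.
Proof.
by move=> q0 s0 st; apply: ge0_ler_powR => //; rewrite nnegrE// (le_trans s0).
Qed.

Lemma powR_ge1 q t : 0 <= q -> 1 <= t -> 1 <= t `^ q.
Proof. by move=> q0 t1; have := @powR_le2 q 1 t q0 ler01 t1; rewrite powR1. Qed.

Lemma powR_le1 q t : 0 <= q -> 0 <= t -> t <= 1 -> t `^ q <= 1.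
Proof. by move=> q0 t0 t1; have := @powR_le2 q t 1 q0 t0 t1; rewrite powR1. Qed.

(** Young's inequality with exponents 1/b and 1/(1-b), applied to [s ^ b] and 1. *)
Lemma powR_bernoulli_le b s : 0 <= b <= 1 -> 0 <= s -> s `^ b <= 1 + b * (s - 1).
Proof.
move=> /andP[b0 b1] s0.
have [->|bn0] := eqVneq b 0; first by rewrite powRr0 mul0r addr0.
have [->|bn1] := eqVneq b 1; first by rewrite powRr1// mul1r addrC subrK.
have bp : 0 < b by rewrite lt_neqAle eq_sym bn0.
have bp1 : 0 < 1 - b by rewrite subr_gt0 lt_neqAle bn1.
have := @conjugate_powR R (s `^ b) 1 b^-1 (1 - b)^-1 (powR_ge0 _ _) ler01.
rewrite !invr_gt0 !invrK => /(_ bp bp1); rewrite subrKC mulr1 powR1 => /(_ erefl).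
rewrite -powRrM mulfV// powRr1// => /le_trans; apply; lra.
Qed.

(** The previous inequality with exponent 1/b at the point [s ^ b]. *)
Lemma powR_bernoulli_ge b s : 1 <= b -> 0 <= s -> 1 + b * (s - 1) <= s `^ b.
Proof.
move=> b1 s0; have b0 : 0 < b by lra.
have := @powR_bernoulli_le b^-1 (s `^ b) _ (powR_ge0 _ _).
rewrite invr_ge0 ltW// invf_le1// b1 => /(_ isT).
rewrite -powRrM mulfV ?gt_eqF// powRr1// => h.
have : b * s <= b * (1 + b^-1 * (s `^ b - 1)) by rewrite ler_pM2l.
by rewrite mulrDr mulrA mulfV ?gt_eqF// mul1r; lra.
Qed.

Lemma powR_le_add1 q t : 0 < q -> 0 <= t -> (1 + t) `^ q <= 2 `^ q * (1 + t `^ q).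
Proof.
move=> q0 t0; have [t1|t1] := leP t 1.
  apply: (@le_trans _ _ (2 `^ q)).
    by apply: ge0_ler_powR; rewrite ?nnegrE; lra.
  by rewrite ler_peMr ?powR_ge0// lerDl powR_ge0.
apply: (@le_trans _ _ ((2 * t) `^ q)).
  by apply: ge0_ler_powR; rewrite ?nnegrE; lra.
by rewrite powRM ?ler_wpM2l ?powR_ge0// ?lerDr//; lra.
Qed.

Lemma powR_le_add q s t : 0 < q -> 0 <= s -> 0 <= t ->
  (s + t) `^ q <= 2 `^ q * (s `^ q + t `^ q).
Proof.
move=> q0 s0 t0.
wlog st : s t s0 t0 / s <= t.
  move=> H; have [st|/ltW ts] := leP s t; first exact: H.
  by rewrite addrC [_ `^ _ + _]addrC; exact: H.
apply: (@le_trans _ _ ((2 * t) `^ q)).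
  by apply: ge0_ler_powR; rewrite ?nnegrE; lra.
by rewrite powRM ?ler_wpM2l ?powR_ge0// ?lerDr ?powR_ge0//; lra.
Qed.

(** A crude Young inequality: the smaller of [s] and [t] is replaced by the larger one. It yields
    integrability of |f|^2 v^(q-1) from that of |f|^(2q) and v^q. *)
Lemma mulr_powR_le q s t : 1 <= q -> 0 <= s -> 0 <= t ->
  s * t `^ (q - 1) <= s `^ q + t `^ q.
Proof.
move=> q1 s0 t0; have q0 : 0 < q by lra.
have [st|/ltW ts] := leP s t.
  apply: (@le_trans _ _ (t * t `^ (q - 1))); first by rewrite ler_wpM2r ?powR_ge0.
  by rewrite mulr_powRB1// lerDr powR_ge0.
apply: (@le_trans _ _ (s * s `^ (q - 1))).
  by rewrite ler_wpM2l// ge0_ler_powR// ?nnegrE//; lra.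
by rewrite mulr_powRB1// lerDl powR_ge0.
Qed.

(** In (1 + t)^q = (1 + t)^(q-1) + t (1 + t)^(q-1) the exponent q - 1 is nonpositive, so the base
    may be lowered to 1 in the first term and to t in the second. *)
Lemma powR_subadd1 q t : 0 < q -> q <= 1 -> 0 <= t -> (1 + t) `^ q <= 1 + t `^ q.
Proof.
move=> q0 q1; rewrite le_eqVlt => /predU1P[<-|t0].
  by rewrite addr0 powR1 lerDl powR_ge0.
rewrite -[leLHS]mulr_powRB1//; last lra.
rewrite mulrDl mul1r lerD//.
  rewrite -[leRHS](powRr0 (1 + t)) ler_powR//; lra.
rewrite -[leRHS]mulr_powRB1//; last lra.
rewrite ler_pM2l// -(opprB 1 q) !powRN.
rewrite lef_pV2 ?posrE ?powR_gt0//; last by lra.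
by apply: ge0_ler_powR; rewrite ?nnegrE; lra.
Qed.

(* The sign that makes [x |-> powsgn q * x `^ q] convex. *)
Definition powsgn q : R := if q < 1 then -1 else 1.

Lemma powsgn_sqr q : powsgn q * powsgn q = 1.
Proof. by rewrite /powsgn; case: ifP => _; lra. Qed.

(* With [s = x `^ (q / 2)] and [a = 2 / q], Bernoulli's inequality for
   [s `^ (a - 1)] bounds [s `^ a] by a quadratic polynomial in [s]. *)
Lemma powR_bregman1 q : 0 < q -> q != 1 -> exists2 c : R, 0 < c &
  forall t, 0 <= t ->
    c * (t `^ (q / 2) - 1) ^+ 2 <= powsgn q * ((t `^ q - 1) / q - (t - 1)).
Proof.
move=> q0 q1; set a := 2 / q.
have a0 : 0 < a by rewrite divr_gt0.
have qE : q^-1 = a / 2 by rewrite /a; field; rewrite gt_eqF.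
have tq t : 0 <= t -> t `^ q = (t `^ (q / 2)) ^+ 2.
  by move=> t0; rewrite -powR_mulrn ?powR_ge0// -powRrM divfK.
have ta t : 0 <= t -> t = (t `^ (q / 2)) `^ a.
  move=> t0; rewrite -powRrM (_ : q / 2 * a = 1) ?powRr1//.
  by rewrite /a; field; rewrite gt_eqF.
have qa : q * a = 2 by rewrite /a; field; rewrite gt_eqF.
have sa s : 0 <= s -> s * s `^ (a - 1) = s `^ a by move=> s0; rewrite mulr_powRB1.
have [ql1|] := ltP q 1.
  have a2 : 2 < a by nra.
  (* In terms of [s], the right-hand side is s^a - 1 - (a/2)(s^2 - 1); Bernoulli's bound s^a >= s (1
     + (a - 1)(s - 1)) leaves exactly (a/2 - 1)(s - 1)^2. *)
  exists (a / 2 - 1) => [|t t0]; first lra.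
  rewrite /powsgn ql1 tq// {3}(ta t)// qE.
  have s0 := powR_ge0 t (q / 2); set s := t `^ (q / 2) in s0 *.
  have /(ler_wpM2l s0) := @powR_bernoulli_ge (a - 1) s ltac:(lra) s0.
  rewrite sa//; nra.
rewrite le_eqVlt eq_sym (negbTE q1)/= => qg1.
have ps : powsgn q = 1 by rewrite /powsgn ltNge ltW.
have [q2|q2] := ltP q 2.
  have a2 : a < 2 by nra.
  have a1 : 1 < a by nra.
  exists (1 - a / 2) => [|t t0]; first lra.
  rewrite ps tq// {3}(ta t)// qE.
  have s0 := powR_ge0 t (q / 2); set s := t `^ (q / 2) in s0 *.
  have /(ler_wpM2l s0) := @powR_bernoulli_le (a - 1) s ltac:(lra) s0.
  rewrite sa//; nra.
(* Here a - 1 <= 0, so Bernoulli's inequality is applied to [s ^ a] itself; what remains is (a/2)(s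
   - 1)^2. *)
have a1 : a <= 1 by nra.
exists (a / 2) => [|t t0]; first lra.
rewrite ps tq// {3}(ta t)// qE.
have s0 := powR_ge0 t (q / 2); set s := t `^ (q / 2) in s0 *.
have := @powR_bernoulli_le a s ltac:(lra) s0; nra.
Qed.

(** Both sides are homogeneous of degree q in (x, m), so division by m reduces to m = 1. On the
    right stands, up to the sign, the Bregman divergence of x^q / q: convexity is quantified through
    the powers x^(q/2). *)
Lemma powR_bregman q : 0 < q -> q != 1 -> exists2 c : R, 0 < c &
  forall x m, 0 <= x -> 0 < m ->
    c * (x `^ (q / 2) - m `^ (q / 2)) ^+ 2
      <= powsgn q * ((x `^ q - m `^ q) / q - m `^ (q - 1) * (x - m)).
Proof.
move=> q0 q1; have [c c0 h] := powR_bregman1 q0 q1; exists c => // x m x0 m0.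
have xE : x = m * (x / m) by field; rewrite gt_eqF.
have t0 : 0 <= x / m by rewrite divr_ge0// ltW.
move: (x / m) xE t0 => t -> t0 {x x0}.
rewrite !powRM ?(ltW m0)//.
have mq : m `^ q = (m `^ (q / 2)) ^+ 2.
  by rewrite -powR_mulrn ?powR_ge0// -powRrM divfK.
rewrite (_ : m `^ (q - 1) * (m * t - m) = m `^ q * (t - 1)); last first.
  by rewrite -(mulr_powRB1 (ltW m0) q0); ring.
have := ler_wpM2l (sqr_ge0 (m `^ (q / 2))) (h t t0).
by rewrite mq; lra.
Qed.

(* The derivative of [psi q] is [posX s `^ (q - 1)]: [psi q] is [x |-> x `^ q / q]
   continued affinely to the left of [1], with the origin moved to [1]. *)
Definition posX s : R := 1 + Num.max 0 s.

Definition psi q s : R := (posX s `^ q - 1) / q + (s + 1 - posX s).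

Lemma posX_ge1 s : 1 <= posX s.
Proof. by rewrite /posX lerDl le_max lexx. Qed.

Lemma posX_lipschitz s t : `|posX s - posX t| <= `|s - t|.
Proof.
rewrite /posX; case: (leP 0 s) => ?; case: (leP 0 t) => ?; rewrite ler_norml;
  case: (ler0P (s - t)) => ?; apply/andP; lra.
Qed.

(** Passing from [posX s], [posX m] to [s], [m] adds a product. Its first factor vanishes for m <=
    0. For m > 0 this factor has the sign [powsgn q], while the second is nonnegative because
    [posX m - m] takes its least value 1. *)
Lemma psi_bregman q : 0 < q -> q != 1 -> exists2 c : R, 0 < c &
  forall s m, c * (posX s `^ (q / 2) - posX m `^ (q / 2)) ^+ 2
    <= powsgn q * (psi q s - psi q m - posX m `^ (q - 1) * (s - m)).
Proof.
move=> q0 q1; have [c c0 h] := powR_bregman q0 q1; exists c => // s m.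
have X1 := posX_ge1 s; have M1 := posX_ge1 m.
apply: (le_trans (h _ _ _ _)); [lra|lra|].
rewrite (_ : psi q s - psi q m - posX m `^ (q - 1) * (s - m) =
  ((posX s `^ q - posX m `^ q) / q - posX m `^ (q - 1) * (posX s - posX m)) +
  (posX m `^ (q - 1) - 1) * ((posX s - s) - (posX m - m))); last first.
  by rewrite /psi; lra.
rewrite [leRHS]mulrDr lerDl mulrA.
have [m0|m0] := leP m 0.
  have -> : posX m = 1 by rewrite /posX; case: leP => ?; lra.
  by rewrite powR1 subrr mulr0 mul0r.
apply: mulr_ge0; last by rewrite /posX; case: (leP 0 s) => ?; case: (leP 0 m) => ?; lra.
rewrite /powsgn; case: ltP => q'.
  rewrite mulN1r oppr_ge0 subr_le0 -[leRHS](powRr0 (posX m)) ler_powR//; lra.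
rewrite mul1r subr_ge0 -[leLHS](powRr0 (posX m)) ler_powR//; lra.
Qed.

(** Bounds the potential from below by the difference of the q-th powers of the positive and
    negative parts, the quantity that the square function inequality controls. The affine side of
    [psi] is compared with a power by Bernoulli's inequality. *)
Lemma psi_lower_bound q : 0 < q -> q != 1 -> exists B : R, forall t,
  ((Num.max 0 t) `^ q - (Num.max 0 (- t)) `^ q) / q - B
    <= powsgn q * psi q (powsgn q * t).
Proof.
move=> q0 q1; have iq0 : 0 < q^-1 by rewrite invr_gt0.
exists (q^-1 + 1) => t.
have p0 : 0 <= Num.max 0 t by rewrite le_max lexx.
have n0 : 0 <= Num.max 0 (- t) by rewrite le_max lexx.
have maxN s : s + 1 - posX s = - Num.max 0 (- s).
  by rewrite /posX; case: (leP 0 s) => ?; case: (leP 0 (- s)) => ?; lra.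
rewrite /psi maxN /posX /powsgn; case: ltP => q'.
  rewrite !mulN1r opprK.
  have := powR_subadd1 q0 (ltW q') n0.
  have := @powR_bernoulli_le q (Num.max 0 t) ltac:(lra) p0.
  have qi : q * q^-1 = 1 by rewrite mulfV// gt_eqF.
  nra.
rewrite !mul1r.
have := @powR_bernoulli_ge q (Num.max 0 (- t)) ltac:(lra) n0.
have : (Num.max 0 t) `^ q <= (1 + Num.max 0 t) `^ q.
  by apply: ge0_ler_powR; rewrite ?nnegrE; lra.
have qi : q * q^-1 = 1 by rewrite mulfV// gt_eqF.
nra.
Qed.

Lemma cvg_powR (u : nat -> R) (l r : R) : 0 < l -> u @ \oo --> l ->
  (u n) `^ r @[n --> \oo] --> l `^ r.
Proof.
move=> l0 ul.
have h : {for l, continuous (fun x : R => x `^ r)}.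
  apply: differentiable_continuous; apply/derivable1_diffP.
  by apply: derivable_powR; rewrite in_itv/= l0.
by apply: (@cvg_comp _ _ _ u (fun x : R => x `^ r) \oo (nbhs l) _ ul); exact: h.
Qed.

End scalar_inequalities.

(** * Geometric convergence of scalars and of functions *)

Section fast_convergence.
Context {R : realType}.

Lemma geometric_sum_le (t : R) n : 0 <= t -> t < 1 ->
  \sum_(k < n) t ^+ k <= (1 - t)^-1.
Proof.
move=> t0 t1; have h : 0 < 1 - t by lra.
suff -> : \sum_(k < n) t ^+ k = (1 - t ^+ n) / (1 - t).
  rewrite -[leRHS]mul1r ler_pM2r ?invr_gt0//.
  by have := exprn_ge0 n t0; lra.
elim: n => [|n IH]; first by rewrite big_ord0 expr0 subrr mul0r.
by rewrite big_ord_recr/= IH exprS; field; rewrite gt_eqF.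
Qed.

Lemma cvgn_geometric_bound (u : nat -> R) (l K : R) :
  (forall n, `|u n - l| <= K * 2^-1 ^+ n) -> u @ \oo --> l.
Proof.
move=> h; have half : `|2^-1 : R| < 1 by rewrite ger0_norm; lra.
apply: (@squeeze_cvgr _ _ _ _ (fun n => l - K * 2^-1 ^+ n)
   (fun n => l + K * 2^-1 ^+ n)).
- apply: nearW => n; have := h n.
  by rewrite ler_distl.
- rewrite -[X in _ --> X]subr0 -[X in _ - X](mulr0 K).
  by apply: cvgB; [exact: cvg_cst|apply: cvgM; [exact: cvg_cst|exact: cvg_expr]].
- rewrite -[X in _ --> X]addr0 -[X in _ + X](mulr0 K).
  by apply: cvgD; [exact: cvg_cst|apply: cvgM; [exact: cvg_cst|exact: cvg_expr]].
Qed.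

(** The intervals with centre [u n] and radius [2 * K * 2^-1 ^+ n] are nested, since consecutive
    radii differ by the allowed increment; [l] is the supremum of their left ends. *)
Lemma fast_cauchy (u : nat -> R) (K : R) :
  (forall n, `|u n.+1 - u n| <= K * 2^-1 ^+ n) ->
  exists l, forall n, `|u n - l| <= 2 * K * 2^-1 ^+ n.
Proof.
move=> h; pose e n : R := 2 * K * 2^-1 ^+ n.
have eS n : e n - e n.+1 = K * 2^-1 ^+ n by rewrite /e exprS; field.
have K0 : 0 <= K by have := le_trans (normr_ge0 _) (h 0); rewrite expr0 mulr1.
have e0 n : 0 <= e n by rewrite /e !mulr_ge0// exprn_ge0// invr_ge0.
have step n : `|u n.+1 - u n| <= e n - e n.+1 by rewrite eS.
have nd : {homo (fun n => u n - e n) : m n / (m <= n)%N >-> m <= n}.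
  apply: homo_leq => [x|y x z|n]; [exact: lexx|exact: le_trans|].
  by have := step n; rewrite ler_norml => /andP[]; lra.
have ni : {homo (fun n => u n + e n) : m n / (m <= n)%N >-> n <= m}.
  apply: homo_leq => [x|y x z xy yz|n]; [exact: lexx|exact: le_trans yz xy|].
  by have := step n; rewrite ler_norml => /andP[]; lra.
have bd m n : u m - e m <= u n + e n.
  have h1 := nd _ _ (leq_maxl m n); have h2 := ni _ _ (leq_maxr m n).
  have := e0 (maxn m n); lra.
have ub n : ubound (range (fun k => u k - e k)) (u n + e n) by move=> _ [k _ <-].
pose l := sup (range (fun k => u k - e k)); exists l => n.
have hs : has_sup (range (fun k => u k - e k)).
  by split; [exists (u 0%N - e 0%N), 0%N|exists (u 0%N + e 0%N); exact: ub].
have l1 : u n - e n <= l by apply: ub_le_sup; [exact: hs.2|exists n].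
have l2 : l <= u n + e n by apply: ge_sup; [exact: hs.1|exact: ub].
by rewrite ler_norml -/(e n); apply/andP; lra.
Qed.

Context {d : measure_display} {T : measurableType d}.
Variable mu : {measure set T -> \bar R}.

Lemma measurable_powRf (f : T -> R) r : measurable_fun [set: T] f ->
  measurable_fun [set: T] (fun x => f x `^ r).
Proof. by move=> mf; exact: (measurableT_comp (measurable_powR r) mf). Qed.

(** Increments of order 4^-n in L^r remain summable after multiplication by 2^n. The r-th powers of
    the scaled increments have an integrable majorant [E] of their sum, so the increments at x are
    at most E(x)^(1/r) 2^-n. *)
Lemma fast_ae_cvg (r C : R) (F : nat -> T -> R) : 0 < r ->
  (forall n, measurable_fun [set: T] (F n)) ->
  (forall n, itg mu (fun x => `|F n.+1 x - F n x| `^ r)) ->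
  (forall n, \int[mu]_x (`|F n.+1 x - F n x| `^ r) <= C * ((4 `^ r)^-1) ^+ n) ->
  exists E f : T -> R, [/\ itg mu E, forall x, 0 <= E x, measurable_fun [set: T] f &
    {ae mu, forall x, forall n,
      `|F n x - f x| <= 2 * E x `^ r^-1 * 2^-1 ^+ n}].
Proof.
move=> r0 mF iF JF.
pose t : R := (2^-1) `^ r.
have t0 : 0 <= t by exact: powR_ge0.
have t1 : t < 1.
  have := @gt0_ltr_powR R r r0 2^-1 1; rewrite powR1 !nnegrE; apply; lra.
have C0 : 0 <= C.
  by have := le_trans (J_ge0 mu (fun x => powR_ge0 _ _)) (JF 0%N); rewrite expr0 mulr1.
pose G n x := (2 `^ r) ^+ n * `|F n.+1 x - F n x| `^ r.
have tE n : (2 `^ r) ^+ n * ((4 `^ r)^-1) ^+ n = t ^+ n.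
  rewrite -exprMn /t (_ : 4 = 2 * 2 :> R); last lra.
  rewrite powRM// -powR_inv1 ?mulr_ge0 ?powR_ge0//.
  have -> : (2^-1) `^ r = (2 `^ r)^-1 :> R by rewrite -powR_inv1// -powRrM mulN1r powRN.
  congr (_ ^+ _); rewrite powR_inv1 ?mulr_ge0 ?powR_ge0//.
  by field; rewrite gt_eqF// powR_gt0.
have [] := @itg_series _ _ _ mu G (C * (1 - t)^-1).
- by move=> n; exact: itgZ.
- by move=> n x; rewrite mulr_ge0 ?exprn_ge0 ?powR_ge0.
- move=> n; apply: (@le_trans _ _ (\sum_(k < n) C * t ^+ k)).
    apply: ler_sum => k _; rewrite JZ; last exact: iF.
    rewrite -tE mulrCA; apply: ler_wpM2l; last exact: JF.
    by rewrite exprn_ge0 ?powR_ge0.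
  by rewrite -mulr_sumr ler_wpM2l// geometric_sum_le.
move=> E [iE E0 _ aeE].
(* The upper limit is defined and measurable everywhere, whatever happens on the exceptional null
   set. *)
pose f x := fine (limn_esup (fun n => (F n x)%:E)).
exists E, f; split => //.
  apply: measurableT_comp => //; apply: measurable_fun_limn_esup.
  by move=> n; exact/measurable_EFinP.
apply: filterS aeE => x hx.
have step n : `|F n.+1 x - F n x| <= E x `^ r^-1 * 2^-1 ^+ n.
  have : G n x <= E x.
    apply: le_trans (hx n.+1); rewrite big_ord_recr/= lerDr sumr_ge0// => k _.
    by rewrite mulr_ge0 ?exprn_ge0 ?powR_ge0.
  have -> : G n x = (2 ^+ n * `|F n.+1 x - F n x|) `^ r.
    rewrite /G [RHS]powRM ?exprn_ge0//; congr (_ * _).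
    by rewrite -(powR_mulrn n (powR_ge0 2 r)) -(powR_mulrn n (ler0n R 2)) powRAC.
  have h0 : 0 <= 2 ^+ n * `|F n.+1 x - F n x| by rewrite mulr_ge0 ?exprn_ge0.
  move=> /(@ge0_ler_powR _ r^-1); rewrite !nnegrE powR_ge0 E0 invr_ge0 ltW// => /(_ isT isT isT).
  rewrite -powRrM mulfV ?gt_eqF// powRr1// => h.
  rewrite exprVn -ler_pdivrMr ?invr_gt0 ?exprn_gt0// invrK mulrC//.
have [l hl] := fast_cauchy step.
suff -> : f x = l by [].
have cl : (F n x)%:E @[n --> \oo] --> l%:E.
  apply: cvg_EFin; first exact: nearW.
  exact: (cvgn_geometric_bound hl).
rewrite /f is_cvg_limn_esupE; last by apply/cvg_ex; exists l%:E.
by rewrite (cvg_lim _ cl).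
Qed.

End fast_convergence.

(** * A weight obtained by minimising over a convex cone *)

Section convex_cone_weight.
Context {d : measure_display} {T : measurableType d} {R : realType}.
Variables (nu : {measure set T -> \bar R}) (q : R).
Hypothesis nu_fin : (nu [set: T] < +oo)%E.
Hypothesis q0 : 0 < q.

Local Notation sg := (powsgn q).
Local Notation J f := (Rintegral nu [set: T] f).

(** A convex function with derivative [X t ^ (q - 1)], the two signs cancelling in the derivative.
    For q < 1 they reflect the concave [psi q] into a convex function. *)
Let pot t : R := sg * psi q (sg * t).
Let X t : R := posX (sg * t).

Let sgsg : sg * sg = 1. Proof. exact: powsgn_sqr. Qed.

Let sg_norm t : `|sg * t| = `|t|.
Proof. by rewrite /powsgn; case: ifP => _; rewrite ?mulN1r ?mul1r ?normrN. Qed.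

Let X1 t : 1 <= X t. Proof. exact: posX_ge1. Qed.

Let pot_bregman : q != 1 -> exists2 c : R, 0 < c & forall s m,
  c * (X s `^ (q / 2) - X m `^ (q / 2)) ^+ 2
    <= pot s - pot m - X m `^ (q - 1) * (s - m).
Proof.
move=> q1; have [c c0 h] := psi_bregman q0 q1; exists c => // s m.
apply: (le_trans (h _ _)).
rewrite (_ : sg * s - sg * m = sg * (s - m)); last by ring.
rewrite (_ : sg * (psi q (sg * s) - psi q (sg * m) - posX (sg * m) `^ (q - 1) * (sg * (s - m)))
  = pot s - pot m - sg * sg * (X m `^ (q - 1) * (s - m))); last by rewrite /pot /X; ring.
by rewrite sgsg mul1r.
Qed.

(** [pot_bregman] is used at the midpoint towards both ends: the linear terms cancel, and (x - z)^2
    + (y - z)^2 >= (x - y)^2 / 2 removes the midpoint value. *)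
Let pot_midpoint : q != 1 -> exists2 c : R, 0 < c & forall a b,
  c * (X b `^ (q / 2) - X a `^ (q / 2)) ^+ 2
    <= pot a + pot b - 2 * pot (2^-1 * (a + b)).
Proof.
move=> q1; have [c c0 h] := pot_bregman q1; exists (c / 2) => [|a b]; first lra.
have := h a (2^-1 * (a + b)); have := h b (2^-1 * (a + b)).
set x := X a `^ _; set y := X b `^ _; set z := X _ `^ (q / 2).
set w := X _ `^ _; set u := pot (2^-1 * _) => h1 h2.
have : 0 <= c * (x + y - 2 * z) ^+ 2 by rewrite mulr_ge0 ?sqr_ge0// ltW.
nra.
Qed.

Let good f := itg nu f /\ itg nu (fun x => `|f x| `^ q).

Let good_meas f : good f -> measurable_fun [set: T] f.
Proof. by move=> [fi _]; exact: itg_measurable fi. Qed.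

Lemma measurable_posX (f : T -> R) : measurable_fun [set: T] f ->
  measurable_fun [set: T] (fun x => posX (f x)).
Proof.
move=> mf; apply: measurable_funD; first exact: measurable_cst.
by apply: measurable_maxr; [exact: measurable_cst|].
Qed.

Let mX f : measurable_fun [set: T] f -> measurable_fun [set: T] (fun x => X (f x)).
Proof.
move=> mf; apply: (@measurable_posX (fun x => sg * f x)).
by apply: measurable_funM => //; exact: measurable_cst.
Qed.

Let X_le t : X t <= 1 + `|t|.
Proof.
have := ler_norm (sg * t); have := normr_ge0 (sg * t).
by rewrite sg_norm /X /posX; case: (leP 0 (sg * t)) => ?; lra.
Qed.

Let itg_X f : good f -> itg nu (fun x => X (f x) `^ q).
Proof.
move=> gf; have mf := good_meas gf; have [_ fq] := gf.
apply: (itg_le _ (itgZ (2 `^ q) (itgD (itg_cst 1 nu_fin) fq))).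
  exact/measurable_powRf/mX.
move=> x /=; rewrite ger0_norm ?powR_ge0//; apply: (le_trans _ (powR_le_add1 _ _)) => //.
by apply: powR_le2; rewrite ?X_le// ?ltW// (lt_le_trans ltr01).
Qed.

Let itg_pot f : good f -> itg nu (fun x => pot (f x)).
Proof.
move=> gf; have mf := good_meas gf; have [fi _] := gf.
have i1 := itg_cst 1 nu_fin.
have iX : itg nu (fun x => X (f x)).
  apply: (itg_le (mX mf) (itgD i1 (itg_norm fi))) => x /=.
  by rewrite ger0_norm ?X_le//; have := X1 (f x); lra.
have := itgZ sg (itgD (itgZ q^-1 (itgB (itg_X gf) i1)) (itgB (itgD (itgZ sg fi) i1) iX)).
apply: eq_integrable => // x _ /=; congr (_%:E); rewrite /pot /psi /X; ring.
Qed.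

Variable DD : set (T -> R).
Hypothesis DDgood : forall f, DD f -> good f.
Hypothesis DD0 : DD (cst 0).
Hypothesis DDD : forall f g, DD f -> DD g -> DD (f \+ g).
Hypothesis DDZ : forall (c : R) f, 0 <= c -> DD f -> DD (fun x => c * f x).
Hypothesis DDle : forall f, DD f ->
  J (fun x => (Num.max 0 (- f x)) `^ q) <= J (fun x => (Num.max 0 (f x)) `^ q).

Let JJ f := J (fun x => pot (f x)).

Let itg_max f : good f -> itg nu (fun x => (Num.max 0 (f x)) `^ q).
Proof.
move=> gf; have mf := good_meas gf; have [_ fq] := gf.
apply: (itg_le _ fq) => [|x].
  by apply/measurable_powRf/measurable_maxr => //; exact: measurable_cst.
rewrite ger0_norm ?powR_ge0//; apply: powR_le2; first exact: ltW.
  by rewrite le_max lexx.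
by rewrite ge_max normr_ge0 ler_norm.
Qed.

Let goodN f : good f -> good (fun x => - f x).
Proof.
move=> [fi fq]; split.
  by have := itgZ (-1) fi; apply: eq_integrable => // x _ /=; rewrite mulN1r.
by under eq_fun do rewrite normrN.
Qed.

(** Integrate [psi_lower_bound]: [DDle] makes the difference of the power integrals nonnegative, and
    the constant term is integrable because [nu] is finite. *)
Let JJ_lower : q != 1 -> exists B, forall f, DD f -> B <= JJ f.
Proof.
move=> q1; have [B hB] := psi_lower_bound q0 q1.
exists (- J (cst B)) => f Df; have gf := DDgood Df.
have ip := itg_max gf; have im := itg_max (goodN gf); have iB := itg_cst B nu_fin.
have := J_le (itgB (itgZ q^-1 (itgB ip im)) iB) (itg_pot gf).
move=> /(_ _)/(le_trans _); apply.
  rewrite JB//; last exact/itgZ/itgB.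
  rewrite JZ; last exact: itgB.
  rewrite JB// lerDr; apply: mulr_ge0; first by rewrite invr_ge0 ltW.
  by rewrite subr_ge0; exact: DDle.
by move=> x /=; rewrite mulrC; exact: hB.
Qed.

(** The tolerance 16^-n is used twice: it gives L2 increments of order 4^-n, as [fast_ae_cvg]
    requires, and it remains negligible after division by the step 4^-n of the first-order
    condition. *)
Let minimizing : q != 1 -> exists f : nat -> T -> R, forall n, DD (f n) /\
  forall g, DD g -> JJ (f n) <= JJ g + (16^-1) ^+ n.
Proof.
move=> q1; have [B hB] := JJ_lower q1.
have hi : has_inf (JJ @` DD).
  by split; [exists (JJ (cst 0)), (cst 0)|exists B => _ [f Df <-]; exact: hB].
have /choice[f hf] n : exists f, DD f /\ JJ f < inf (JJ @` DD) + (16^-1) ^+ n.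
  have e0 : 0 < (16^-1) ^+ n :> R by rewrite exprn_gt0// invr_gt0.
  have [_ [f Df <-] h] := inf_adherent e0 hi.
  by exists f.
exists f => n; have [Df h] := hf n; split => // g Dg.
apply: (le_trans (ltW h)); rewrite lerD2r.
by apply: ge_inf; [exact: hi.2|exists g].
Qed.

(* Strict convexity ([pot_midpoint]) makes [X (f n) `^ (q / 2)] Cauchy in L2 for
   a minimising sequence [f n] of [JJ] over the cone, although [f n] itself need
   not converge; the limit is [x `^ (q / 2)]. The inequality is the first-order
   condition at [f n] in the direction [g], with step [4^-1 ^+ n]. *)
Lemma convex_cone_weight : exists x : T -> R,
  [/\ measurable_fun [set: T] x, forall t, 1 <= x t, itg nu (fun t => x t `^ q) &
   forall f, DD f -> itg nu (fun t => f t * x t `^ (q - 1)) /\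
     0 <= J (fun t => f t * x t `^ (q - 1))].
Proof.
(* For q = 1 the potential is affine and gives no compactness, but [DDle] then says that [J f] is
   nonnegative, so the constant weight works. *)
have [q1|q1] := eqVneq q 1.
  exists (cst 1); split => //.
  - rewrite /cst; under eq_fun do rewrite powR1; exact: itg_cst.
  - move=> f Df; have gf := DDgood Df.
    under eq_fun do rewrite powR1 mulr1; split; first exact: gf.1.
    have := DDle Df; rewrite q1.
    under eq_Rintegral do rewrite powRr1 ?le_max ?lexx//.
    under [leRHS]eq_Rintegral do rewrite powRr1 ?le_max ?lexx//.
    have ip := itg_max gf; have im := itg_max (goodN gf).
    have mE (g : T -> R) : (fun x => Num.max 0 (g x) `^ q) = (fun x => Num.max 0 (g x)).
      by apply/funext => x; rewrite q1 powRr1 ?le_max ?lexx.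
    rewrite mE in ip; rewrite mE in im.
    rewrite -subr_ge0 -JB// => /le_trans; apply; apply: J_le => //; first exact: itgB.
      exact: gf.1.
    by move=> x /=; case: (leP 0 (f x)) => ?; case: (leP 0 (- f x)) => ?; lra.
have [f hf] := minimizing q1.
have Df n := (hf n).1; have fmin n := (hf n).2.
have gf n := DDgood (Df n); have mf n := good_meas (gf n).
have [c c0 hc] := pot_midpoint q1.
pose z n t := X (f n t) `^ (q / 2).
have mz n : measurable_fun [set: T] (z n) by exact/measurable_powRf/mX.
have z2 n t : z n t ^+ 2 = X (f n t) `^ q.
  by rewrite /z -powR_mulrn ?powR_ge0// -powRrM divfK.
have z1 n t : 1 <= z n t.
  rewrite -[leLHS](powRr0 (X (f n t))) ler_powR//.
  by rewrite divr_ge0// ltW.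
have iz n : itg nu (fun t => z n t ^+ 2).
  by under eq_fun do rewrite z2; exact: itg_X.
have izz n : itg nu (fun t => `|z n.+1 t - z n t| `^ 2).
  apply: (itg_le _ (itgD (itgZ 2 (iz n.+1)) (itgZ 2 (iz n)))) => [|t /=].
    by apply/measurable_powRf/measurableT_comp => //; exact: measurable_funB.
  rewrite ger0_norm ?powR_ge0// powR_mulrn// real_normK ?num_real//.
  by have := sqr_ge0 (z n.+1 t + z n t); nra.
(* The midpoint lies in the cone, hence its value is no less than those of [f n] and [f n.+1] up to
   the tolerances; [pot_midpoint] turns this into an L2 bound on [z n.+1 - z n]. *)
pose mid n := fun t => 2^-1 * (f n t + f n.+1 t).
have Dmid n : DD (mid n) by apply: (@DDZ 2^-1 (f n \+ f n.+1)); [lra|exact: DDD].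
have Jzz n : J (fun t => `|z n.+1 t - z n t| `^ 2) <= 2 / c * ((4 `^ 2)^-1) ^+ n.
  have i0 := itg_pot (gf n); have i1 := itg_pot (gf n.+1).
  have i2 := itg_pot (DDgood (Dmid n)).
  have := J_le (itgZ c (izz n)) (itgB (itgD i0 i1) (itgZ 2 i2)).
  rewrite JZ// (JB (itgD i0 i1) (itgZ 2 i2)) (JD i0 i1) (JZ 2 i2) => h.
  have e16 : (4 `^ 2)^-1 = 16^-1 :> R by rewrite powR_mulrn//; congr (_^-1); lra.
  rewrite e16 mulrAC ler_pdivlMr// mulrC.
  apply: (le_trans (h _)).
    move=> t /=; rewrite powR_mulrn// real_normK ?num_real//; exact: hc.
  have h1 := fmin n _ (Dmid n); have h2 := fmin n.+1 _ (Dmid n).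
  have : (16^-1 : R) ^+ n.+1 <= 16^-1 ^+ n.
    by rewrite exprS ler_piMl ?exprn_ge0//; lra.
  by move: h1 h2; rewrite /JJ; lra.
have [E [zl [iE E0 mzl]]] := fast_ae_cvg (ltr0n _ 2) mz izz Jzz.
have half (t : T) : E t `^ 2^-1 = Num.sqrt (E t) by rewrite powR12_sqrt.
move=> aez.
(* Since [z n >= 1], raising the limit to 1 brings it no farther from [z n] and gives the lower
   bound everywhere. *)
pose zz t := Num.max 1 (zl t).
have mzz : measurable_fun [set: T] zz by apply: measurable_maxr => //; exact: measurable_cst.
have zz1 t : 1 <= zz t by rewrite /zz le_max lexx.
have {}aez : {ae nu, forall t, forall n,
    `|z n t - zz t| <= 2 * Num.sqrt (E t) * 2^-1 ^+ n}.
  apply: filterS aez => t h n; rewrite -half.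
  apply: (le_trans _ (h n)); have := z1 n t; rewrite /zz.
  by case: (leP 1 (zl t)) => // ? ?; rewrite !ger0_norm; lra.
(* With s the square root of [E t], both [zz] and all [z n] are at most z_0 + 4 s a.e., and (z_0 + 4
   s)^2 <= 2 z_0^2 + 32 s^2. *)
pose D t := 2 * z 0%N t ^+ 2 + 32 * E t.
have iD : itg nu D by apply: itgD; exact: itgZ.
have h2n n : 0 <= (2^-1 : R) ^+ n <= 1.
  by rewrite exprn_ge0 ?invr_ge0// exprn_ile1//; lra.
have aeD : {ae nu, forall t, zz t ^+ 2 <= D t /\ forall n, z n t ^+ 2 <= D t}.
  apply: filterS aez => t h.
  have s0 := sqrtr_ge0 (E t); have s2 := sqr_sqrtr (E0 t).
  have h0 := h 0%N; rewrite expr0 mulr1 ler_distl in h0.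
  have zz1t := zz1 t; have z10 := z1 0%N t.
  rewrite /D -s2; set s := Num.sqrt (E t) in s0 h h0 *.
  have b1 : zz t <= z 0%N t + 2 * s by lra.
  split=> [|n].
    apply: (@le_trans _ _ ((z 0%N t + 4 * s) ^+ 2)); last first.
      by have := sqr_ge0 (z 0%N t - 4 * s); nra.
    by rewrite ler_sqr ?nnegrE; lra.
  have z1n := z1 n t.
  have : z n t <= z 0%N t + 4 * s.
    have := h n; rewrite ler_distl => /andP[_ ].
    have /andP[p0 p1] := h2n n.
    have : 2 * s * 2^-1 ^+ n <= 2 * s by rewrite ler_piMr//; lra.
    lra.
  move=> b2; apply: (@le_trans _ _ ((z 0%N t + 4 * s) ^+ 2)); last first.
    by have := sqr_ge0 (z 0%N t - 4 * s); nra.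
  by rewrite ler_sqr ?nnegrE; lra.
have r0 : 0 <= 2 / q by rewrite divr_ge0// ltW.
pose x t := zz t `^ (2 / q).
have x1 t : 1 <= x t by rewrite -[leLHS](powRr0 (zz t)) ler_powR.
have mx : measurable_fun [set: T] x by exact: measurable_powRf.
have xq t : x t `^ q = zz t ^+ 2.
  rewrite /x -powRrM divfK ?gt_eqF// powR_mulrn//; have := zz1 t; lra.
have ix : itg nu (fun t => x t `^ q).
  apply: (itg_ae_le _ iD); first exact: measurable_powRf.
  by apply: filterS aeD => t [h _]; rewrite ger0_norm ?powR_ge0// xq.
exists x; split => // g Dg; have gg := DDgood Dg; have mg := good_meas gg.
pose y n t := X (f n t + (4^-1) ^+ n * g t).
have e4 n : 0 < (4^-1 : R) ^+ n by rewrite exprn_gt0// invr_gt0.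
have Dn n : DD (fun t => f n t + (4^-1) ^+ n * g t).
  by apply: (@DDD (f n) (fun t => (4^-1) ^+ n * g t)) => //; apply: DDZ => //; exact/ltW.
have my n : measurable_fun [set: T] (y n) by apply: mX; exact: good_meas (DDgood (Dn n)).
have Xf n t : X (f n t) = z n t `^ (2 / q).
  rewrite /z -powRrM (_ : q / 2 * (2 / q) = 1); last by field; rewrite gt_eqF.
  by rewrite powRr1//; have := X1 (f n t); lra.
have yX n t : `|y n t - X (f n t)| <= (4^-1) ^+ n * `|g t|.
  apply: (le_trans (posX_lipschitz _ _)).
  rewrite (_ : sg * _ - sg * _ = sg * ((4^-1) ^+ n * g t)); last by ring.
  by rewrite sg_norm normrM ger0_norm// ltW.
have [c' c'0 hb] := pot_bregman q1.
have m1 n : measurable_fun [set: T] (fun t => g t * y n t `^ (q - 1)).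
  by apply: measurable_funM => //; exact: measurable_powRf.
have y1 n t : 1 <= y n t by exact: X1.
(* An integrable majorant for both ranges of q: for q <= 1 the factor [y n t ^ (q - 1)] is at most
   1; for q > 1 use [mulr_powR_le] and the bound of [y n t] by [X (f n t) + |g t|]. *)
pose H t := `|g t| + (`|g t| `^ q + 2 `^ q * (D t + `|g t| `^ q)).
have iH : itg nu H.
  have [gi gq] := gg.
  by apply: itgD; [exact: itg_norm|apply: itgD => //; apply: itgZ; exact: itgD].
have aeH : {ae nu, forall t, forall n, `|g t * y n t `^ (q - 1)| <= H t}.
  apply: filterS aeD => t [_ h] n.
  have D0 : 0 <= D t by apply: le_trans (h 0%N); exact: sqr_ge0.
  have gq0 := powR_ge0 (`|g t|) q; have q20 := powR_ge0 2 q.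
  rewrite normrM (ger0_norm (powR_ge0 _ _)).
  have [ql1|qg1] := leP q 1.
    apply: (@le_trans _ _ `|g t|).
      rewrite ler_piMr// -[leRHS](powRr0 (y n t)) ler_powR//; lra.
    by rewrite /H lerDl addr_ge0// mulr_ge0// addr_ge0.
  apply: (@le_trans _ _ (`|g t| `^ q + y n t `^ q)).
    by apply: mulr_powR_le => //; [exact: ltW|have := y1 n t; lra].
  have gn0 := normr_ge0 (g t).
  suff : y n t `^ q <= 2 `^ q * (D t + `|g t| `^ q) by rewrite /H; lra.
  apply: (@le_trans _ _ ((X (f n t) + `|g t|) `^ q)).
    apply: powR_le2; [exact: ltW|by have := y1 n t; lra|].
    have := yX n t; rewrite ler_distl => /andP[_ ].
    have : (4^-1 : R) ^+ n * `|g t| <= `|g t|.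
      by rewrite ler_piMl// exprn_ile1//; lra.
    lra.
  apply: (le_trans (powR_le_add _ _ _)) => //; first by have := X1 (f n t); lra.
  by rewrite ler_wpM2l// lerD2r -z2.
have aec : {ae nu, forall t, (fun n => g t * y n t `^ (q - 1)) @ \oo --> g t * x t `^ (q - 1)}.
  apply: filterS aez => t h.
  apply: cvgM; first exact: cvg_cst.
  apply: cvg_powR; first by have := x1 t; lra.
  have zc : z ^~ t @ \oo --> zz t by exact: cvgn_geometric_bound h.
  have Xc : (fun n => X (f n t)) @ \oo --> x t.
    under eq_fun do rewrite Xf; apply: cvg_powR => //; have := zz1 t; lra.
  have dc : (fun n => y n t - X (f n t)) @ \oo --> (0 : R).
    apply: (@cvgn_geometric_bound _ _ _ `|g t|) => n; rewrite subr0.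
    apply: (le_trans (yX n t)); rewrite mulrC ler_wpM2l//.
    by apply: lerXn2r; rewrite ?nnegrE; lra.
  rewrite -[x t]add0r (_ : (fun n => y n t) =
    (fun n => (y n t - X (f n t)) + X (f n t))); first exact: cvgD dc Xc.
  by apply/funext => n; rewrite subrK.
have mgx : measurable_fun [set: T] (fun t => g t * x t `^ (q - 1)).
  by apply: measurable_funM => //; exact: measurable_powRf.
have [igx Jc] := itg_dominated m1 mgx iH aeH aec.
split=> //.
have iy n : itg nu (fun t => g t * y n t `^ (q - 1)).
  apply: (itg_ae_le _ iH) => //; apply: filterS aeH => t; exact.
(* The tangent inequality is taken at the perturbed function and evaluated at [f n]. It bounds the
   difference of the functionals by 4^-n times this integral, and minimality bounds that difference
   below by -16^-n. *)
have Jn n : - (4^-1) ^+ n <= J (fun t => g t * y n t `^ (q - 1)).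
  have i0 := itg_pot (gf n); have i1 := itg_pot (DDgood (Dn n)).
  have := J_le (itgB i1 i0) (itgZ ((4^-1) ^+ n) (iy n)).
  rewrite JZ// (JB i1 i0) => h.
  have {h} : - (16^-1) ^+ n <= 4^-1 ^+ n * J (fun t => g t * y n t `^ (q - 1)).
    apply: (le_trans _ (h _)).
      by have := fmin n _ (Dn n); rewrite /JJ; lra.
    move=> t /=; have := hb (f n t) (f n t + (4^-1) ^+ n * g t).
    have : 0 <= c' * (X (f n t) `^ (q / 2) - X (f n t + 4^-1 ^+ n * g t) `^ (q / 2)) ^+ 2.
      by rewrite mulr_ge0 ?sqr_ge0// ltW.
    rewrite -/(y n t); lra.
  rewrite (_ : 16^-1 = 4^-1 * 4^-1 :> R); last by lra.
  by rewrite exprMn -mulrN ler_pM2l.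
have cn : - (4^-1 : R) ^+ n @[n --> \oo] --> - (0 : R).
  by apply: cvgN; apply: cvg_expr; rewrite ger0_norm; lra.
rewrite -oppr0; apply: (ler_cvg_to cn Jc); exact: nearW.
Qed.

End convex_cone_weight.

(** * Khintchine's inequality by induction over signs *)

Section two_point.
Context {R : realType}.

(** The even and odd parts in [s] are bounded together, because multiplication by 1 + s and 1 - s
    feeds each of them with the other. *)
Let two_point_aux (s : R) (r : nat) : `|s| <= 1 ->
  (1 + s) ^+ r + (1 - s) ^+ r <= 2 + 2 * (2 ^+ r - 1) * s ^+ 2 /\
  `|(1 + s) ^+ r - (1 - s) ^+ r| <= 2 * (2 ^+ r - 1) * `|s|.
Proof.
move=> s1; elim: r => [|r [E O]]; first by rewrite !expr0 !subrr !normr0; split; lra.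
have g0 : 0 <= 2 ^+ r - 1 :> R by rewrite subr_ge0 exprn_ege1//; lra.
rewrite !(exprS _ r); set g := 2 ^+ r in g0 E O *.
set a := (1 + s) ^+ r in E O *; set b := (1 - s) ^+ r in E O *.
have s2 : s ^+ 2 = `|s| * `|s| by rewrite -expr2 real_normK ?num_real.
have n0 := normr_ge0 s.
have O' : s * (a - b) <= 2 * (g - 1) * s ^+ 2.
  apply: (le_trans (ler_norm _)); rewrite normrM s2 mulrA [leRHS]mulrC.
  by rewrite ler_wpM2l.
split.
  rewrite (_ : (1 + s) * a + (1 - s) * b = (a + b) + s * (a - b)); last by ring.
  rewrite s2 in E O' *; have : 0 <= `|s| * `|s| by exact: mulr_ge0.
  by lra.
rewrite (_ : (1 + s) * a - (1 - s) * b = (a - b) + s * (a + b)); last by ring.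
have ab0 : 0 <= a + b.
  by rewrite addr_ge0// exprn_ge0//; move: s1; rewrite ler_norml => /andP[]; lra.
apply: (le_trans (ler_normD _ _)); rewrite [`|s * _|]normrM (ger0_norm ab0).
have s21 : s ^+ 2 <= 1 by rewrite s2 -[leRHS]mul1r ler_pM.
have : `|s| * (a + b) <= `|s| * (2 * g).
  rewrite ler_wpM2l//; apply: (le_trans E).
  have : (g - 1) * s ^+ 2 <= g - 1 by rewrite ler_piMr.
  by lra.
lra.
Qed.

(** The induction step for moments: for a vector a and a new vector y take B = |a|^2 + |y|^2, t =
    2<a,y>, b = |y|^2. After scaling to B = 1 the second-order term is t^2 / B <= 4 b. *)
Lemma two_point (B b t : R) (r : nat) : 0 <= B -> 0 <= b -> `|t| <= B ->
  t ^+ 2 <= 4 * B * b ->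
  (B + t) ^+ r + (B - t) ^+ r <= 2 * (B + 2 ^+ r.+2 * b) ^+ r.
Proof.
move=> B0 b0 tB t2; case: r => [|r]; first by rewrite !expr0 mulr1; lra.
have [BE|Bp] := eqVneq B 0.
  move: tB; rewrite BE normr_le0 => /eqP ->; rewrite subrr !addr0 expr0n/= addr0 add0r.
  by rewrite mulr_ge0// exprn_ge0// mulr_ge0// exprn_ge0.
have {}Bp : 0 < B by rewrite lt_neqAle eq_sym Bp.
have s1 : `|t / B| <= 1 by rewrite normrM (@ger0_norm _ B^-1) ?invr_ge0// ler_pdivrMr// mul1r.
have [h _] := two_point_aux r.+1 s1.
rewrite (_ : B + t = B * (1 + t / B)); last by field; rewrite gt_eqF.
rewrite (_ : B - t = B * (1 - t / B)); last by field; rewrite gt_eqF.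
rewrite !exprMn -mulrDr.
apply: (@le_trans _ _ (2 * (B * (1 + 2 ^+ r.+1 * (t / B) ^+ 2)) ^+ r.+1)).
  rewrite exprMn mulrCA ler_wpM2l ?exprn_ge0//.
  set u := (t / B) ^+ 2 in h *; have u0 : 0 <= u by exact: sqr_ge0.
  apply: (le_trans h); rewrite -mulrA -[X in X + _]mulr1 -mulrDr ler_wpM2l//.
  have p0 : 0 <= 2 ^+ r.+1 :> R by rewrite exprn_ge0.
  apply: (@le_trans _ _ (1 + 2 ^+ r.+1 * u)); first by lra.
  by rewrite -[leLHS]expr1 ler_eXnr// lerDl mulr_ge0.
rewrite ler_wpM2l// lerXn2r ?nnegrE//.
- by rewrite mulr_ge0// addr_ge0// mulr_ge0 ?sqr_ge0// exprn_ge0.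
- by rewrite addr_ge0// mulr_ge0// exprn_ge0.
rewrite mulrDr mulr1 lerD2l (_ : B * _ = 2 ^+ r.+1 * (t ^+ 2 / B)); last by field; rewrite gt_eqF.
rewrite (exprS _ r.+2) (exprS _ r.+1) (exprS _ r); have p0 : 0 <= 2 ^+ r :> R by rewrite exprn_ge0.
have : t ^+ 2 / B <= 4 * b by rewrite ler_pdivrMr// mulrAC.
by set u := _ / B; nra.
Qed.

End two_point.

Section signs.

Definition upd (b : nat -> bool) (J : nat) (c : bool) : nat -> bool :=
  fun j => if j == J then c else b j.

(* [true] stands for the sign -1; entries from index [J] on are junk [false]. *)
Fixpoint signs (J : nat) : seq (nat -> bool) :=
  if J is J'.+1 then
    [seq upd b J' true | b <- signs J'] ++ [seq upd b J' false | b <- signs J']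
  else [:: fun=> false].

Lemma size_signs J : size (signs J) = (2 ^ J)%N.
Proof. by elim: J => //= J IH; rewrite size_cat !size_map IH addnn expnS mul2n. Qed.

Lemma sum_signsS (V : nmodType) J (F : (nat -> bool) -> V) :
  \sum_(b <- signs J.+1) F b =
  \sum_(b <- signs J) (F (upd b J true) + F (upd b J false)).
Proof. by rewrite /= big_cat/= !big_map big_split. Qed.

Lemma upd_lt b J c j : (j < J)%N -> upd b J c j = b j.
Proof. by move=> jJ; rewrite /upd ltn_eqF. Qed.

Lemma upd_eq b J c : upd b J c J = c.
Proof. by rewrite /upd eqxx. Qed.

Lemma sum_signs_cst (V : nmodType) J (v : V) : \sum_(b <- signs J) v = v *+ 2 ^ J.
Proof. by rewrite big_const_seq count_predT size_signs iter_addr_0. Qed.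

End signs.

Section powers.
Context {R : realType}.

Lemma powR_le_exprn (q t : R) (r : nat) : 0 <= q -> q <= r%:R -> 0 <= t ->
  t `^ q <= 1 + t ^+ r.
Proof.
move=> q0 qr t0; have [t1|/ltW t1] := leP t 1.
  by apply: (@le_trans _ _ 1); rewrite ?lerDl ?exprn_ge0// powR_le1.
apply: (@le_trans _ _ (t ^+ r)); last by rewrite lerDr.
by rewrite -powR_mulrn// ler_powR.
Qed.

(** One summand suffices in each of the ranges t <= 1/4, 1/4 < t <= M and t > M. The coefficient 1/M
    makes the high power negligible, so that a first moment forces a lower bound on the q-th one. *)
Lemma le_powR_exprn (q t M : R) (r : nat) : 0 < q -> 1 <= M -> 0 <= t ->
  t <= 4^-1 + M * 4 `^ q * t `^ q + t ^+ r.+2 / M.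
Proof.
move=> q0 M1 t0; have M0 : 0 < M by lra.
have a0 : 0 <= M * 4 `^ q * t `^ q by rewrite !mulr_ge0 ?powR_ge0// ltW.
have b0 : 0 <= t ^+ r.+2 / M by rewrite divr_ge0 ?exprn_ge0// ltW.
have [t4|t4] := leP t 4^-1; first by lra.
have [tM|/ltW Mt] := leP t M.
  suff : t <= M * 4 `^ q * t `^ q by lra.
  rewrite -mulrA -powRM// -[leLHS]mulr1 ler_pM//.
  by rewrite powR_ge1 ?(ltW q0)//; lra.
suff : t <= t ^+ r.+2 / M by have : 0 <= 4^-1 :> R; lra.
rewrite ler_pdivlMr// exprS ler_wpM2l// (le_trans Mt)// -[leLHS]expr1 ler_weXn2l//.
by lra.
Qed.

Lemma nat_bound (q : R) : 0 < q -> exists r : nat, q <= r.+2%:R.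
Proof.
move=> q0; exists (Num.bound q); apply: ltW.
by apply: (lt_le_trans (archi_boundP (ltW q0))); rewrite ler_nat -addn2 leq_addr.
Qed.

Lemma scale_pow (q S D : R) : 0 < S -> 0 <= D -> D `^ q = S `^ q * (D / S) `^ q.
Proof. by move=> S0 D0; rewrite -powRM ?divr_ge0 ?(ltW S0)// mulrC divfK ?gt_eqF. Qed.

End powers.

Section khintchine.
Context {R : realType} {I : finType}.
Implicit Types (x : nat -> I -> R) (v w : I -> R) (b : nat -> bool).

(** The terms are vectors over a finite index type so that complex numbers, and finite families of
    them, are covered through their real and imaginary parts. *)
Definition rsum (J : nat) x b (i : I) : R := \sum_(j < J) (-1) ^+ b j * x j i.
Definition nrm2 v : R := \sum_i v i ^+ 2.

Lemma nrm2_ge0 v : 0 <= nrm2 v.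
Proof. by apply: sumr_ge0 => i _; exact: sqr_ge0. Qed.

Lemma cauchy_schwarz v w : (\sum_i v i * w i) ^+ 2 <= nrm2 v * nrm2 w.
Proof.
set t := \sum_i _; have [w0|w0] := eqVneq (nrm2 w) 0.
  suff -> : t = 0 by rewrite expr0n/= w0 mulr0.
  apply: big1 => i _; suff -> : w i = 0 by rewrite mulr0.
  have /eqP := w0; rewrite /nrm2 psumr_eq0 => [/allP/(_ i)|j _]; last exact: sqr_ge0.
  by rewrite mem_index_enum sqrf_eq0 => /(_ isT)/eqP.
have wp : 0 < nrm2 w by rewrite lt_neqAle eq_sym w0 nrm2_ge0.
have : 0 <= \sum_i (nrm2 w * v i - t * w i) ^+ 2.
  by apply: sumr_ge0 => i _; exact: sqr_ge0.
have -> : \sum_i (nrm2 w * v i - t * w i) ^+ 2 =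
    nrm2 w * (nrm2 v * nrm2 w - t ^+ 2).
  transitivity (\sum_i (nrm2 w ^+ 2 * v i ^+ 2 +
    (- (2 * nrm2 w * t)) * (v i * w i) + t ^+ 2 * w i ^+ 2)).
    by apply: eq_bigr => i _; ring.
  by rewrite !big_split/= -!mulr_sumr -/(nrm2 v) -/(nrm2 w) -/t; ring.
by rewrite pmulr_rge0// subr_ge0.
Qed.

Let dot v w : R := \sum_i v i * w i.

Let rsumS J x b c i : rsum J.+1 x (upd b J c) i = rsum J x b i + (-1) ^+ c * x J i.
Proof.
rewrite /rsum big_ord_recr/= upd_eq; congr (_ + _).
by apply: eq_bigr => j _; rewrite upd_lt.
Qed.

Let nrm2_step J x b c : nrm2 (rsum J.+1 x (upd b J c)) =
  nrm2 (rsum J x b) + nrm2 (x J) + (-1) ^+ c * (2 * dot (rsum J x b) (x J)).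
Proof.
rewrite /nrm2 /dot !mulr_sumr -!big_split/=; apply: eq_bigr => i _.
by rewrite rsumS sqrrD exprMn sqrr_sign mul1r -mulr_natl; ring.
Qed.

(** The cross terms for the two choices of the last sign cancel. *)
Lemma rsum_second_moment J x :
  \sum_(b <- signs J) nrm2 (rsum J x b) = 2 ^+ J * \sum_(j < J) nrm2 (x j).
Proof.
elim: J => [|J IH].
  rewrite big_seq1 big_ord0 mulr0; apply: big1 => i _.
  by rewrite /rsum big_ord0 expr0n.
rewrite sum_signsS; under eq_bigr => b _.
  rewrite !nrm2_step (_ : _ + _ = 2 * nrm2 (rsum J x b) + 2 * nrm2 (x J)); last by rewrite expr1 expr0; ring.
  over.
rewrite big_split/= -!mulr_sumr IH sum_signs_cst big_ord_recr/= exprS.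
by rewrite -[nrm2 (x J) *+ _]mulr_natr natrX; ring.
Qed.

(** After [two_point] the binomial expansion involves all moments of order at most r of the shorter
    sum. The induction therefore treats them together, with a constant depending on [r0] alone, and
    the bounds recombine by the binomial formula. *)
Lemma rsum_moment (r0 : nat) J x r : (r <= r0)%N ->
  \sum_(b <- signs J) nrm2 (rsum J x b) ^+ r
    <= 2 ^+ J * ((1 + 2 ^+ r0.+2) * \sum_(j < J) nrm2 (x j)) ^+ r.
Proof.
set c : R := 1 + _; have c1 : 1 <= c by rewrite lerDl exprn_ge0.
elim: J r => [r _|J IH r rr0].
  rewrite big_seq1 big_ord0 mulr0 mul1r /nrm2 big1// => i _.
  by rewrite /rsum big_ord0 expr0n.
set S := \sum_(j < J) _ in IH; set y := nrm2 (x J).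
have y0 : 0 <= y by exact: nrm2_ge0.
have S0 : 0 <= S by apply: sumr_ge0 => j _; exact: nrm2_ge0.
rewrite sum_signsS.
apply: (@le_trans _ _ (\sum_(b <- signs J) 2 * (nrm2 (rsum J x b) + c * y) ^+ r)).
  apply: ler_sum => b _; rewrite !nrm2_step expr1 expr0 mulN1r mul1r -/y.
  set a := nrm2 (rsum J x b); have a0 : 0 <= a by exact: nrm2_ge0.
  have t2 := cauchy_schwarz (rsum J x b) (x J); rewrite -/a -/y -/(dot _ _) in t2.
  set t := dot _ _ in t2 *.
  rewrite addrC; apply: le_trans (@two_point _ (a + y) y (2 * t) r _ _ _ _) _ => //.
  - exact: addr_ge0.
  - rewrite -ler_sqr ?nnegrE ?addr_ge0// real_normK ?num_real//.
    by have := sqr_ge0 (a - y); nra.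
  - by have := sqr_ge0 y; nra.
  rewrite ler_wpM2l//; apply: lerXn2r; rewrite ?nnegrE.
  - by rewrite !addr_ge0// mulr_ge0// exprn_ge0.
  - by rewrite addr_ge0// mulr_ge0// (le_trans ler01 c1).
  rewrite -addrA lerD2l /c mulrDl mul1r lerD2l ler_wpM2r//.
  by rewrite ler_weXn2l ?ltnS//; lra.
rewrite -mulr_sumr; under eq_bigr do rewrite addrC exprDn.
rewrite exchange_big/= [in leRHS]big_ord_recr/= -/S -/y exprS -mulrA ler_wpM2l//.
apply: (@le_trans _ _ (\sum_(i < r.+1)
   2 ^+ J * (((c * y) ^+ (r - i) * (c * S) ^+ i) *+ 'C(r, i)))).
  apply: ler_sum => i _; rewrite -mulrnAr; under eq_bigr do rewrite -mulr_natr -mulrA.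
  rewrite -mulr_sumr mulrnAr -mulrnAr mulrCA.
  rewrite ler_wpM2l ?exprn_ge0 ?mulr_ge0 ?(le_trans ler01 c1)//.
  rewrite -mulr_suml -[X in _ <= _ * X]mulr_natr [leRHS]mulrA.
  by rewrite ler_wpM2r// IH// (leq_trans _ rr0)// -ltnS ltn_ord.
rewrite -mulr_sumr -exprDn ler_wpM2l ?exprn_ge0//.
by rewrite -mulrDr addrC.
Qed.

Lemma rsum_eq0 J x b : \sum_(j < J) nrm2 (x j) = 0 -> nrm2 (rsum J x b) = 0.
Proof.
move=> /eqP; rewrite psumr_eq0 => [/allP h|j _]; last exact: nrm2_ge0.
rewrite /nrm2 big1// => i _; rewrite /rsum big1 ?expr0n// => j _.
have := h j (mem_index_enum _); rewrite /nrm2 psumr_eq0 => [/allP/(_ i)|k _]; last exact: sqr_ge0.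
by rewrite mem_index_enum sqrf_eq0 => /(_ isT)/eqP ->; rewrite mulr0.
Qed.

End khintchine.

(** Divide by S, the sum of the squared norms, and bound the q-th power by 1 plus an integer power
    of order at least q, which [rsum_moment] controls. *)
Lemma khintchine_upper {R : realType} (q : R) : 0 < q -> exists2 B : R, 0 < B &
  forall (I : finType) J (x : nat -> I -> R), \sum_(b <- signs J) nrm2 (rsum J x b) `^ q
    <= B * 2 ^+ J * (\sum_(j < J) nrm2 (x j)) `^ q.
Proof.
move=> q0; have [r qr] := nat_bound q0.
set c : R := 1 + 2 ^+ r.+4; have c0 : 0 < c by rewrite ltr_pwDl// exprn_ge0.
exists (1 + c ^+ r.+2) => [|I J x]; first by rewrite ltr_pwDl// exprn_ge0// ltW.
set S := \sum_(j < J) _; have S0 : 0 <= S by apply: sumr_ge0 => j _; exact: nrm2_ge0.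
have [SE|Sn] := eqVneq S 0.
  rewrite SE powR0 ?gt_eqF// mulr0 big1// => b _.
  by rewrite rsum_eq0// powR0// gt_eqF.
have Sp : 0 < S by rewrite lt_neqAle eq_sym Sn.
under eq_bigr do rewrite (@scale_pow _ q S)// ?nrm2_ge0//.
rewrite -mulr_sumr mulrC ler_wpM2r ?powR_ge0//.
apply: (@le_trans _ _ (\sum_(b <- signs J) (1 + (nrm2 (rsum J x b) / S) ^+ r.+2))).
  by apply: ler_sum => b _; apply: powR_le_exprn; rewrite ?(ltW q0)// divr_ge0 ?nrm2_ge0.
rewrite big_split/= sum_signs_cst mulrDl mul1r lerD//; first by rewrite natrX.
under eq_bigr do rewrite expr_div_n.
rewrite -mulr_suml ler_pdivrMr ?exprn_gt0//.
apply: (le_trans (@rsum_moment _ _ r.+2 J x r.+2 (leqnn _))).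
by rewrite -/c -/S exprMn [c ^+ _ * 2 ^+ _]mulrC mulrA.
Qed.

(** Divided by S, the squared norms average exactly to 1. In [le_powR_exprn] the constant
    contributes 1/4 and the choice of [M] keeps the high power below another 1/4, so the q-th powers
    must supply the remaining half; hence the factor 2. *)
Lemma khintchine_lower {R : realType} (q : R) : 0 < q -> exists2 B : R, 0 < B &
  forall (I : finType) J (x : nat -> I -> R), 2 ^+ J * (\sum_(j < J) nrm2 (x j)) `^ q
    <= B * \sum_(b <- signs J) nrm2 (rsum J x b) `^ q.
Proof.
move=> q0; pose r := 0%N.
set c : R := 1 + 2 ^+ r.+4; have c1 : 1 <= c by rewrite lerDl exprn_ge0.
pose M := 4 * c ^+ r.+2; have M1 : 1 <= M.
  by have : 1 <= c ^+ r.+2 by [exact: exprn_ege1]; rewrite /M; lra.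
exists (2 * (M * 4 `^ q)) => [|I J x].
  by rewrite !mulr_gt0 ?powR_gt0//; lra.
set S := \sum_(j < J) _; have S0 : 0 <= S by apply: sumr_ge0 => j _; exact: nrm2_ge0.
have M0 : 0 < M by lra.
have [SE|Sn] := eqVneq S 0.
  rewrite SE powR0 ?gt_eqF// mulr0 mulr_ge0//; last by apply: sumr_ge0 => *; exact: powR_ge0.
  by apply: mulr_ge0 => //; apply: mulr_ge0; [exact: ltW|exact: powR_ge0].
have Sp : 0 < S by rewrite lt_neqAle eq_sym Sn.
under eq_bigr do rewrite (@scale_pow _ q S)// ?nrm2_ge0//.
rewrite -mulr_sumr mulrCA [leLHS]mulrC ler_wpM2l ?powR_ge0//.
have : \sum_(b <- signs J) nrm2 (rsum J x b) / S <= \sum_(b <- signs J)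
    (4^-1 + M * 4 `^ q * (nrm2 (rsum J x b) / S) `^ q
     + (nrm2 (rsum J x b) / S) ^+ r.+2 / M).
  by apply: ler_sum => b _; apply: le_powR_exprn => //; rewrite divr_ge0// nrm2_ge0.
rewrite !big_split/= sum_signs_cst -mulr_sumr -!mulr_suml rsum_second_moment mulfK//.
under [X in _ + X / M]eq_bigr do rewrite expr_div_n.
rewrite -mulr_suml => h.
have h2 : (\sum_(b <- signs J) nrm2 (rsum J x b) ^+ r.+2) / S ^+ r.+2 / M <= 2 ^+ J / 4.
  rewrite !ler_pdivrMr ?exprn_gt0//; apply: (le_trans (@rsum_moment _ _ r.+2 J x r.+2 (leqnn _))).
  by rewrite -/c -/S exprMn /M (_ : 2 ^+ J / 4 * (4 * c ^+ r.+2) * S ^+ r.+2 =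
    2 ^+ J * (c ^+ r.+2 * S ^+ r.+2))//; field.
move: h; rewrite -[4^-1 *+ _]mulr_natr natrX.
set s := \sum_(b <- _) _ `^ q; move: h2; set u := _ / M; set v := 2 ^+ J; lra.
Qed.

(** * The squared modulus of complex numbers *)

Section complex_modulus.
Context {R : realType}.
Implicit Types z w : R[i].

(** |z|^p is written [sqc z ^ (p / 2)] throughout, which is where the exponent q = p / 2 originates;
    [sqc] is a polynomial in the two parts, hence measurable and easy to sum over signs. *)
Definition sqc z : R := complex.Re z ^+ 2 + complex.Im z ^+ 2.

Lemma sqc_ge0 z : 0 <= sqc z.
Proof. by rewrite addr_ge0 ?sqr_ge0. Qed.

Lemma normcE z : normc z = Num.sqrt (sqc z).
Proof. by case: z. Qed.

Lemma normc_ge0 z : 0 <= normc z.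
Proof. by rewrite normcE sqrtr_ge0. Qed.

Lemma sqr_normc z : normc z ^+ 2 = sqc z.
Proof. by rewrite normcE sqr_sqrtr ?sqc_ge0. Qed.

Lemma sqcM z w : sqc (z * w) = sqc z * sqc w.
Proof. by rewrite -!sqr_normc normcM exprMn. Qed.

Lemma normcD z w : normc (z + w) <= normc z + normc w.
Proof. exact: (@le_normcD R). Qed.

Lemma normc_opp z : normc (- z) = normc z.
Proof. exact: (@normcN R). Qed.

Lemma normc_eq0 z : (normc z == 0) = (z == 0).
Proof. by apply/eqP/eqP => [/eq0_normc//|->]; rewrite normc0. Qed.

Lemma normc_realE (r : R) : normc r%:C = `|r|.
Proof. by rewrite /= expr0n/= addr0 sqrtr_sqr. Qed.

Lemma normc_real (r : R) : 0 <= r -> normc r%:C = r.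
Proof. by rewrite normc_realE => /ger0_norm. Qed.

Lemma normr_Re_le z : `|complex.Re z| <= normc z.
Proof. by rewrite normcE -sqrtr_sqr ler_wsqrtr// lerDl sqr_ge0. Qed.

Lemma normr_Im_le z : `|complex.Im z| <= normc z.
Proof. by rewrite normcE -sqrtr_sqr ler_wsqrtr// lerDr sqr_ge0. Qed.

Lemma normc_le_ReIm z : normc z <= `|complex.Re z| + `|complex.Im z|.
Proof.
rewrite -ler_sqr ?nnegrE ?normc_ge0 ?addr_ge0// sqr_normc /sqc.
rewrite -[complex.Re z ^+ 2]real_normK ?num_real// -[complex.Im z ^+ 2]real_normK ?num_real//.
by rewrite sqrrD; have := mulr_ge0 (normr_ge0 (complex.Re z)) (normr_ge0 (complex.Im z)); lra.
Qed.

Lemma ReD z w : complex.Re (z + w) = complex.Re z + complex.Re w.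
Proof. by case: z w => [a b] [c d]. Qed.

Lemma ImD z w : complex.Im (z + w) = complex.Im z + complex.Im w.
Proof. by case: z w => [a b] [c d]. Qed.

Lemma ReN z : complex.Re (- z) = - complex.Re z.
Proof. by case: z. Qed.

Lemma ImN z : complex.Im (- z) = - complex.Im z.
Proof. by case: z. Qed.

Lemma Re_sum (I : Type) (s : seq I) (P : pred I) (F : I -> R[i]) :
  complex.Re (\sum_(i <- s | P i) F i) = \sum_(i <- s | P i) complex.Re (F i).
Proof. by apply: (big_morph (@complex.Re R)) => //; exact: ReD. Qed.

Lemma Im_sum (I : Type) (s : seq I) (P : pred I) (F : I -> R[i]) :
  complex.Im (\sum_(i <- s | P i) F i) = \sum_(i <- s | P i) complex.Im (F i).
Proof. by apply: (big_morph (@complex.Im R)) => //; exact: ImD. Qed.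

Lemma sqcD_le z w : sqc (z + w) <= 2 * sqc z + 2 * sqc w.
Proof.
rewrite /sqc ReD ImD; have := sqr_ge0 (complex.Re z - complex.Re w).
by have := sqr_ge0 (complex.Im z - complex.Im w); lra.
Qed.

Lemma sqcN z : sqc (- z) = sqc z.
Proof. by rewrite /sqc ReN ImN !sqrrN. Qed.

Lemma sqc_real (r : R) : sqc r%:C = r ^+ 2.
Proof. by rewrite /sqc /= expr0n/= addr0. Qed.

Lemma sqc_cvg (z : nat -> R[i]) (y : R[i]) (K : R) :
  (forall j, normc (z j) <= K * 2^-1 ^+ j) -> sqc (y - z j) @[j --> \oo] --> sqc y.
Proof.
move=> zK; rewrite /sqc; apply: cvgD; rewrite !expr2.
  have : complex.Re (y - z j) @[j --> \oo] --> complex.Re y; last by move=> h; exact: cvgM.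
  apply: (@cvgn_geometric_bound _ _ _ K) => j; apply: le_trans (zK j).
  by rewrite ReD ReN addrAC subrr add0r normrN normr_Re_le.
have : complex.Im (y - z j) @[j --> \oo] --> complex.Im y; last by move=> h; exact: cvgM.
apply: (@cvgn_geometric_bound _ _ _ K) => j; apply: le_trans (zK j).
by rewrite ImD ImN addrAC subrr add0r normrN normr_Im_le.
Qed.

Lemma fast_cauchyC (u : nat -> R[i]) (K : R) :
  (forall n, normc (u n.+1 - u n) <= K * 2^-1 ^+ n) ->
  exists l, forall n, normc (u n - l) <= 4 * K * 2^-1 ^+ n.
Proof.
move=> h.
have [a ha] : exists a, forall n, `|complex.Re (u n) - a| <= 2 * K * 2^-1 ^+ n.
  apply: fast_cauchy => n; apply: (le_trans _ (h n)).
  by rewrite -ReN -ReD normr_Re_le.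
have [b hb] : exists b, forall n, `|complex.Im (u n) - b| <= 2 * K * 2^-1 ^+ n.
  apply: fast_cauchy => n; apply: (le_trans _ (h n)).
  by rewrite -ImN -ImD normr_Im_le.
exists (a +i* b) => n; apply: (le_trans (normc_le_ReIm _)).
rewrite ReD ImD ReN ImN/=; have := ha n; have := hb n; lra.
Qed.

End complex_modulus.

(** * Rearrangements with prescribed blocks *)

Section rearrangement.

Lemma sum_uniq_ord (V : nmodType) (t : seq nat) (m : nat) (F : nat -> V) :
  uniq t -> all (fun i => (i < m)%N) t ->
  \sum_(i <- t) F i = \sum_(i < m | val i \in t) F i.
Proof.
move=> ut tm; rewrite -(big_mkord (fun i => i \in t)) -big_filter.
apply: perm_big; apply: uniq_perm => //; first by rewrite filter_uniq// iota_uniq.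
move=> i; rewrite mem_filter mem_index_iota/=.
by have [it|//] := boolP (i \in t); rewrite (allP tm).
Qed.

(* A bijection of [nat] that lists, in the [j]-th block [[N j, N j.+1)], first
   the elements of [B j] and then the others. *)
Lemma block_bijection (N : nat -> nat) (B : nat -> pred nat) :
  N 0 = 0 -> (forall j, (N j < N j.+1)%N) ->
  exists s : nat -> nat, bijective s /\ forall j (V : nmodType) (u : nat -> V),
    let A := [seq k <- iota (N j) (N j.+1 - N j) | B j k] in
    \sum_(k < N j + size A) u (s k) = \sum_(k < N j) u (s k) + \sum_(k <- A) u k.
Proof.
move=> N0 NS.
have Nge j : (j <= N j)%N by elim: j => // j IH; exact: leq_ltn_trans (NS j).
pose A j := [seq k <- iota (N j) (N j.+1 - N j) | B j k].
pose A' j := [seq k <- iota (N j) (N j.+1 - N j) | ~~ B j k].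
pose F := fix F j := if j is j'.+1 then F j' ++ (A j' ++ A' j') else [::].
have pF j : perm_eq (F j) (iota 0 (N j)).
  elim: j => [|j IH]; first by rewrite N0.
  rewrite -(subnKC (ltnW (NS j))) iotaD add0n /= perm_cat//.
  exact: (permEl (perm_filterC _ _)).
have sF j : size (F j) = N j by rewrite (perm_size (pF j)) size_iota.
have uF j : uniq (F j) by rewrite (perm_uniq (pF j)) iota_uniq.
have mF j i : (i \in F j) = (i < N j)%N by rewrite (perm_mem (pF j)) mem_iota add0n.
have Fle j l i : (j <= l)%N -> (i < N j)%N -> nth 0%N (F l) i = nth 0%N (F j) i.
  move=> jl iN; elim: l jl => [|l IH]; first by rewrite leqn0 => /eqP ->.
  rewrite leq_eqVlt => /predU1P[-> //|]; rewrite ltnS => jl.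
  rewrite -IH//= nth_cat sF (leq_trans iN)//.
  have : {homo N : x y / (x <= y)%N} by apply: homo_leq => // [? ? ?|k]; [exact: leq_trans|exact: ltnW].
  exact.
(* [F i.+1] is long enough, as [i < i.+1 <= N i.+1], and by [Fle] every later list has the same
   entry at [i]. *)
pose s i := nth 0%N (F i.+1) i.
have sE j i : (i < N j)%N -> s i = nth 0%N (F j) i.
  move=> iN; rewrite /s; have [ij|/ltnW ji] := leqP i.+1 j.
    by rewrite -(Fle _ _ _ ij)//; exact: Nge.
  by rewrite (Fle _ _ _ ji).
have sinj : injective s.
  move=> i i'; pose j := maxn i.+1 i'.+1.
  have iN : (i < N j)%N by apply: leq_trans (Nge j); rewrite leq_maxl.
  have iN' : (i' < N j)%N by apply: leq_trans (Nge j); rewrite leq_maxr.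
  by rewrite !(sE j)// => /eqP; rewrite nth_uniq ?sF// => /eqP.
exists s; split.
  exists (fun k => index k (F k.+1)) => [i|k].
    apply: sinj; set k := s i.
    rewrite (sE k.+1) ?nth_index// ?mF ?Nge//.
    by rewrite -(sF k.+1) index_mem mF Nge.
  rewrite (sE k.+1) ?nth_index// ?mF ?Nge//.
  by rewrite -(sF k.+1) index_mem mF Nge.
move=> j V u /=; rewrite -/(A j).
have sA : (N j + size (A j) <= N j.+1)%N.
  rewrite -(sF j.+1)/= !size_cat sF leq_add2l leq_addr//.
have st m l : (m <= N l)%N -> \sum_(k < m) u (s k) = \sum_(k <- take m (F l)) u k.
  move=> mN; rewrite (big_nth 0%N) size_takel ?sF// big_mkord.
  apply: eq_bigr => k _; rewrite nth_take// (sE l)//.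
  exact: leq_trans (ltn_ord k) mN.
rewrite (st _ _ sA) (st _ j)//= take_cat sF ltnNge leq_addr/= addKn.
by rewrite take_cat ltnn subnn take0 cats0 take_oversize ?sF// big_cat.
Qed.

End rearrangement.

(** * Invariance of unconditional bases under identifications *)

Section basis_transfer.
Context {R : realType} {V V' : lmodType R[i]}.
Variables (X : set V) (N : V -> \bar R) (X' : set V') (N' : V' -> \bar R).
Variable Phi : {linear V -> V'}.
Hypothesis XX' : forall v, X' (Phi v) <-> X v.
Hypothesis onto : forall v', X' v' -> exists2 v, X v & Phi v = v'.
Hypothesis NN' : forall u : nat -> V,
  N' (Phi (u n)) @[n --> \oo] --> 0%E <-> N (u n) @[n --> \oo] --> 0%E.

Let sums_toE (e : nat -> V) (a : nat -> R[i]) x (s : nat -> nat) :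
  sums_to N' ((fun k => a k *: (Phi \o e) k) \o s) (Phi x) <->
  sums_to N ((fun k => a k *: e k) \o s) x.
Proof.
rewrite /sums_to -(NN' (fun n => x - \sum_(k < n) ((fun k => a k *: e k) \o s) k)).
suff h n : \sum_(k < n) ((fun k => a k *: (Phi \o e) k) \o s) k =
    Phi (\sum_(k < n) ((fun k => a k *: e k) \o s) k).
  by under eq_fun do rewrite h -linearB.
by rewrite linear_sum; apply: eq_bigr => k _ /=; rewrite linearZ.
Qed.

(** The norm enters the definition of a basis only through sequences tending to 0, so agreement on
    those is enough. It is applied to the inclusion of the type of L^p functions in all
    functions. *)
Lemma unconditional_basis_transfer (e : nat -> V) :
  is_unconditional_basis X N e <-> is_unconditional_basis X' N' (Phi \o e).
Proof.
split=> [[[eX eb] eu]|[[eX eb] eu]]; split.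
- split=> [k|x' X'x']; first exact/XX'.
  have [x Xx <-] := onto X'x'; have [a [ax aU]] := eb x Xx.
  exists a; split=> [|a' /(sums_toE e a' x id)]; first exact/(sums_toE e a x id).
  exact: aU.
- move=> x' a /onto[x Xx <-] /(sums_toE e a x id) h s bs.
  by apply/sums_toE; exact: eu.
- split=> [k|x Xx]; first exact/XX'/(eX k).
  have [a [ax aU]] := eb (Phi x) ((XX' x).2 Xx).
  exists a; split=> [|a' /(sums_toE e a' x id)]; first exact/(sums_toE e a x id).
  exact: aU.
- move=> x a /XX' Xx /(sums_toE e a x id) h s bs.
  by apply/sums_toE; exact: eu.
Qed.

End basis_transfer.

(** * A criterion for unconditional bases *)

Section seminorm.
Context {R : realType} {V : lmodType R[i]}.
Variable N : V -> R.
Hypothesis N0 : forall x, 0 <= N x.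
Hypothesis ND : forall x y, N (x + y) <= N x + N y.
Hypothesis NZ : forall a x, N (a *: x) = normc a * N x.

Let nE x := (N x)%:E.
Notation psum a e m b := (\sum_(k < m | b (val k)) a (val k) *: e (val k)).

Let Nzero : N 0 = 0.
Proof. by rewrite -(scale0r (0 : V)) NZ normc0 mul0r. Qed.

Let Nopp x : N (- x) = N x.
Proof. by rewrite -scaleN1r NZ normc_opp normc1 mul1r. Qed.

Let Nsub x y : N (x - y) <= N x + N y.
Proof. by rewrite -(Nopp y); exact: ND. Qed.

Let Nsum (I : Type) (s : seq I) (P : pred I) (F : I -> V) :
  N (\sum_(i <- s | P i) F i) <= \sum_(i <- s | P i) N (F i).
Proof.
elim/big_rec2: _ => [|i y x _ h]; first by rewrite Nzero.
by apply: (le_trans (ND _ _)); rewrite lerD2l.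
Qed.

Lemma sums_toP (u : nat -> V) x : sums_to nE u x <->
  forall eps : R, 0 < eps -> exists m, forall k, (m <= k)%N ->
    N (x - \sum_(i < k) u i) < eps.
Proof.
rewrite /sums_to; split=> [h eps e0|h].
  have /fine_cvgP[_ /cvgrPdist_lt/(_ _ e0)[m _ hm]] := h.
  exists m => k mk; have := hm k mk.
  by rewrite /= sub0r normrN ger0_norm.
apply/fine_cvgP; split; first exact: nearW.
apply/cvgrPdist_lt => eps e0; have [m hm] := h _ e0.
by exists m => // k mk; rewrite /= sub0r normrN ger0_norm// hm.
Qed.

Section sufficient_condition.
Variables (e : nat -> V) (C : R).
Hypothesis eN : forall k, 0 < N (e k).
Hypothesis C0 : 0 <= C.
Hypothesis Ce : forall (c : nat -> R[i]) m (b : pred nat),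
  N (psum c e m b) <= C * N (psum c e m xpredT).
Hypothesis dense : forall x (eps : R), 0 < eps -> exists c m,
  N (x - \sum_(k < m) c (val k) *: e (val k)) < eps.

Let coef_le (c : nat -> R[i]) m k : (k < m)%N ->
  normc (c k) * N (e k) <= C * N (psum c e m xpredT).
Proof.
move=> km; rewrite -NZ; apply: le_trans (Ce c m (pred1 k)).
by rewrite (big_pred1 (Ordinal km))//.
Qed.

Let psumB (c c' : nat -> R[i]) m b :
  psum c e m b - psum c' e m b = psum (fun k => c k - c' k) e m b.
Proof. by rewrite -sumrB; apply: eq_bigr => k _; rewrite scalerBl. Qed.

(** Approximants from the dense span have Cauchy coefficients, because the uniform bound applies to
    their differences. The limit coefficients work for every finite index set containing an initial
    segment; this yields convergence and all rearrangements at once. *)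
Let expansion x : exists c : nat -> R[i], forall eps : R, 0 < eps ->
  exists m0, forall m (b : pred nat), (m0 <= m)%N ->
    (forall k, (k < m0)%N -> b k) -> N (x - psum c e m b) <= eps.
Proof.
have half0 j : 0 < (2^-1 : R) ^+ j by rewrite exprn_gt0// invr_gt0.
have /choice[c0 hc0] j : exists c0 : (nat -> R[i]) * nat,
    N (x - \sum_(k < c0.2) c0.1 (val k) *: e (val k)) < 2^-1 ^+ j.
  by have [c [m h]] := dense x (half0 j); exists (c, m).
(* Padding by zeros lets approximants of different lengths be compared over a common range. *)
pose M j := (c0 j).2; pose c j k := if (k < M j)%N then (c0 j).1 k else 0.
have cM j m (b : pred nat) : (M j <= m)%N -> (forall k, (k < M j)%N -> b k) ->
    psum (c j) e m b = \sum_(k < M j) (c0 j).1 (val k) *: e (val k).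
  move=> Mm bM; rewrite (big_ord_widen_cond m xpredT (fun k => (c0 j).1 k *: e k))//=.
  rewrite big_mkcond [RHS]big_mkcond; apply: eq_bigr => k _.
  rewrite /c; case: ltnP => kM; first by rewrite bM.
  by rewrite scale0r if_same.
have hc j m (b : pred nat) : (M j <= m)%N -> (forall k, (k < M j)%N -> b k) ->
    N (x - psum (c j) e m b) < 2^-1 ^+ j by move=> ? ?; rewrite cM//; exact: hc0.
have diff j l m (b : pred nat) : (j <= l)%N -> N (psum (c l) e m b - psum (c j) e m b) <= C * (2 * 2^-1 ^+ j).
  move=> jl; pose m' := maxn m (maxn (M j) (M l)).
  have mm' : (m <= m')%N by rewrite leq_maxl.
  have jm' : (M j <= m')%N by rewrite leq_max leq_maxl orbT.
  have lm' : (M l <= m')%N by rewrite leq_max leq_maxr orbT.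
  rewrite psumB; pose a k := c l k - c j k.
  rewrite (big_ord_widen_cond m' (fun k => b k) (fun k => a k *: e k))//=.
  apply: (le_trans (Ce a m' (fun k => b k && (k < m)%N))); rewrite ler_wpM2l//.
  rewrite -(psumB (c l) (c j) m' xpredT) (_ : psum (c l) e m' xpredT - _ =
    (x - psum (c j) e m' xpredT) - (x - psum (c l) e m' xpredT)).
    apply: (le_trans (Nsub _ _)); rewrite mulr_natl mulr2n lerD//.
      exact/ltW/(hc j m' xpredT jm').
    apply: (le_trans (ltW (hc l m' xpredT lm' _))) => //.
    by rewrite ler_wiXn2l//; lra.
  by rewrite opprB [RHS]addrC subrKA.
have step k j : normc (c j.+1 k - c j k) <= (C * 2 / N (e k)) * 2^-1 ^+ j.
  have := diff j j.+1 k.+1 (pred1 k) (leqnSn j).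
  rewrite psumB (big_pred1 ord_max)//= NZ => h.
  by rewrite mulrAC ler_pdivlMr// -mulrA.
have /choice[a ha] k := fast_cauchyC (step k).
have lim j m (b : pred nat) : N (psum a e m b - psum (c j) e m b) <= C * (2 * 2^-1 ^+ j).
  apply/ler_addgt0Pl => eps eps0.
  (* For fixed [m] only finitely many coefficients occur, so a late approximant [l] replaces the
     limit up to [S * 2^-l]. *)
  pose S := \sum_(k < m | b (val k)) (4 * (C * 2 / N (e (val k)))) * N (e (val k)).
  have S0 : 0 <= S by apply: sumr_ge0 => k _; rewrite !mulr_ge0 ?invr_ge0// ltW.
  have [l hl] : exists l, S * 2^-1 ^+ l < eps.
    have : S * 2^-1 ^+ n @[n --> \oo] --> S * 0.
      by apply: cvgM; [exact: cvg_cst|apply: cvg_expr; rewrite ger0_norm; lra].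
    rewrite mulr0 => /cvgrPdist_lt/(_ _ eps0)[l _ hl]; exists l.
    have := hl l (leqnn _); rewrite /= sub0r normrN; apply: le_lt_trans; exact: ler_norm.
  pose l' := maxn j l.
  rewrite (_ : psum a e m b - _ = (psum a e m b - psum (c l') e m b) +
    (psum (c l') e m b - psum (c j) e m b)); last by rewrite addrA subrK.
  apply: (le_trans (ND _ _)); apply: lerD; last by apply: diff; rewrite leq_maxl.
  apply: le_trans (ltW hl); rewrite psumB; apply: (le_trans (Nsum _ _ _)).
  rewrite /S mulr_suml; apply: ler_sum => k _; rewrite NZ -normc_opp opprB.
  rewrite mulrAC ler_wpM2r//; apply: (le_trans (ha k l')).
  rewrite ler_wpM2l//; first by rewrite !mulr_ge0 ?invr_ge0// ltW.
  by rewrite ler_wiXn2l ?leq_maxr//; lra.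
exists a => eps eps0.
have [j hj] : exists j, (1 + C * 2) * 2^-1 ^+ j < eps.
  have : (1 + C * 2) * 2^-1 ^+ n @[n --> \oo] --> (1 + C * 2) * 0.
    by apply: cvgM; [exact: cvg_cst|apply: cvg_expr; rewrite ger0_norm; lra].
  rewrite mulr0 => /cvgrPdist_lt/(_ _ eps0)[l _ hl]; exists l.
  have := hl l (leqnn _); rewrite /= sub0r normrN; apply: le_lt_trans; exact: ler_norm.
exists (M j) => m b Mm bM; apply: le_trans (ltW hj).
rewrite (_ : x - _ = (x - psum (c j) e m b) - (psum a e m b - psum (c j) e m b)); last first.
  by rewrite opprB subrKA.
apply: (le_trans (Nsub _ _)); have := hc j m b Mm bM; have := lim j m b; lra.
Qed.

Lemma unconditional_basis_of_dense : is_unconditional_basis setT nE e.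
Proof.
have uniq_coef x a a' : sums_to nE (fun k => a k *: e k) x ->
    sums_to nE (fun k => a' k *: e k) x -> a = a'.
  move=> /sums_toP ha /sums_toP ha'; apply/funext => k.
  apply/eqP; rewrite -subr_eq0 -normc_eq0 eq_le normc_ge0 andbT.
  rewrite -(ler_pM2r (eN k)) mul0r.
  suff h (eps : R) : 0 < eps -> normc (a k - a' k) * N (e k) <= eps.
    by apply/ler_addgt0Pl => eps eps0; rewrite addr0 h.
  move=> eps0.
  have C1 : 0 < C + 1 by rewrite ltr_wpDl.
  (* Then C (2 eta) = C / (C + 1) eps <= eps; adding 1 avoids division by zero when C = 0. *)
  pose eta := eps / (2 * (C + 1)).
  have eta0 : 0 < eta by rewrite divr_gt0// mulr_gt0.
  have [m hm] := ha _ eta0; have [m' hm'] := ha' _ eta0.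
  pose l := maxn k.+1 (maxn m m').
  have kl : (k < l)%N by rewrite leq_max leqnn.
  have ml : (m <= l)%N by rewrite leq_max leq_maxl orbT.
  have ml' : (m' <= l)%N by rewrite leq_max leq_maxr orbT.
  have := @coef_le (fun k => a k - a' k) l k kl.
  rewrite -(psumB a a' l xpredT) => /le_trans; apply.
  rewrite (_ : psum a e l xpredT - _ = (x - psum a' e l xpredT) - (x - psum a e l xpredT)).
    apply: (@le_trans _ _ (C * (2 * eta))).
      rewrite ler_wpM2l//; apply: (le_trans (Nsub _ _)).
      by have := hm l ml; have := hm' l ml'; lra.
    rewrite /eta (_ : C * _ = C / (C + 1) * eps); last by field; lra.
    rewrite -[leRHS]mul1r; apply: ler_wpM2r; first exact/ltW.
    by rewrite ler_pdivrMr// mul1r lerDl.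
  by rewrite opprB [RHS]addrC subrKA.
have perm x a : (forall eps : R, 0 < eps -> exists m0, forall m (b : pred nat),
    (m0 <= m)%N -> (forall k, (k < m0)%N -> b k) -> N (x - psum a e m b) <= eps) ->
    unconditionally_sums_to nE (fun k => a k *: e k) x.
  move=> h s [g gs sg]; apply/sums_toP => eps eps0.
  have [m0 hm0] := h (eps / 2) (divr_gt0 eps0 (ltr0n _ 2)).
  (* [g] inverts [s]: from this point on, the first [k] values of [s] include all indices below
     [m0]. *)
  exists (\max_(i < m0) (g i).+1) => k hk.
  pose t := [seq s i | i <- iota 0 k].
  have ut : uniq t by rewrite map_inj_uniq ?iota_uniq//; exact: can_inj gs.
  pose m := maxn m0 (\max_(i <- t) i.+1).
  have tm : all (fun i => (i < m)%N) t.
    apply/allP => i it; rewrite leq_max; apply/orP; right.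
    by rewrite (big_rem i it)/= leq_max leqnn.
  rewrite (_ : \sum_(i < k) _ = psum a e m (fun i => i \in t)).
    apply: (@le_lt_trans _ _ (eps / 2)); last by lra.
    apply: hm0; first by rewrite leq_maxl.
    move=> i im0; apply/mapP; exists (g i); rewrite ?sg// mem_iota add0n.
    by apply: leq_trans hk; exact: (leq_bigmax (Ordinal im0)).
  rewrite -(sum_uniq_ord (fun i => a i *: e i) ut tm) big_map.
  by rewrite -[k in iota 0 k]subn0 big_mkord.
have ids : bijective (@id nat) by exists id.
split; first split=> // x _.
  have [a ha] := expansion x; exists a.
  have sa : sums_to nE (fun k => a k *: e k) x by exact: (perm x a ha id ids).
  by split => // a' sa'; exact: uniq_coef sa sa'.
move=> x a _ sa; have [a' ha'] := expansion x.
have sa' : sums_to nE (fun k => a' k *: e k) x by exact: (perm x a' ha' id ids).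
by rewrite (uniq_coef _ _ _ sa sa'); exact: perm.
Qed.

End sufficient_condition.
End seminorm.

(** * Uniform boundedness of the coordinate projections *)

Section uniform_bound.
Context {R : realType} {V : lmodType R[i]}.
Variable N : V -> R.
Hypothesis N0 : forall x, 0 <= N x.
Hypothesis ND : forall x y, N (x + y) <= N x + N y.
Hypothesis NZ : forall a x, N (a *: x) = normc a * N x.
Hypothesis Ncomplete : forall u : nat -> V,
  (forall k, N (u k.+1 - u k) <= 4^-1 ^+ k) ->
  exists y, forall eps : R, 0 < eps ->
    exists m, forall k, (m <= k)%N -> N (y - u k) < eps.
Variable e : nat -> V.
Hypothesis basis_e : is_unconditional_basis setT (fun x => (N x)%:E) e.

Notation psum a m b := (\sum_(k < m | b (val k)) a (val k) *: e (val k)).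
Notation sums := (sums_to (fun x => (N x)%:E)).

Let Nzero : N 0 = 0.
Proof. by rewrite -(scale0r (0 : V)) NZ normc0 mul0r. Qed.

Let Nopp x : N (- x) = N x.
Proof. by rewrite -scaleN1r NZ normc_opp normc1 mul1r. Qed.

Let Nsub x y : N (x - y) <= N x + N y.
Proof. by rewrite -(Nopp y); exact: ND. Qed.

Let Nsum (I : Type) (s : seq I) (P : pred I) (F : I -> V) :
  N (\sum_(i <- s | P i) F i) <= \sum_(i <- s | P i) N (F i).
Proof.
elim/big_rec2: _ => [|i y x _ h]; first by rewrite Nzero.
by apply: (le_trans (ND _ _)); rewrite lerD2l.
Qed.

Let small (K eps : R) : 0 < eps -> exists j, K * 4^-1 ^+ j < eps.
Proof.
move=> eps0; have : K * 4^-1 ^+ n @[n --> \oo] --> K * 0.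
  by apply: cvgM; [exact: cvg_cst|apply: cvg_expr; rewrite ger0_norm; lra].
rewrite mulr0 => /cvgrPdist_lt/(_ _ eps0)[l _ hl]; exists l.
have := hl l (leqnn _); rewrite /= sub0r normrN; apply: le_lt_trans; exact: ler_norm.
Qed.

Lemma exists_coef : exists a : V -> nat -> R[i],
  (forall x, sums (fun k => a x k *: e k) x) /\
  (forall x c, sums (fun k => c k *: e k) x -> c = a x).
Proof.
have /choice[a ha] x : exists a : nat -> R[i], sums (fun k => a k *: e k) x /\
    forall c, sums (fun k => c k *: e k) x -> c = a.
  have [a [h u]] := basis_e.1.2 x I; exists a; split => // c hc.
  by rewrite (u _ hc).
by exists a; split=> x; [exact: (ha x).1|exact: (ha x).2].
Qed.

Variable a : V -> nat -> R[i].
Hypothesis a_sums : forall x, sums (fun k => a x k *: e k) x.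
Hypothesis a_unique : forall x c, sums (fun k => c k *: e k) x -> c = a x.

Let sumsP u x := sums_toP N0 u x.

Lemma coefD x y k : a (x + y) k = a x k + a y k.
Proof.
suff -> : a (x + y) = (fun k => a x k + a y k) by [].
apply/esym/a_unique/sumsP => eps eps0.
have e2 : 0 < eps / 2 by lra.
have /sumsP/(_ _ e2)[m hm] := a_sums x; have /sumsP/(_ _ e2)[m' hm'] := a_sums y.
exists (maxn m m') => j; rewrite geq_max => /andP[mj mj'].
under eq_bigr do rewrite scalerDl.
rewrite big_split/= opprD addrACA; apply: (le_lt_trans (ND _ _)).
by have := hm _ mj; have := hm' _ mj'; lra.
Qed.

Lemma coefZ c x k : a (c *: x) k = c * a x k.
Proof.
suff -> : a (c *: x) = (fun k => c * a x k) by [].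
apply/esym/a_unique/sumsP => eps eps0.
have c1 : 0 < normc c + 1 by rewrite ltr_wpDl// normc_ge0.
have /sumsP/(_ _ (divr_gt0 eps0 c1))[m hm] := a_sums x.
exists m => j mj; under eq_bigr do rewrite -scalerA.
rewrite -scaler_sumr -scalerBr NZ.
have := hm j mj; rewrite ltr_pdivlMr//; apply: le_lt_trans.
by rewrite mulrC ler_wpM2l// lerDl.
Qed.

Lemma coefN x k : a (- x) k = - a x k.
Proof. by rewrite -scaleN1r coefZ mulN1r. Qed.

Lemma coef0 k : a 0 k = 0.
Proof. by rewrite -(scale0r (0 : V)) coefZ mul0r. Qed.

Lemma coef_sum (I : Type) (s : seq I) (F : I -> V) k :
  a (\sum_(i <- s) F i) k = \sum_(i <- s) a (F i) k.
Proof.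
elim: s => [|i s IH]; first by rewrite !big_nil coef0.
by rewrite !big_cons coefD IH.
Qed.

Lemma coef_basis j k : a (e j) k = (j == k)%:R.
Proof.
suff -> : a (e j) = (fun k => (j == k)%:R) by [].
apply/esym/a_unique/sumsP => eps eps0; exists j.+1 => m jm.
rewrite (bigD1 (Ordinal jm))//= eqxx scale1r big1 ?addr0 ?subrr ?Nzero// => i.
by rewrite -val_eqE/= eq_sym => /negbTE ->; rewrite scale0r.
Qed.

(** A basis vector of seminorm 0 would give 0 a second expansion, with coefficient 1 at [k]. *)
Lemma basis_norm_gt0 k : 0 < N (e k).
Proof.
rewrite lt_neqAle N0 andbT eq_sym; apply/eqP => ek.
have : (fun j => (j == k)%:R : R[i]) = a 0.
  apply/a_unique/sumsP => eps eps0; exists 0%N => m _.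
  rewrite sub0r Nopp; apply: le_lt_trans eps0; apply: (le_trans (Nsum _ _ _)).
  apply: sumr_le0 => i _; rewrite NZ; have [->|ik] := eqVneq (val i) k.
    by rewrite ek mulr0.
  by rewrite normc0 mul0r.
move=> /(congr1 (@^~ k)); rewrite eqxx coef0 => /eqP.
by rewrite oner_eq0.
Qed.

Let bounded x (K : R) := forall m (b : pred nat), N (psum (a x) m b) <= K.

(** Otherwise there are infinitely many disjoint blocks with sums larger than [eps]; a rearrangement
    listing each of them consecutively would not be Cauchy. *)
Let tail_small x (eps : R) : 0 < eps -> exists m0, forall m (b : pred nat),
  (forall k, b k -> (m0 <= k)%N) -> N (psum (a x) m b) <= eps.
Proof.
move=> eps0; apply: contrapT => /forallNP h.
have /choice[w hw] m0 : exists w : nat * pred nat,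
    (forall k, w.2 k -> (m0 <= k)%N) /\ eps < N (psum (a x) w.1 w.2).
  have /existsNP[m /existsNP[b /not_implyP[bm /negP]]] := h m0.
  by rewrite -ltNge => ?; exists (m, b).
(* Each bad block is sought beyond the end of the preceding one. *)
pose M := fix M j := if j is j'.+1 then (w (M j')).1 else 0%N.
pose B j := (w (M j)).2.
have B1 j k : B j k -> (M j <= k)%N by exact: (hw (M j)).1.
have MS j : (M j < M j.+1)%N.
  rewrite ltnNge; apply/negP => Mj; have := (hw (M j)).2.
  rewrite big1 ?Nzero => [|k /B1]; first by rewrite ltNge ltW.
  by rewrite leqNgt (leq_trans (ltn_ord k) Mj).
have Mge j : (j <= M j)%N by elim: j => // j IH; exact: leq_ltn_trans (MS j).
have [s [bs hs]] := @block_bijection M B erefl MS.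
have /sumsP/(_ _ (divr_gt0 eps0 (ltr0n _ 2)))[j hj] :=
  basis_e.2 x (a x) I (a_sums x) s bs.
pose A := [seq k <- iota (M j) (M j.+1 - M j) | B j k].
have hA : \sum_(k < M j + size A) a x (s k) *: e (s k) =
    \sum_(k < M j) a x (s k) *: e (s k) + \sum_(k <- A) a x k *: e k.
  exact: (hs j V (fun k => a x k *: e k)).
have h1 := hj (M j) (Mge j).
have h2 := hj (M j + size A)%N (leq_trans (Mge j) (leq_addr _ _)).
have h3 := (hw (M j)).2.
suff E : psum (a x) (M j.+1) (B j) = \sum_(k <- A) a x k *: e k.
  move: h3; rewrite -/(B j) -[(w (M j)).1]/(M j.+1) E ltNge => /negP; apply.
  set s1 := \sum_(k < M j) _ in hA h1; set s2 := \sum_(k < _ + _) _ in hA h2.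
  rewrite (_ : \sum_(k <- A) _ = (x - s1) - (x - s2)).
    by apply: (le_trans (Nsub _ _)); move: h1 h2; rewrite /=; lra.
  by rewrite opprB [RHS]addrC subrKA hA addrAC subrr add0r.
rewrite (@sum_uniq_ord _ A (M j.+1)).
- apply: eq_bigl => k; rewrite mem_filter mem_iota subnKC ?(ltnW (MS j))// ltn_ord andbT.
  by have [/B1 ->|] := boolP (B j k).
- by rewrite filter_uniq// iota_uniq.
- by apply/allP => k; rewrite mem_filter mem_iota subnKC ?(ltnW (MS j))// => /and3P[].
Qed.

(** A small tail plus finitely many terms. [K] is a natural number so that countably many sets cover
    the space. *)
Let exists_bounded x : exists K : nat, bounded x K%:R.
Proof.
have [m0 hm0] := tail_small x ltr01.
pose S := \sum_(k < m0) N (a x k *: e k).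
have S0 : 0 <= S by apply: sumr_ge0.
exists (Num.bound (1 + S)) => m b; apply: (@le_trans _ _ (1 + S)); last first.
  by apply/ltW/archi_boundP; rewrite addr_ge0.
rewrite (bigID (fun k : 'I_m => (val k < m0)%N))/= addrC.
apply: (le_trans (ND _ _)); apply: lerD.
  by apply: (hm0 m (fun k => b k && ~~ (k < m0)%N)) => k; rewrite -leqNgt => /andP[].
apply: (le_trans (Nsum _ _ _)); pose m' := maxn m m0.
pose F k := N (a x k *: e k).
rewrite (big_ord_widen_cond m' (fun k => b k && (k < m0)%N) F) ?leq_maxl//.
rewrite /S (big_ord_widen_cond m' xpredT F) ?leq_maxr//=.
rewrite [leLHS]big_mkcond [leRHS]big_mkcond; apply: ler_sum => k _ /=.
case: (k < m0)%N; rewrite ?andbT ?andbF//=; case: ifP => // _; exact: N0.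
Qed.

Let boundedB x y K L : bounded x K -> bounded y L -> bounded (x - y) (K + L).
Proof.
move=> hx hy m b; rewrite (_ : psum _ m b = psum (a x) m b - psum (a y) m b).
  by apply: (le_trans (Nsub _ _)); apply: lerD.
by rewrite -sumrB; apply: eq_bigr => k _; rewrite coefD coefN scalerBl.
Qed.

Let boundedD x y K L : bounded x K -> bounded y L -> bounded (x + y) (K + L).
Proof.
move=> hx hy m b; rewrite (_ : psum _ m b = psum (a x) m b + psum (a y) m b).
  by apply: (le_trans (ND _ _)); apply: lerD.
by rewrite -big_split; apply: eq_bigr => k _; rewrite coefD scalerDl.
Qed.

Let boundedZ c x K : bounded x K -> bounded (c *: x) (normc c * K).
Proof.
move=> hx m b; rewrite (_ : psum _ m b = c *: psum (a x) m b).
  by rewrite NZ ler_wpM2l ?normc_ge0.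
by rewrite scaler_sumr; apply: eq_bigr => k _; rewrite coefZ scalerA.
Qed.

(* Baire category argument: the sets [bounded^~ K] exhaust the space, so the
   closure of one of them contains a ball. *)
Let baire : exists (K : nat) x0 (r : R), 0 < r /\ forall x, N (x - x0) < r ->
  forall eps : R, 0 < eps -> exists y, bounded y K%:R /\ N (x - y) < eps.
Proof.
apply: contrapT => /forallNP h.
have /choice[f hf] (q : nat * V * R) : exists w : V * R, 0 < q.2 ->
    [/\ N (w.1 - q.1.2) < q.2, 0 < w.2 &
      forall y, bounded y q.1.1%:R -> w.2 <= N (w.1 - y)].
  have [q0|q0] := ltP 0 q.2; last by exists (0, 0).
  move/forallNP/(_ q.1.2)/forallNP/(_ q.2)/not_andP : (h q.1.1) => [//|].
  move=> /existsNP[x /not_implyP[xr /existsNP[eps /not_implyP[eps0 /forallNP hy]]]].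
  exists (x, eps) => _; split => // y by_; rewrite leNgt; apply/negP => ?.
  exact: (hy y).
(* Centres and radii of shrinking balls, the [j]-th step avoiding the vectors [bounded] by [j]. The
   factor 1/4 provides the rate required by [Ncomplete]; [w.2 / 2] keeps later balls away from the
   avoided set. *)
pose st := fix st j : V * R := if j is j'.+1 then
    let w := f (j', (st j').1, (st j').2) in
    (w.1, Num.min ((st j').2 / 4) (w.2 / 2))
  else (0, 1).
pose x j := (st j).1; pose r j := (st j).2.
have r0 j : 0 < r j.
  elim: j => [|j IH]; first exact: ltr01.
  have [_ d0 _] := hf (j, x j, r j) IH.
  by rewrite /r /= lt_min !divr_gt0.
have H j := hf (j, x j, r j) (r0 j).
have rS j : r j.+1 <= r j / 4 by rewrite /r /= ge_min lexx.
have xS j : N (x j.+1 - x j) < r j by have [] := H j.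
have r4 j : r j <= 4^-1 ^+ j.
  elim: j => [|j IH]; first by rewrite expr0.
  by rewrite exprS; have := rS j; lra.
(* As each radius is at most a quarter of the preceding one, r_k <= (4/3)(r_k - r_(k+1)), which
   telescopes. *)
have tel k i : N (x (k + i)%N - x k) <= 4 / 3 * (r k - r (k + i)%N).
  elim: i => [|i IH]; first by rewrite addn0 !subrr Nzero mulr0.
  rewrite addnS -[X in N X](subrKA (x (k + i)%N)).
  apply: (le_trans (ND _ _)); have := xS (k + i)%N; have := rS (k + i)%N; lra.
have [y hy] := Ncomplete (fun k => le_trans (ltW (xS k)) (r4 k)).
have [K hK] := exists_bounded y.
(* The limit [y] is bounded by [K], hence at distance at least [w.2] from the centre of stage [K];
   yet it lies within (4/3)(1/2) + 1/4 = 11/12 of [w.2]. *)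
have [_ d0 /(_ y hK)] := H K; set w := f _ in d0 * => wy.
have rK : r K.+1 <= w.2 / 2 by rewrite /r /= ge_min lexx orbT.
have [m hm] := hy (w.2 / 4) (divr_gt0 d0 (ltr0n _ 4)).
have t := tel K.+1 m; have h1 := hm (K.+1 + m)%N (leq_addl _ _).
have r1 := r0 (K.+1 + m)%N.
have : N (w.1 - y) <= N (x (K.+1 + m)%N - x K.+1) + N (y - x (K.+1 + m)%N).
  rewrite -Nopp opprB -[w.1]/(x K.+1) -(subrKA (x (K.+1 + m)%N) y) [leRHS]addrC.
  exact: ND.
lra.
Qed.

(** Subtracting approximants moves the ball to the origin and doubles the bound; scaling a vector of
    size [t] to size r/2 gives 2K * 2t/r, hence M = 4K/r. *)
Let approx : exists2 M : R, 0 <= M & forall x (t : R), 0 < t -> N x <= t ->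
  forall eps : R, 0 < eps -> exists y, bounded y (M * t) /\ N (x - y) < eps.
Proof.
have [K [x0 [r [r0 h]]]] := baire.
have h' x : N x < r -> forall eps : R, 0 < eps ->
    exists y, bounded y (K%:R + K%:R) /\ N (x - y) < eps.
  move=> xr eps eps0; have e2 : 0 < eps / 2 by lra.
  have [|y1 [b1 n1]] := h (x + x0) _ _ e2; first by rewrite addrK.
  have [|y2 [b2 n2]] := h x0 _ _ e2; first by rewrite subrr Nzero.
  exists (y1 - y2); split; first exact: boundedB.
  rewrite (_ : x - _ = (x + x0 - y1) - (x0 - y2)).
    by apply: (le_lt_trans (Nsub _ _)); lra.
  by rewrite [RHS]addrAC addrKA opprK opprB addrA.
exists (4 * K%:R / r) => [|x t t0 xt eps eps0]; first by rewrite divr_ge0 ?mulr_ge0// ltW.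
pose c := r / (2 * t); have c0 : 0 < c by rewrite divr_gt0// mulr_gt0.
have nc : normc (c%:C : R[i]) = c by apply: normc_real; exact: ltW.
have [|y [by_ ny]] := h' (c%:C *: x) _ (c * eps) (mulr_gt0 c0 eps0).
  rewrite NZ nc; apply: (@le_lt_trans _ _ (c * t)); first by rewrite ler_pM2l.
  by rewrite /c (_ : _ * t = r / 2); [lra|field; rewrite gt_eqF].
exists (c^-1%:C *: y); have ni : normc (c^-1%:C : R[i]) = c^-1.
  by apply: normc_real; rewrite invr_ge0 ltW.
split.
  have := @boundedZ c^-1%:C y _ by_; rewrite ni.
  rewrite (_ : c^-1 * _ = 4 * K%:R / r * t)// /c.
  by field; rewrite !gt_eqF.
have -> : x - c^-1%:C *: y = c^-1%:C *: (c%:C *: x - y).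
  by rewrite scalerBr scalerA -rmorphM/= mulVf ?gt_eqF// scale1r.
by rewrite NZ ni mulrC ltr_pdivrMr// mulrC.
Qed.

(** Successive approximation, as in the open mapping theorem: x is the limit of sums of vectors
    bounded by M t 4^-j. Continuity of the coefficients is not yet available, so those of the
    partial sums are shown to converge and uniqueness of expansions identifies the limit. *)
Lemma basis_projections_bounded : exists2 C : R, 0 <= C &
  forall x m (b : pred nat), N (psum (a x) m b) <= C * N x.
Proof.
have [M M0 hM] := approx; exists (2 * M); first by rewrite mulr_ge0.
suff key x (t : R) : 0 < t -> N x <= t -> bounded x (2 * M * t).
  move=> x m b; apply/ler_addgt0Pr => eps eps0.
  pose d := eps / (2 * M + 1); have m1 : 0 < 2 * M + 1 by rewrite ltr_wpDl// mulr_ge0.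
  have d0 : 0 < d by exact: divr_gt0.
  apply: (le_trans (@key x (N x + d) _ _ m b)); rewrite ?lerDl ?(ltW d0)// ?ltr_wpDl//.
  rewrite mulrDr lerD2l /d mulrA ler_pdivrMr// mulrC ler_wpM2l ?(ltW eps0)//.
  by rewrite lerDl.
move=> t0 xt.
have p4 j : 0 < (4^-1 : R) ^+ j by rewrite exprn_gt0// invr_gt0.
have /choice[g hg] (q : V * nat) : exists y, N q.1 <= t * 4^-1 ^+ q.2 ->
    bounded y (M * (t * 4^-1 ^+ q.2)) /\ N (q.1 - y) < t * 4^-1 ^+ q.2.+1.
  have [h|h] := leP (N q.1) (t * 4^-1 ^+ q.2); last by exists 0.
  have [y hy] := hM q.1 _ (mulr_gt0 t0 (p4 _)) h _ (mulr_gt0 t0 (p4 q.2.+1)).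
  by exists y.
pose z := fix z j := if j is j'.+1 then z j' + g (x - z j', j') else 0.
pose y j := g (x - z j, j).
have xz j : N (x - z j) <= t * 4^-1 ^+ j.
  elim: j => [|j IH]; first by rewrite /= subr0 mulr1.
  have [_ h] := hg (x - z j, j) IH.
  by rewrite /= opprD addrA; exact: ltW.
have yb j : bounded (y j) (M * (t * 4^-1 ^+ j)) by have [] := hg (x - z j, j) (xz j).
have zS j : z j.+1 = z j + y j by [].
(* The factor 2 absorbs the geometric sum 1/(1 - 1/4) = 4/3 and makes the bound telescope. *)
have zb j i : bounded (z (j + i)%N - z j) (2 * M * t * (4^-1 ^+ j - 4^-1 ^+ (j + i))).
  elim: i => [|i IH] m b.
    rewrite addn0 !subrr mulr0 big1 ?Nzero// => k _.
    by rewrite coef0 scale0r.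
  have := boundedD IH (yb (j + i)%N) m b.
  rewrite addnS zS addrAC => /le_trans; apply.
  by have := mulr_ge0 M0 (mulr_ge0 (ltW t0) (ltW (p4 (j + i)%N))); rewrite exprS; lra.
have Mt0 : 0 <= 2 * M * t by rewrite !mulr_ge0// ltW.
have zb' j l : (j <= l)%N -> bounded (z l - z j) (2 * M * t * 4^-1 ^+ j).
  move=> jl m b; rewrite -(subnKC jl); apply: (le_trans (zb _ _ _ _)).
  by rewrite ler_wpM2l// gerBl ltW.
have zcoef k j : normc (a (z j.+1) k - a (z j) k) <= 2 * M * t / N (e k) * 2^-1 ^+ j.
  have := zb' j j.+1 (leqnSn _) k.+1 (pred1 k).
  rewrite (big_pred1 ord_max)//= NZ coefD coefN -zS => h.
  rewrite mulrAC ler_pdivlMr ?basis_norm_gt0//; apply: (le_trans h).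
  by rewrite ler_wpM2l// lerXn2r ?nnegrE; lra.
have /choice[c hc] k := fast_cauchyC (zcoef k).
have lim j m b : N (psum c m b - psum (a (z j)) m b) <= 2 * M * t * 4^-1 ^+ j.
  apply/ler_addgt0Pl => eps eps0.
  pose S := \sum_(k < m | b (val k)) (4 * (2 * M * t / N (e (val k)))) * N (e (val k)).
  have S0 : 0 <= S.
    apply: sumr_ge0 => k _; apply: mulr_ge0 => //; apply: mulr_ge0 => //.
    by rewrite divr_ge0.
  have [l hl] : exists l, S * 2^-1 ^+ l < eps.
    have : S * 2^-1 ^+ n @[n --> \oo] --> S * 0.
      by apply: cvgM; [exact: cvg_cst|apply: cvg_expr; rewrite ger0_norm; lra].
    rewrite mulr0 => /cvgrPdist_lt/(_ _ eps0)[l _ hl]; exists l.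
    have := hl l (leqnn _); rewrite /= sub0r normrN; apply: le_lt_trans; exact: ler_norm.
  pose l' := maxn j l.
  have E1 : psum c m b - psum (a (z l')) m b = \sum_(k < m | b (val k)) (c k - a (z l') k) *: e k.
    by rewrite -sumrB; apply: eq_bigr => k _; rewrite scalerBl.
  have E2 : psum (a (z l')) m b - psum (a (z j)) m b = psum (a (z l' - z j)) m b.
    by rewrite -sumrB; apply: eq_bigr => k _; rewrite coefD coefN scalerBl.
  rewrite -(subrKA (psum (a (z l')) m b)) E1 E2.
  apply: (le_trans (ND _ _)); apply: lerD; last by apply: zb'; rewrite leq_maxl.
  apply: le_trans (ltW hl); apply: (le_trans (Nsum _ _ _)).
  rewrite /S mulr_suml; apply: ler_sum => k _; rewrite NZ -normc_opp opprB.
  rewrite mulrAC ler_wpM2r//; apply: (le_trans (hc k l')).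
  rewrite ler_wpM2l//; first by rewrite mulr_ge0// divr_ge0.
  by rewrite ler_wiXn2l ?leq_maxr//; lra.
(* By [lim] the sums with coefficients [c] stay uniformly close to those of [z j], which converge to
   [z j], and [z j] tends to x. *)
have ca : c = a x.
  apply/a_unique/sumsP => eps eps0.
  have [j hj] := small (t + 2 * M * t) (divr_gt0 eps0 (ltr0n _ 2)).
  have /sumsP/(_ _ (divr_gt0 eps0 (ltr0n _ 2)))[m hm] := a_sums (z j).
  exists m => l ml; have h := hm l ml; have lj := lim j l xpredT.
  rewrite -(subrKA (z j)) -(subrKA (\sum_(i < l) a (z j) i *: e i) (z j)).
  apply: (le_lt_trans (ND _ _)).
  apply: (@le_lt_trans _ _ (t * 4^-1 ^+ j +
    (N (z j - \sum_(i < l) a (z j) i *: e i) + 2 * M * t * 4^-1 ^+ j))).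
    rewrite lerD ?xz//; apply: (le_trans (ND _ _)); rewrite lerD2l.
    by rewrite -Nopp opprB.
  by move: h hj; rewrite /=; lra.
move=> m b; rewrite -ca; have := lim 0%N m b.
by rewrite expr0 mulr1 [X in _ - X]big1 ?subr0// => k _; rewrite coef0 scale0r.
Qed.

End uniform_bound.

(** * Complex L^p functions, their norm and completeness *)

Section complex_measurable.
Context {d : measure_display} {T : measurableType d} {R : realType}.
Implicit Types f g : T -> R[i].

Lemma cmeasurable_cst (c : R[i]) : cmeasurable (fun _ : T => c).
Proof. by split; exact: measurable_cst. Qed.

Lemma cmeasurableD f g : cmeasurable f -> cmeasurable g -> cmeasurable (f + g).
Proof.
move=> [rf jf] [rg jg]; split.
  by under eq_fun do rewrite ReD; exact: measurable_funD.
by under eq_fun do rewrite ImD; exact: measurable_funD.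
Qed.

Lemma cmeasurableM f g : cmeasurable f -> cmeasurable g ->
  cmeasurable (fun x => f x * g x).
Proof.
have E (z w : R[i]) : z * w = (complex.Re z * complex.Re w - complex.Im z * complex.Im w)
    +i* (complex.Re z * complex.Im w + complex.Im z * complex.Re w).
  by case: z w => [a b] [a' b'].
move=> [rf jf] [rg jg]; split; under eq_fun do rewrite E /=.
  by apply: measurable_funB; exact: measurable_funM.
by apply: measurable_funD; exact: measurable_funM.
Qed.

Lemma cmeasurable_real (h : T -> R) : measurable_fun [set: T] h ->
  cmeasurable (fun x => (h x)%:C).
Proof. by move=> mh; split => //; exact: measurable_cst. Qed.

Lemma cmeasurableZ (c : R[i]) f : cmeasurable f -> cmeasurable (c *: f).
Proof. by move=> mf; apply: cmeasurableM => //; exact: cmeasurable_cst. Qed.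

Lemma measurable_sqc f : cmeasurable f -> measurable_fun [set: T] (fun x => sqc (f x)).
Proof. by move=> [rf jf]; apply: measurable_funD; exact: measurable_funX. Qed.

Lemma measurable_normc f : cmeasurable f -> measurable_fun [set: T] (fun x => normc (f x)).
Proof.
move=> mf; under eq_fun do rewrite normcE -powR12_sqrt ?sqc_ge0//.
exact/measurable_powRf/measurable_sqc.
Qed.

End complex_measurable.

Lemma normc_powR {R : realType} (p : R) (z : R[i]) :
  (normc z) `^ p = (sqc z) `^ (p / 2).
Proof. by rewrite normcE -powR12_sqrt ?sqc_ge0// -powRrM mulrC. Qed.

Section Lp_norm.
Context {d : measure_display} {T : measurableType d} {R : realType}.
Variable mu : {measure set T -> \bar R}.
Variables (p : R) (p1 : 1 <= p).
Implicit Types f g : T -> R[i].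

Let p0 : 0 < p. Proof. exact: lt_le_trans p1. Qed.
Let pn0 : p != 0. Proof. by rewrite gt_eqF. Qed.
Local Notation J f := (Rintegral mu [set: T] f).

Lemma cLnormE f : cLnorm mu p f =
  poweR (\int[mu]_x ((sqc (f x)) `^ (p / 2))%:E)%E p^-1.
Proof.
rewrite /cLnorm unlock (eq_integral (fun x => (sqc (f x) `^ (p / 2))%:E))// => x _ /=.
by rewrite ger0_norm ?normc_ge0// normc_powR.
Qed.

Lemma cLpP f : cLp mu p f <->
  cmeasurable f /\ itg mu (fun x => (sqc (f x)) `^ (p / 2)).
Proof.
have h : cmeasurable f -> (cLnorm mu p f < +oo)%E <->
    itg mu (fun x => (sqc (f x)) `^ (p / 2)).
  move=> mf; rewrite cLnormE itg_ge0P; last 2 first.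
  - exact/measurable_powRf/measurable_sqc.
  - by move=> x; exact: powR_ge0.
  split=> [|h]; last exact: poweR_lty.
  by apply: lty_poweRy; rewrite invr_neq0.
by split=> -[mf hf]; split => //; exact/h.
Qed.

Definition Lpn f : R := fine (cLnorm mu p f).

Lemma Lpn_ge0 f : 0 <= Lpn f.
Proof. by rewrite fine_ge0// Lnorm_ge0. Qed.

Lemma cLnorm_fin f : cLp mu p f -> cLnorm mu p f = (Lpn f)%:E.
Proof. by move=> [_ h]; rewrite fineK// ge0_fin_numE ?Lnorm_ge0. Qed.

Lemma LpnE f : cLp mu p f -> Lpn f = (J (fun x => (sqc (f x)) `^ (p / 2))) `^ p^-1.
Proof. by move=> /cLpP[_ h]; rewrite /Lpn cLnormE EFin_Rintegral. Qed.

Lemma Lpn_powR f : cLp mu p f -> Lpn f `^ p = J (fun x => (sqc (f x)) `^ (p / 2)).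
Proof.
move=> h; rewrite LpnE// -powRrM mulVf// powRr1//.
by apply: J_ge0 => x; exact: powR_ge0.
Qed.

Lemma cLnormD f g : cmeasurable f -> cmeasurable g ->
  (cLnorm mu p (f + g)%R <= cLnorm mu p f + cLnorm mu p g)%E.
Proof.
move=> mf mg; have nf := measurable_normc mf; have ng := measurable_normc mg.
have nfg := measurable_normc (cmeasurableD mf mg).
apply: (le_trans _ (minkowski_EFin mu nf ng p1)).
rewrite /cLnorm unlock; apply: gt0_ler_poweR.
- by rewrite invr_ge0 ltW.
- by rewrite in_itv/= leey andbT integral_ge0// => x _; exact: poweR_ge0.
- by rewrite in_itv/= leey andbT integral_ge0// => x _; exact: poweR_ge0.
apply: ge0_le_integral => //.
- by move=> x _; exact: poweR_ge0.
- by apply/measurable_EFinP/measurable_powRf/measurableT_comp.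
- by apply/measurable_EFinP/measurable_powRf/measurableT_comp => //; exact: measurable_funD.
move=> x _ /=; rewrite lee_fin !ger0_norm ?addr_ge0 ?normc_ge0//.
by apply: powR_le2; rewrite ?normc_ge0 ?normcD// ltW.
Qed.

Lemma cLnormZ c f : cmeasurable f -> cLnorm mu p (c *: f) = ((normc c)%:E * cLnorm mu p f)%E.
Proof.
move=> mf; rewrite !cLnormE.
have -> : (fun x => ((sqc ((c *: f) x)) `^ (p / 2))%:E) =
    (fun x => ((sqc c `^ (p / 2))%:E * (sqc (f x) `^ (p / 2))%:E)%E).
  by apply/funext => x; rewrite -EFinM -powRM ?sqc_ge0// -sqcM.
rewrite ge0_integralZl_EFin ?powR_ge0//; last 2 first.
- by move=> x _; rewrite lee_fin powR_ge0.
- exact/measurable_EFinP/measurable_powRf/measurable_sqc.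
rewrite poweRM; last 2 first.
- by rewrite lee_fin powR_ge0.
- by apply: integral_ge0 => x _; rewrite lee_fin powR_ge0.
by rewrite -normc_powR poweR_EFin -powRrM mulfV// powRr1// normc_ge0.
Qed.

Lemma Lp_submod_closed : submod_closed (mem [set f | cLp mu p f]).
Proof.
have p20 : p / 2 != 0 by rewrite mulf_neq0.
split=> [|c f g]; rewrite !inE/=.
  apply/cLpP; split; first exact: cmeasurable_cst.
  have -> : (fun x : T => sqc ((0 : T -> R[i]) x) `^ (p / 2)) = cst 0.
    by apply/funext => x; rewrite /sqc/= expr0n/= addr0 powR0.
  exact: integrable0.
move=> [mf nf] [mg ng]; have mcf := cmeasurableZ c mf.
split; first exact: cmeasurableD.
apply: (le_lt_trans (cLnormD mcf mg)); rewrite lte_add_pinfty//.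
by rewrite cLnormZ// lte_mul_pinfty// lee_fin normc_ge0.
Qed.

(** The Riesz-Fischer theorem: [fast_ae_cvg] for the real and imaginary parts gives an a.e. limit
    together with an integrable majorant that decays geometrically, whence convergence in norm. *)
Lemma Lp_complete (u : nat -> T -> R[i]) : (forall k, cLp mu p (u k)) ->
  (forall k, Lpn (u k.+1 - u k) <= 4^-1 ^+ k) ->
  exists2 f, cLp mu p f & forall eps : R, 0 < eps ->
    exists m, forall k, (m <= k)%N -> Lpn (f - u k) < eps.
Proof.
move=> uL du.
have [mem0 memD] := Lp_submod_closed.
have LB f g : cLp mu p f -> cLp mu p g -> cLp mu p (f - g).
  move=> fL gL; have := memD (-1) g f; rewrite !inE/= scaleN1r addrC.
  by move=> /(_ gL fL).
have itgu k : itg mu (fun x => sqc (u k.+1 x - u k x) `^ (p / 2)).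
  by have /cLpP[] := LB _ _ (uL k.+1) (uL k).
have Ju k : J (fun x => sqc (u k.+1 x - u k x) `^ (p / 2)) <= 1 * ((4 `^ p)^-1) ^+ k.
  have := Lpn_powR (LB _ _ (uL k.+1) (uL k)).
  rewrite [J (fun _ => _)](_ : _ = J (fun x => sqc (u k.+1 x - u k x) `^ (p / 2)))// => <-.
  rewrite mul1r (_ : _ ^+ k = (4^-1 ^+ k) `^ p).
    by apply: powR_le2 => //; [exact: ltW|exact: Lpn_ge0].
  rewrite -(@powR_mulrn _ 4^-1 k); last by rewrite invr_ge0.
  rewrite powRAC powR_mulrn ?powR_ge0//; congr (_ ^+ _).
  by rewrite -[in RHS](@powR_inv1 _ 4)// -powRrM mulN1r powRN.
have part (h : R[i] -> R) : (forall z w, h (z - w) = h z - h w) ->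
    (forall z, `|h z| <= normc z) -> (forall k, measurable_fun [set: T] (fun x => h (u k x))) ->
    exists E f : T -> R, [/\ itg mu E, forall x, 0 <= E x, measurable_fun [set: T] f &
    {ae mu, forall x, forall n, `|h (u n x) - f x| <= 2 * E x `^ p^-1 * 2^-1 ^+ n}].
  move=> hB hn mh.
  have le x k : `|h (u k.+1 x) - h (u k x)| `^ p <= sqc (u k.+1 x - u k x) `^ (p / 2).
    by rewrite -hB -normc_powR; apply: powR_le2 => //; exact: ltW.
  have ih k : itg mu (fun x => `|h (u k.+1 x) - h (u k x)| `^ p).
    apply: (itg_le _ (itgu k)) => [|x]; last by rewrite ger0_norm ?powR_ge0.
    by apply/measurable_powRf/measurableT_comp => //; exact: measurable_funB.
  apply: (@fast_ae_cvg _ _ _ mu p 1 (fun k x => h (u k x)) p0 mh ih) => k.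
  by apply: le_trans (Ju k); apply: J_le.
have [E1 [f1 [iE1 E10 mf1 ae1]]] := part (@complex.Re R)
  (fun z w => etrans (ReD _ _) (congr1 _ (ReN w))) (@normr_Re_le R) (fun k => (uL k).1.1).
have [E2 [f2 [iE2 E20 mf2 ae2]]] := part (@complex.Im R)
  (fun z w => etrans (ImD _ _) (congr1 _ (ImN w))) (@normr_Im_le R) (fun k => (uL k).1.2).
pose f x : R[i] := f1 x +i* f2 x.
have mf : cmeasurable f by split.
(* One factor comes from the constant 2 in [fast_ae_cvg], the other from [powR_le_add] for the two
   parts. *)
pose K : R := 2 `^ p * 2 `^ p.
have K0 : 0 <= K by rewrite mulr_ge0 ?powR_ge0.
pose E x := K * (E1 x + E2 x).
have iE : itg mu E by apply: itgZ; exact: itgD.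
pose t : R := (2^-1) `^ p.
have aeE : {ae mu, forall x, forall n, sqc (f x - u n x) `^ (p / 2) <= t ^+ n * E x}.
  apply: filterS2 ae1 ae2 => x h1 h2 n.
  have e0 : 0 <= (2^-1 : R) ^+ n by rewrite exprn_ge0// invr_ge0.
  have a1 := powR_ge0 (E1 x) p^-1; have a2 := powR_ge0 (E2 x) p^-1.
  rewrite -normc_powR; apply: (@le_trans _ _
     ((2 * 2^-1 ^+ n * (E1 x `^ p^-1 + E2 x `^ p^-1)) `^ p)).
    apply: powR_le2; [exact: ltW|exact: normc_ge0|].
    apply: (le_trans (normc_le_ReIm _)); rewrite ReD ImD ReN ImN/=.
    rewrite -normrN -[X in _ + X]normrN !opprB.
    by have := h1 n; have := h2 n; lra.
  rewrite !powRM ?addr_ge0 ?mulr_ge0//.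
  apply: (@le_trans _ _ (2 `^ p * (2^-1 ^+ n) `^ p * (2 `^ p * (E1 x + E2 x)))).
    rewrite ler_wpM2l ?mulr_ge0 ?powR_ge0//.
    apply: (le_trans (powR_le_add p0 a1 a2)).
    by rewrite -!powRrM mulVf// !powRr1.
  rewrite -(@powR_mulrn _ 2^-1 n); last by rewrite invr_ge0.
  rewrite powRAC -/t powR_mulrn ?powR_ge0// /E /K.
  by rewrite le_eqVlt; apply/orP; left; apply/eqP; ring.
have ifu n : itg mu (fun x => sqc (f x - u n x) `^ (p / 2)).
  apply: (itg_ae_le _ (itgZ (t ^+ n) iE)).
    apply/measurable_powRf/(@measurable_sqc _ _ _ (f - u n))/cmeasurableD => //.
    by rewrite -scaleN1r; exact: cmeasurableZ (uL n).1.
  by apply: filterS aeE => x h; rewrite ger0_norm ?powR_ge0.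
have fuL n : cLp mu p (f - u n).
  apply/cLpP; split; last exact: ifu.
  by apply: cmeasurableD => //; rewrite -scaleN1r; exact: cmeasurableZ (uL n).1.
exists f => [|eps eps0].
  have := memD (-1) (- u 0%N) (f - u 0%N); rewrite !inE/= scaleN1r opprK [u 0%N + _]addrC subrK.
  apply; last exact: fuL.
  by have := LB _ _ (set_mem mem0) (uL 0%N); rewrite sub0r.
have t0 : 0 <= t by exact: powR_ge0.
have t1 : t < 1.
  have := @gt0_ltr_powR R p p0 2^-1 1; rewrite powR1 !nnegrE; apply; lra.
have : t ^+ n * J E @[n --> \oo] --> 0 * J E.
  by apply: cvgM; [apply: cvg_expr; rewrite ger0_norm|exact: cvg_cst].
have ep0 : 0 < eps `^ p by exact: powR_gt0.
rewrite mul0r => /cvgrPdist_lt/(_ _ ep0)[m _ hm]; exists m => k mk.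
have h : Lpn (f - u k) `^ p < eps `^ p.
  rewrite Lpn_powR//; apply: le_lt_trans (hm k mk); rewrite sub0r normrN.
  apply: le_trans (ler_norm _); rewrite -JZ//; apply: J_ae_le; [exact: ifu|exact: itgZ|].
  by apply: filterS aeE => x; exact.
rewrite ltNge; apply/negP => h'; move: h; rewrite ltNge => /negP; apply.
by apply: powR_le2 => //; exact: ltW.
Qed.

End Lp_norm.

Section Lp_type.
Context {d : measure_display} {T : measurableType d} {R : realType}.
Variable mu : {measure set T -> \bar R}.
Variables (p : R) (p1 : 1 <= p).

(** The proof of [1 <= p] is an argument so that the instance of closure under linear combinations,
    which depends on it, can be found from the predicate. *)
Definition Lpset of (1 <= p) : {pred T -> R[i]} := mem [set f | cLp mu p f].

HB.instance Definition _ := GRing.isSubmodClosed.Build R[i] (T -> R[i])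
  (Lpset p1) (Lp_submod_closed mu p1).

Record Lpt := LptMk { Lpv :> T -> R[i] ; Lpv_in : Lpv \in Lpset p1 }.

HB.instance Definition _ := [isSub for Lpv].
HB.instance Definition _ := [Choice of Lpt by <:].
HB.instance Definition _ := [SubChoice_isSubLmodule of Lpt by <:].

Lemma Lpv_cLp (f : Lpt) : cLp mu p f.
Proof. by case: f => f /= /[!inE]. Qed.

Definition mkLpt f (h : cLp mu p f) : Lpt := @LptMk f (mem_set h).

Definition LptN (f : Lpt) : R := Lpn mu p f.

Lemma LptN_ge0 f : 0 <= LptN f.
Proof. exact: Lpn_ge0. Qed.

Lemma LptND f g : LptN (f + g) <= LptN f + LptN g.
Proof.
have := cLnormD mu p1 (Lpv_cLp f).1 (Lpv_cLp g).1.
rewrite (cLnorm_fin (Lpv_cLp f)) (cLnorm_fin (Lpv_cLp g)).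
by rewrite -[(Lpv f + Lpv g)]/(Lpv (f + g)) (cLnorm_fin (Lpv_cLp (f + g))) lee_fin.
Qed.

Lemma LptNZ c f : LptN (c *: f) = normc c * LptN f.
Proof.
have := cLnormZ mu p1 c (Lpv_cLp f).1.
rewrite (cLnorm_fin (Lpv_cLp f)).
rewrite -[(c *: Lpv f)]/(Lpv (c *: f)) (cLnorm_fin (Lpv_cLp (c *: f))) -EFinM.
by move=> [].
Qed.

Lemma Lpt_complete (u : nat -> Lpt) : (forall k, LptN (u k.+1 - u k) <= 4^-1 ^+ k) ->
  exists y, forall eps : R, 0 < eps ->
    exists m, forall k, (m <= k)%N -> LptN (y - u k) < eps.
Proof.
move=> h; have [f fL hf] := Lp_complete p1 (fun k => Lpv_cLp (u k)) h.
by exists (mkLpt fL).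
Qed.

Lemma Lpt_basis (e : nat -> Lpt) :
  is_unconditional_basis setT (fun x => (LptN x)%:E) e <->
  is_Lp_unconditional_basis mu p (fun k => Lpv (e k)).
Proof.
have lin : linear (Lpv : Lpt -> T -> R[i]) by [].
pose Phi := GRing.isLinear.Build _ _ _ _ (Lpv : Lpt -> T -> R[i]) lin.
pose L : {linear Lpt -> (T -> R[i])} := HB.pack (Lpv : Lpt -> T -> R[i]) Phi.
apply: (@unconditional_basis_transfer _ _ _ _ _ _ _ L).
- by move=> v; split=> // _; exact: Lpv_cLp.
- by move=> f fL; exists (mkLpt fL).
- move=> u; suff -> : (fun n => cLnorm mu p (L (u n))) = (fun n => (LptN (u n))%:E) by [].
  by apply/funext => n; rewrite cLnorm_fin//; exact: Lpv_cLp.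
Qed.

End Lp_type.

(** * Khintchine's inequality for complex families *)

Section complex_khintchine.
Context {R : realType}.
Implicit Types (q : R).

Let xRI n (z : nat -> nat -> R[i]) (j : nat) (k : 'I_n * bool) : R :=
  if k.2 then complex.Re (z j k.1) else complex.Im (z j k.1).

Lemma Re_sign (b : bool) (z : R[i]) : complex.Re ((-1) ^+ b * z) = (-1) ^+ b * complex.Re z.
Proof. by case: b; rewrite ?expr1 ?expr0 ?mulN1r ?mul1r ?ReN. Qed.

Lemma Im_sign (b : bool) (z : R[i]) : complex.Im ((-1) ^+ b * z) = (-1) ^+ b * complex.Im z.
Proof. by case: b; rewrite ?expr1 ?expr0 ?mulN1r ?mul1r ?ImN. Qed.

Let nrm2_xRI n z j : nrm2 (@xRI n z j) = \sum_(k < n) sqc (z j k).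
Proof.
rewrite /nrm2 -(pair_bigA _ (fun k b => xRI z j (k, b) ^+ 2))/=.
by apply: eq_bigr => k _; rewrite big_bool.
Qed.

Let nrm2_rsum n z J s : nrm2 (rsum J (@xRI n z) s) =
  \sum_(k < n) sqc (\sum_(j < J) (-1) ^+ s j * z j k).
Proof.
rewrite /nrm2 -(pair_bigA _ (fun k b => rsum J (xRI z) s (k, b) ^+ 2))/=.
apply: eq_bigr => k _; rewrite big_bool /sqc Re_sum Im_sum /rsum.
congr (_ ^+ 2 + _ ^+ 2); apply: eq_bigr => j _; by rewrite ?Re_sign ?Im_sign.
Qed.

Lemma khintchine_vec q : 0 < q -> exists2 B : R, 0 < B & forall n J (z : nat -> nat -> R[i]),
  let S := (\sum_(j < J) \sum_(k < n) sqc (z j k)) `^ q in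
  let E := \sum_(s <- signs J)
    (\sum_(k < n) sqc (\sum_(j < J) (-1) ^+ s j * z j k)) `^ q in
  E <= B * (2 ^+ J * S) /\ 2 ^+ J * S <= B * E.
Proof.
move=> q0; have [B1 B10 h1] := khintchine_upper q0.
have [B2 B20 h2] := khintchine_lower q0.
exists (B1 + B2) => [|n J z S E]; first exact: addr_gt0.
have E0 : 0 <= E by apply: sumr_ge0 => *; exact: powR_ge0.
have S0 : 0 <= 2 ^+ J * S by rewrite mulr_ge0 ?powR_ge0// exprn_ge0.
have ES : (\sum_(j < J) nrm2 (@xRI n z j)) `^ q = S by under eq_bigr do rewrite nrm2_xRI.
have EE : \sum_(s <- signs J) nrm2 (rsum J (@xRI n z) s) `^ q = E.
  by apply: eq_bigr => s _; rewrite nrm2_rsum.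
have := h1 _ J (@xRI n z); have := h2 _ J (@xRI n z).
rewrite ES EE => e2; rewrite -mulrA => e1; rewrite !mulrDl; split.
  by apply: (le_trans e1); rewrite lerDl mulr_ge0// ltW.
by apply: (le_trans e2); rewrite lerDr mulr_ge0// ltW.
Qed.

Lemma khintchine1 q : 0 < q -> exists2 B : R, 0 < B & forall J (z : nat -> R[i]),
  let S := (\sum_(j < J) sqc (z j)) `^ q in
  let E := \sum_(s <- signs J) sqc (\sum_(j < J) (-1) ^+ s j * z j) `^ q in
  E <= B * (2 ^+ J * S) /\ 2 ^+ J * S <= B * E.
Proof.
move=> /khintchine_vec[B B0 h]; exists B => // J z S E.
have [] := h 1%N J (fun j _ => z j).
have -> : (\sum_(j < J) \sum_(k < 1) sqc (z j)) `^ q = S.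
  by under eq_bigr do rewrite big_ord1.
have -> // : \sum_(s <- signs J) (\sum_(k < 1) sqc (\sum_(j < J) (-1) ^+ s j * z j)) `^ q = E.
by apply: eq_bigr => s _; rewrite big_ord1.
Qed.

(** For each fixed [s] the scalar inequality is applied to the signs [t]; the vector-valued one then
    handles the signs [s]. *)
Lemma khintchine2 q : 0 < q -> exists2 B : R, 0 < B & forall n J (z : nat -> nat -> R[i]),
  let S := (\sum_(j < J) \sum_(k < n) sqc (z j k)) `^ q in
  let E := \sum_(s <- signs J) \sum_(t <- signs n)
    sqc (\sum_(k < n) (-1) ^+ t k * \sum_(j < J) (-1) ^+ s j * z j k) `^ q in
  E <= B * (2 ^+ J * 2 ^+ n * S) /\ 2 ^+ J * 2 ^+ n * S <= B * E.
Proof.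
move=> q0; have [B B0 h1] := khintchine1 q0; have [B' B'0 h2] := khintchine_vec q0.
exists (B * B') => [|n J z S E]; first exact: mulr_gt0.
have n0 : 0 <= 2 ^+ n :> R by rewrite exprn_ge0.
pose w s k := \sum_(j < J) (-1) ^+ s j * z j k.
have := h2 n J z; rewrite /= -/S; set E' := \sum_(s <- _) _ => -[e1 e2].
split.
  apply: (@le_trans _ _ (\sum_(s <- signs J) B * (2 ^+ n * (\sum_(k < n) sqc (w s k)) `^ q))).
    by apply: ler_sum => s _; have [] := h1 n (w s).
  rewrite -!mulr_sumr -mulrA ler_pM2l// [leRHS](_ : _ = 2 ^+ n * (B' * (2 ^+ J * S))).
    by rewrite ler_wpM2l.
  by ring.
apply: (@le_trans _ _ (2 ^+ n * (B' * E'))).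
  by rewrite mulrAC mulrC ler_wpM2l.
rewrite mulrCA -[B * B']mulrC -mulrA ler_pM2l// /E /E' !mulr_sumr.
by apply: ler_sum => s _; have [] := h1 n (w s).
Qed.

End complex_khintchine.

(** * The square function inequality for coordinate projections *)

Section square_functions.
Context {d : measure_display} {T : measurableType d} {R : realType}.
Variable mu : {measure set T -> \bar R}.
Variables (p : R) (p1 : 1 <= p).
Local Notation q := (p / 2).
Local Notation J f := (Rintegral mu [set: T] f).
Local Notation X := (Lpt mu p1).

Let p0 : 0 < p. Proof. exact: lt_le_trans p1. Qed.
Let q0 : 0 < q. Proof. by rewrite divr_gt0. Qed.

Lemma Lpt_itg (f : X) : itg mu (fun x => sqc (f x) `^ q).
Proof. by have /cLpP[] := Lpv_cLp f. Qed.

Lemma Lpt_measurable (f : X) : measurable_fun [set: T] (fun x => sqc (f x)).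
Proof. by apply: measurable_sqc; have [] := Lpv_cLp f. Qed.

Lemma LptN_powR (f : X) : LptN f `^ p = J (fun x => sqc (f x) `^ q).
Proof. by rewrite /LptN Lpn_powR//; exact: Lpv_cLp. Qed.

Lemma itg_sum_powR (n : nat) (u : nat -> T -> R) :
  (forall i, measurable_fun [set: T] (u i)) -> (forall i x, 0 <= u i x) ->
  (forall i, itg mu (fun x => u i x `^ q)) ->
  itg mu (fun x => (\sum_(i < n) u i x) `^ q).
Proof.
move=> mu' u0 iu; elim: n => [|n IH].
  under eq_fun do rewrite big_ord0 powR0 ?gt_eqF//.
  exact: integrable0.
have S0 x : 0 <= \sum_(i < n) u i x by apply: sumr_ge0 => i _; exact: u0.
apply: (itg_le _ (itgZ (2 `^ q) (itgD IH (iu n)))) => [|x].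
  apply/measurable_powRf/measurable_sum => i; exact: mu'.
by rewrite ger0_norm ?powR_ge0// big_ord_recr/=; exact: powR_le_add.
Qed.

Lemma LptB_E (f g : X) x : (f - g) x = f x - g x.
Proof. by []. Qed.

Lemma Lpt_sumE (I : Type) (s : seq I) (P : pred I) (F : I -> X) x :
  (\sum_(i <- s | P i) F i : X) x = \sum_(i <- s | P i) F i x.
Proof.
by elim/big_rec2: _ => // i y z _ <-.
Qed.

Variable e : nat -> X.
Hypothesis basis_e : is_unconditional_basis setT (fun f => (LptN f)%:E) e.
Variable a : X -> nat -> R[i].
Hypothesis a_sums : forall f, sums_to (fun f => (LptN f)%:E) (fun k => a f k *: e k) f.
Hypothesis a_unique : forall f c,
  sums_to (fun f => (LptN f)%:E) (fun k => c k *: e k) f -> c = a f.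

Definition Lproj m (b : pred nat) (f : X) : X := \sum_(k < m | b (val k)) a f (val k) *: e (val k).

Let N0 := @LptN_ge0 _ _ _ mu p p1.
Let ND := @LptND _ _ _ mu p p1.
Let NZ := @LptNZ _ _ _ mu p p1.

Let aZ := coefZ N0 NZ a_sums a_unique.
Let asum := coef_sum N0 ND NZ a_sums a_unique.
Let abasis := coef_basis N0 NZ a_unique.

Let sgsum m (t : nat -> bool) (c : nat -> R[i]) : X :=
  \sum_(k < m) ((-1) ^+ t k * c k) *: e k.

Let sgsumE m t c x : sgsum m t c x = \sum_(k < m) (-1) ^+ t k * (c k * e k x).
Proof. by rewrite Lpt_sumE; apply: eq_bigr => k _; rewrite mulrA. Qed.

Let sgsum_coef m t c k : a (sgsum m t c) k = if (k < m)%N then (-1) ^+ t k * c k else 0.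
Proof.
rewrite asum; case: ltnP => km.
  rewrite (bigD1 (Ordinal km))//= aZ abasis eqxx mulr1 big1 ?addr0// => j.
  by rewrite -val_eqE/= aZ abasis => /negbTE ->; rewrite mulr0.
rewrite big1// => j _; rewrite aZ abasis ltn_eqF ?mulr0//.
exact: leq_trans (ltn_ord j) km.
Qed.

(** A sign change is the difference of two complementary coordinate projections. *)
Let sign_bound : exists2 C : R, 0 <= C & forall f m t,
  LptN (sgsum m t (a f)) <= C * LptN f.
Proof.
have [C C0 hC] := basis_projections_bounded N0 ND NZ (@Lpt_complete _ _ _ mu p p1) basis_e a_sums a_unique.
exists (2 * C) => [|f m t]; first by rewrite mulr_ge0.
have h1 := hC f m (fun k => ~~ t k); have h2 := hC f m (fun k => t k).
rewrite (_ : sgsum m t (a f) = (\sum_(k < m | ~~ t (val k)) a f (val k) *: e (val k)) +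
   (-1) *: (\sum_(k < m | t (val k)) a f (val k) *: e (val k))).
  apply: (le_trans (ND _ _)); rewrite NZ normc_opp normc1 mul1r; lra.
rewrite scaler_sumr big_mkcond [X in _ + X]big_mkcond -big_split/=.
apply: eq_bigr => k _; case: (t k) => /=; first by rewrite add0r scalerA expr1.
by rewrite addr0 expr0 mul1r.
Qed.

(** [N] and [M] stand for the numbers of sign patterns, which cancel from the averaged
    inequalities. *)
Let chain1 (N M B2 C A S B u v : R) : 0 < N -> 0 < M -> 0 <= B2 -> 0 <= C ->
  N * M * v <= B2 * A -> A <= M * (C * S) -> S <= B * (N * u) ->
  v <= B2 * C * B * u.
Proof.
move=> N1 M1 B20 C0 h1 h2 h3; rewrite -(ler_pM2l (mulr_gt0 N1 M1)).
apply: (le_trans h1); apply: (@le_trans _ _ (B2 * (M * (C * (B * (N * u)))))).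
  rewrite ler_wpM2l//; apply: (le_trans h2); rewrite ler_wpM2l ?(ltW M1)//.
  by rewrite ler_wpM2l.
by rewrite le_eqVlt; apply/orP; left; apply/eqP; ring.
Qed.

Let chain2 (N M B C S A B2 w v : R) : 0 < N -> 0 < M -> 0 <= B -> 0 <= C ->
  N * w <= B * S -> M * S <= C * A -> A <= B2 * (N * M * v) ->
  w <= B * C * B2 * v.
Proof.
move=> N1 M1 B0 C0 h1 h2 h3; rewrite -(ler_pM2l (mulr_gt0 M1 N1)).
apply: (@le_trans _ _ (M * (B * S))); first by rewrite -mulrA ler_wpM2l// ltW.
apply: (@le_trans _ _ (B * (C * (B2 * (N * M * v))))).
  rewrite mulrCA ler_wpM2l//; apply: (le_trans h2); by rewrite ler_wpM2l.
by rewrite le_eqVlt; apply/orP; left; apply/eqP; ring.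
Qed.

(* Khintchine's inequality is used twice: over the signs of the [f j], and over
   the signs of the coordinates, which unconditionality makes harmless. *)
Lemma square_function_bound : exists2 K : R, 0 <= K &
  forall n (f : nat -> X) m (b : nat -> pred nat),
    J (fun x => (\sum_(j < n) sqc (Lproj m (b j) (f j) x)) `^ q)
      <= K * J (fun x => (\sum_(j < n) sqc (f j x)) `^ q).
Proof.
have [B B0 hB] := khintchine1 q0; have [B2 B20 hB2] := khintchine2 q0.
have [C C0 hC] := sign_bound.
pose I (f : X) := J (fun x => sqc (f x) `^ q).
have hI f m t : I (sgsum m t (a f)) <= C `^ p * I f.
  rewrite /I -!LptN_powR -powRM//; by apply: powR_le2 => //; exact: ltW.
pose g n (f : nat -> X) (s : nat -> bool) : X := \sum_(j < n) ((-1) ^+ s j : R[i]) *: f j.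
have gE n f s x : g n f s x = \sum_(j < n) (-1) ^+ s j * f j x by rewrite Lpt_sumE.
pose S n (f : nat -> X) x := (\sum_(j < n) sqc (f j x)) `^ q.
have iS n f : itg mu (S n f).
  apply: (@itg_sum_powR n (fun j x => sqc (f j x))) => [j|j x|j].
  - exact: Lpt_measurable.
  - exact: sqc_ge0.
  - exact: Lpt_itg.
have e20 n : 0 < 2 ^+ n :> R by rewrite exprn_gt0.
have K1 n f : \sum_(s <- signs n) I (g n f s) <= B * (2 ^+ n * J (S n f)) /\
    2 ^+ n * J (S n f) <= B * \sum_(s <- signs n) I (g n f s).
  have ig s : itg mu (fun x => sqc (g n f s x) `^ q) by exact: Lpt_itg.
  have ie : itg mu (fun x => \sum_(s <- signs n) sqc (g n f s x) `^ q) by exact: itg_sum.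
  rewrite (_ : \sum_(s <- signs n) I (g n f s) =
    J (fun x => \sum_(s <- signs n) sqc (g n f s x) `^ q)); last by rewrite J_sum.
  rewrite -(JZ _ (iS n f)) -(JZ B (itgZ _ (iS n f))) -(JZ B ie).
  split; apply: J_le; [exact: ie|exact/itgZ/itgZ| |exact: itgZ|exact/itgZ/ie|] => // x.
    under eq_bigr do rewrite gE.
    by have [] := hB n (fun j => f j x).
  under [X in _ <= _ * X]eq_bigr do rewrite gE.
  by have [] := hB n (fun j => f j x).
pose S2 n m (c : nat -> nat -> R[i]) x :=
  (\sum_(j < n) \sum_(k < m) sqc (c j k * e k x)) `^ q.
pose cs n (c : nat -> nat -> R[i]) s k : R[i] := \sum_(j < n) (-1) ^+ s j * c j k.
have iS2 n m c : itg mu (S2 n m c).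
  apply: (@itg_sum_powR n (fun j x => \sum_(k < m) sqc (c j k * e k x))).
  - by move=> j; apply: measurable_sum => k; exact: (Lpt_measurable (c j k *: e k)).
  - by move=> j x; apply: sumr_ge0 => k _; exact: sqc_ge0.
  move=> j; apply: (@itg_sum_powR m (fun k x => sqc (c j k * e k x))) => [k|k x|k].
  - exact: (Lpt_measurable (c j k *: e k)).
  - exact: sqc_ge0.
  - exact: (Lpt_itg (c j k *: e k)).
have K2 n m c : \sum_(s <- signs n) \sum_(t <- signs m) I (sgsum m t (cs n c s))
      <= B2 * (2 ^+ n * 2 ^+ m * J (S2 n m c)) /\
    2 ^+ n * 2 ^+ m * J (S2 n m c)
      <= B2 * \sum_(s <- signs n) \sum_(t <- signs m) I (sgsum m t (cs n c s)).
  have ig s t : itg mu (fun x => sqc (sgsum m t (cs n c s) x) `^ q) by exact: Lpt_itg.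
  have igs s : itg mu (fun x => \sum_(t <- signs m) sqc (sgsum m t (cs n c s) x) `^ q).
    exact: itg_sum.
  have ie : itg mu (fun x => \sum_(s <- signs n) \sum_(t <- signs m)
      sqc (sgsum m t (cs n c s) x) `^ q) by exact: itg_sum.
  rewrite (_ : \sum_(s <- signs n) \sum_(t <- signs m) I (sgsum m t (cs n c s)) =
    J (fun x => \sum_(s <- signs n) \sum_(t <- signs m)
      sqc (sgsum m t (cs n c s) x) `^ q)); last first.
    by rewrite J_sum//; apply: eq_bigr => s _; rewrite J_sum.
  rewrite -(JZ _ (iS2 n m c)) -(JZ B2 (itgZ _ (iS2 n m c))) -(JZ B2 ie).
  have E x : \sum_(s <- signs n) \sum_(t <- signs m) sqc (sgsum m t (cs n c s) x) `^ q =
    \sum_(s <- signs n) \sum_(t <- signs m)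
      sqc (\sum_(k < m) (-1) ^+ t k * \sum_(j < n) (-1) ^+ s j * (c j k * e k x)) `^ q.
    apply: eq_bigr => s _; apply: eq_bigr => t _; rewrite sgsumE; congr (sqc _ `^ _).
    apply: eq_bigr => k _; congr (_ * _); rewrite mulr_suml; apply: eq_bigr => j _.
    by rewrite mulrA.
  split; apply: J_le; [exact: ie|exact/itgZ/itgZ| |exact: itgZ|exact/itgZ/ie|] => // x.
    by rewrite E; have [] := hB2 m n (fun j k => c j k * e k x).
  by rewrite E; have [] := hB2 m n (fun j k => c j k * e k x).
exists (B * C `^ p * B2 * (B2 * C `^ p * B)) => [|n f m b].
  by rewrite !mulr_ge0 ?powR_ge0 ?ltW.
have Cp : 0 <= C `^ p by exact: powR_ge0.
pose c j k := a (f j) k; pose c' j k := if b j k then a (f j) k else 0.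
have h1 : J (S2 n m c) <= B2 * C `^ p * B * J (S n f).
  have [_ k2] := K2 n m c; have [k1 _] := K1 n f.
  apply: (chain1 (e20 n) (e20 m) (ltW B20) Cp k2 _ k1).
  rewrite !mulr_sumr; apply: ler_sum => s _.
  rewrite -natrX mulr_natl -(sum_signs_cst m); apply: ler_sum => t _.
  suff -> : cs n c s = a (g n f s) by exact: hI.
  by apply/funext => k; rewrite asum; apply: eq_bigr => j _; rewrite aZ.
have h2 : J (S n (fun j => Lproj m (b j) (f j))) <= B * C `^ p * B2 * J (S2 n m c').
  have [_ k1] := K1 n (fun j => Lproj m (b j) (f j)); have [k2 _] := K2 n m c'.
  apply: (chain2 (e20 n) (e20 m) (ltW B0) Cp k1 _ k2).
  rewrite !mulr_sumr; apply: ler_sum => s _.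
  rewrite mulr_sumr -natrX mulr_natl -(sum_signs_cst m); apply: ler_sum => t _.
  (* Changing signs twice by the same [t] is the identity on the span, so the sign bound also bounds
     a vector by its sign-changed version. *)
  have -> : g n (fun j => Lproj m (b j) (f j)) s = sgsum m t (a (sgsum m t (cs n c' s))).
    rewrite /g /sgsum.
    transitivity (\sum_(k < m) cs n c' s k *: e k).
      under eq_bigr do rewrite /Lproj big_mkcond scaler_sumr.
      rewrite exchange_big/=; apply: eq_bigr => k _; rewrite scaler_suml.
      apply: eq_bigr => j _; rewrite /c'; case: (b j k); first by rewrite scalerA.
      by rewrite mulr0 scaler0 scale0r.
    apply: eq_bigr => k _; congr (_ *: _); rewrite sgsum_coef ltn_ord mulrA.
    by rewrite -expr2 sqrr_sign mul1r.
  exact: hI.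
(* In the double square function the projections merely delete terms; this makes the constant
   independent of them, even when each [f j] has its own. *)
have h3 : J (S2 n m c') <= J (S2 n m c).
  apply: J_le => // x; apply: powR_le2; first exact: ltW.
    by apply: sumr_ge0 => j _; apply: sumr_ge0 => k _; exact: sqc_ge0.
  apply: ler_sum => j _; apply: ler_sum => k _; rewrite /c' /c; case: (b j k) => //.
  by rewrite mul0r /sqc/= expr0n/= addr0; exact: sqc_ge0.
have BC : 0 <= B * C `^ p * B2 by rewrite !mulr_ge0// ltW.
have h4 := le_trans h2 (ler_wpM2l BC (le_trans h3 h1)).
rewrite mulrA in h4; exact: h4.
Qed.

End square_functions.

(** * Normalised densities and integration against them *)

Section integral_positivity.
Context {d : measure_display} {T : measurableType d} {R : realType}.
Variable mu : {measure set T -> \bar R}.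
Local Notation J f := (Rintegral mu [set: T] f).

Lemma J_gt0 (f h : T -> R) : itg mu f -> itg mu h -> (forall x, 0 <= h x) ->
  (forall x, h x = 0 -> f x = 0) -> 0 < J f -> 0 < J h.
Proof.
move=> fi hi h0 hf Jf; rewrite lt_neqAle J_ge0// andbT; apply/eqP => Jh.
have mh : measurable_fun [set: T] (EFin \o h) by apply/measurable_EFinP; exact: itg_measurable hi.
have : ae_eq mu [set: T] (EFin \o h) (cst 0%E).
  apply/ae_eq_integral_abs => //.
  under eq_integral do rewrite /= ger0_norm//.
  by rewrite EFin_Rintegral// -Jh.
move=> aeh; suff : J f <= 0 by rewrite leNgt Jf.
have := @J_ae_le _ _ _ mu f (cst 0) fi (integrable0 _ _).
rewrite (_ : J (cst 0) = 0); last by rewrite /Rintegral integral0.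
by apply; apply: filterS aeh => x /(_ I)[] hx /=; rewrite hf.
Qed.

Lemma exists_normalized_density (h : T -> R) : itg mu h -> (forall x, 0 < h x) ->
  0 < J h -> exists g : density mu, forall x, g x = (J h)^-1 * h x.
Proof.
move=> ih h0 Zh; pose g x := (J h)^-1 * h x.
have g0 x : 0 < g x by rewrite mulr_gt0 ?invr_gt0.
have mg : measurable_fun [set: T] g.
  apply: measurable_funM; [exact: measurable_cst|exact: itg_measurable ih].
have gN : ('N[mu]_1[EFin \o g])%E = 1%E.
  rewrite Lnorm1; under eq_integral do rewrite /= ger0_norm ?(ltW (g0 _))//.
  by rewrite EFin_Rintegral ?JZ// ?mulVf ?gt_eqF//; exact: itgZ.
by exists (Density mg g0 gN).
Qed.

End integral_positivity.

Section density_integral.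
Context {d : measure_display} {T : measurableType d} {R : realType}.
Variables (mu : {sigma_finite_measure set T -> \bar R}) (g : density mu).
Notation nu := (density_measure g).

Let mg : measurable_fun [set: T] g. Proof. exact: density_measurable. Qed.
Let g0 x : 0 <= g x. Proof. exact/ltW/density_gt0. Qed.

Let int_g : (\int[mu]_x (g x)%:E = 1)%E.
Proof.
rewrite -(density_Lnorm1 g) Lnorm1; apply: eq_integral => x _ /=.
by rewrite ger0_norm.
Qed.

Lemma density_itg : itg mu g.
Proof. by apply/itg_ge0P => //; rewrite int_g ltry. Qed.

Lemma density_measureT : nu [set: T] = 1%E.
Proof. exact: int_g. Qed.

Let nu_fin : fin_num_fun nu.
Proof.
move=> A mA; rewrite ge0_fin_numE//; apply: (@le_lt_trans _ _ 1%E); last exact: ltry.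
by rewrite -density_measureT; apply: le_measure; rewrite ?inE.
Qed.

HB.instance Definition _ := Measure_isFinite.Build _ _ _ nu nu_fin.

Let nu_mu : nu `<< mu.
Proof.
apply/null_content_dominatesP => A mA muA0.
apply: null_set_integral => //.
by apply: measurable_funTS; exact/measurable_EFinP.
Qed.

(* The Radon-Nikodym derivative of [nu] is [g]. *)
Lemma integral_density (f : T -> R) : measurable_fun [set: T] f -> (forall x, 0 <= f x) ->
  (\int[nu]_x (f x)%:E = \int[mu]_x (f x * g x)%:E)%E.
Proof.
move=> mf f0; have mfE : measurable_fun [set: T] (fun x => (f x)%:E) by exact/measurable_EFinP.
pose h := Radon_Nikodym_SigmaFinite.f nu mu.
have ih : mu.-integrable [set: T] h by exact: (Radon_Nikodym_SigmaFinite.f_integrable nu_mu).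
have hg : ae_eq mu [set: T] h (EFin \o g).
  apply: integral_ae_eq => //; first exact/measurable_EFinP.
  by move=> E _ mE; rewrite -Radon_Nikodym_SigmaFinite.f_integral.
rewrite -(Radon_Nikodym_SigmaFinite.change_of_variables nu_mu _ measurableT mfE); last first.
  by move=> x; rewrite lee_fin.
apply: ae_eq_integral => //.
- by apply: emeasurable_funM => //; exact: measurable_int ih.
- by apply/measurable_EFinP/measurable_funM.
by apply: filterS hg => x h' Dx; rewrite EFinM -[Radon_Nikodym_SigmaFinite.f _ _ _]/(h x) h'.
Qed.

Lemma itg_density (f : T -> R) : measurable_fun [set: T] f ->
  itg nu f <-> itg mu (fun x => f x * g x).
Proof.
move=> mf.
have mfg : measurable_fun [set: T] (fun x => f x * g x) by exact: measurable_funM.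
have n0 x : 0 <= `|f x| by [].
have mn : measurable_fun [set: T] (fun x => `|f x|) by exact: measurableT_comp.
have E : (\int[nu]_x `|(EFin \o f) x| = \int[mu]_x `|(EFin \o (fun x => f x * g x)%R) x|)%E.
  rewrite (integral_density mn n0); apply: eq_integral => x _ /=.
  by rewrite normrM (ger0_norm (g0 x)).
split=> /integrableP[_ h]; apply/integrableP.
  by split; [exact/measurable_EFinP|rewrite -E].
by split; [exact/measurable_EFinP|rewrite E].
Qed.

Lemma Rintegral_density (f : T -> R) : itg nu f ->
  \int[nu]_x f x = \int[mu]_x (f x * g x).
Proof.
move=> fi; have mf := itg_measurable fi.
have pos (h : T -> R) : itg nu h -> (forall x, 0 <= h x) ->
    \int[nu]_x h x = \int[mu]_x (h x * g x).
  by move=> hi h0; rewrite /Rintegral integral_density//; exact: itg_measurable hi.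
pose fp x := Num.max (f x) 0; pose fn x := Num.max (- f x) 0.
have ip : itg nu fp.
  apply: (itg_le _ (itg_norm fi)) => [|x].
    by apply: measurable_maxr => //; exact: measurable_cst.
  by rewrite ger0_norm /fp ?le_max ?lexx ?orbT// ge_max ler_norm normr_ge0.
have in_ : itg nu fn.
  apply: (itg_le _ (itg_norm fi)) => [|x].
    by apply: measurable_maxr; [exact: measurableT_comp|exact: measurable_cst].
  by rewrite ger0_norm /fn ?le_max ?lexx ?orbT// ge_max -normrN ler_norm normr_ge0.
have fE : f = fp \- fn.
  by apply/funext => x; rewrite /fp /fn /=; case: (leP (f x) 0) => ?; case: (leP (- f x) 0) => ?; lra.
have p0 x : 0 <= fp x by rewrite le_max lexx orbT.
have n0 x : 0 <= fn x by rewrite le_max lexx orbT.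
rewrite {1}fE JB// (pos _ ip p0) (pos _ in_ n0) -JB.
- by apply: J_eq => x /=; rewrite -mulrBl fE.
- by apply/(itg_density _).1 => //; exact: itg_measurable ip.
- by apply/(itg_density _).1 => //; exact: itg_measurable in_.
Qed.

End density_integral.

(** * Weighted quadratic integrals *)

Section weighted_L2.
Context {d : measure_display} {T : measurableType d} {R : realType}.
Variable mu : {measure set T -> \bar R}.
Implicit Types (w : T -> R) (f g : T -> R[i]).
Local Notation J f := (Rintegral mu [set: T] f).

Definition Iw w f : R := J (fun x => sqc (f x) * w x).

Definition Lw w f : Prop := cmeasurable f /\ itg mu (fun x => sqc (f x) * w x).

Lemma Iw_ge0 w f : (forall x, 0 <= w x) -> 0 <= Iw w f.
Proof. by move=> w0; apply: J_ge0 => x; rewrite mulr_ge0// sqc_ge0. Qed.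

Lemma LwZ w c f : Lw w f -> Lw w (c *: f).
Proof.
move=> [mf fi]; split; first exact: cmeasurableZ.
have := itgZ (sqc c) fi; apply: eq_integrable => // x _ /=.
by rewrite mulrA -sqcM.
Qed.

Lemma LwD w f g : measurable_fun [set: T] w -> (forall x, 0 <= w x) ->
  Lw w f -> Lw w g -> Lw w (f + g).
Proof.
move=> mw w0 [mf fi] [mg gi]; have mfg := cmeasurableD mf mg; split => //.
apply: (itg_le _ (itgD (itgZ 2 fi) (itgZ 2 gi))) => [|x /=].
  by apply: measurable_funM => //; exact: measurable_sqc.
rewrite ger0_norm ?mulr_ge0 ?sqc_ge0// !mulrA -mulrDl ler_wpM2r//.
exact: sqcD_le.
Qed.

Lemma IwD w f g : measurable_fun [set: T] w -> (forall x, 0 <= w x) ->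
  Lw w f -> Lw w g -> Iw w (f + g) <= 2 * Iw w f + 2 * Iw w g.
Proof.
move=> mw w0 Lf Lg; have [_ fgi] := LwD mw w0 Lf Lg; have [_ fi] := Lf; have [_ gi] := Lg.
rewrite -(JZ _ fi) -(JZ _ gi) -(JD (itgZ 2 fi) (itgZ 2 gi)).
apply: J_le => //; first by apply: itgD; exact: itgZ.
by move=> x /=; rewrite !mulrA -mulrDl ler_wpM2r//; exact: sqcD_le.
Qed.

Lemma Lw0 w : Lw w 0.
Proof.
split; first exact: cmeasurable_cst.
rewrite (_ : (fun x => _) = cst 0); first exact: integrable0.
by apply/funext => x; rewrite /sqc /= expr0n/= addr0 mul0r.
Qed.

Lemma LwN w f : Lw w f -> Lw w (- f).
Proof. by rewrite -scaleN1r; exact: LwZ. Qed.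

Lemma IwN w f : Iw w (- f) = Iw w f.
Proof. by apply: J_eq => x; rewrite sqcN. Qed.

Lemma Lw_sum w (I : Type) (s : seq I) (P : pred I) (F : I -> T -> R[i]) :
  measurable_fun [set: T] w -> (forall x, 0 <= w x) ->
  (forall i, P i -> Lw w (F i)) -> Lw w (\sum_(i <- s | P i) F i).
Proof.
move=> mw w0 h; elim/big_rec: _ => [|i g Pi Lg]; first exact: Lw0.
by apply: LwD => //; exact: h.
Qed.

End weighted_L2.

Section sign_averages.
Context {R : realType}.

(** Signs are orthogonal, so the quadratic case of Khintchine's inequality is an identity. *)
Lemma sum_signs_sqc n (z : nat -> R[i]) :
  \sum_(s <- signs n) sqc (\sum_(j < n) (-1) ^+ s j * z j) = 2 ^+ n * \sum_(j < n) sqc (z j).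
Proof.
pose x j (b : bool) := if b then complex.Re (z j) else complex.Im (z j).
transitivity (\sum_(s <- signs n) nrm2 (rsum n x s)).
  apply: eq_bigr => s _; rewrite /nrm2 big_bool /sqc Re_sum Im_sum /rsum.
  by congr (_ ^+ 2 + _ ^+ 2); apply: eq_bigr => j _; rewrite ?Re_sign ?Im_sign.
rewrite rsum_second_moment; congr (_ * _); apply: eq_bigr => j _.
by rewrite /nrm2 big_bool.
Qed.

End sign_averages.

(** * Construction of the reference density and of the weight *)

Section weight.
Context {d : measure_display} {T : measurableType d} {R : realType}.
Variable mu : {sigma_finite_measure set T -> \bar R}.
Variables (p : R) (p1 : 1 <= p).
Local Notation q := (p / 2).
Local Notation J f := (Rintegral mu [set: T] f).
Local Notation X := (Lpt mu p1).

Let q0 : 0 < q. Proof. by rewrite divr_gt0// (lt_le_trans _ p1). Qed.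
Let qn0 : q != 0. Proof. by rewrite gt_eqF. Qed.

Variable e : nat -> X.
Hypothesis e_gt0 : forall k, 0 < LptN (e k).

Let sigma_finite_cover : exists F : nat -> set T,
  [/\ forall x, exists n, F n x, forall n, measurable (F n) & forall n, (mu (F n) < +oo)%E].
Proof.
have [F FT F2] := sigma_finiteT mu; exists F; split=> [x|n|n].
- have : [set: T] x by []. by rewrite FT => -[n _ ?]; exists n.
- exact: (F2 n).1.
- exact: (F2 n).2.
Qed.

Let sq n x := sqc (e n x) `^ q.
Let Isq n := J (sq n).

Let isq n : itg mu (sq n). Proof. exact: Lpt_itg. Qed.

Let Isq0 n : 0 < Isq n.
Proof. by rewrite /Isq -LptN_powR powR_gt0. Qed.

(** A normalised series of indicators of a cover by sets of finite measure, for positivity, and of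
    the functions |e_n|^p, for the domination of each of them. *)
Let exists_positive : exists E : T -> R, [/\ itg mu E, forall x, 0 <= E x,
  {ae mu, forall x, 0 < E x} &
  forall n, exists2 c : R, 0 < c & {ae mu, forall x, c * sq n x <= E x}].
Proof.
have [F [Fx mF muF]] := sigma_finite_cover.
pose ind n x : R := \1_(F n) x.
have iind n : itg mu (ind n).
  apply/itg_ge0P.
  - exact: measurable_indic.
  - by move=> x; rewrite /ind indicE.
  - by rewrite /ind integral_indic// setIT; exact: muF.
have ind0 n x : 0 <= ind n x by rewrite /ind indicE.
have Jind0 n : 0 <= J (ind n) by exact: J_ge0.
have c0 n : 0 < 1 + J (ind n) by rewrite ltr_wpDr.
have c0' n : 0 < 1 + Isq n by rewrite addr_gt0.
have half0 n : 0 < (2^-1 : R) ^+ n by rewrite exprn_gt0// invr_gt0.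
pose G n x := 2^-1 ^+ n * ((1 + J (ind n))^-1 * ind n x + (1 + Isq n)^-1 * sq n x).
have iG n : itg mu (G n) by apply/itgZ/itgD; apply: itgZ.
have G0 n x : 0 <= G n x.
  by rewrite mulr_ge0 ?(ltW (half0 n))// addr_ge0// mulr_ge0 ?invr_ge0 ?powR_ge0// ltW.
have JG n : J (G n) <= 2 * 2^-1 ^+ n.
  rewrite /G JZ; last by apply: itgD; exact: itgZ.
  rewrite mulrC ler_wpM2r ?(ltW (half0 n))//.
  rewrite (JD (itgZ _ (iind n)) (itgZ _ (isq n))) !JZ//.
  have -> : 2 = 1 + 1 :> R by lra.
  by apply: lerD; rewrite mulrC ler_pdivrMr ?mul1r ?lerDr.
have [n|E [iE E0 _ aeE]] := @itg_series _ _ _ mu G (2 * (1 - 2^-1)^-1) iG G0.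
  apply: (@le_trans _ _ (\sum_(k < n) 2 * 2^-1 ^+ k)); first exact: ler_sum.
  by rewrite -mulr_sumr ler_wpM2l// geometric_sum_le//; lra.
have GE : {ae mu, forall x, forall n, G n x <= E x}.
  apply: filterS aeE => x h n; apply: le_trans (h n.+1).
  by rewrite big_ord_recr/= lerDr sumr_ge0.
exists E; split => // [|n].
  apply: filterS GE => x h; have [n Fnx] := Fx x; apply: lt_le_trans (h n).
  rewrite mulr_gt0// ltr_pwDl//; last by rewrite mulr_ge0 ?powR_ge0// invr_ge0 ltW.
  by rewrite mulr_gt0 ?invr_gt0// /ind indicE mem_set.
exists (2^-1 ^+ n * (1 + Isq n)^-1); first by rewrite mulr_gt0 ?invr_gt0.
apply: filterS GE => x h; apply: le_trans (h n).
by rewrite -mulrA ler_wpM2l ?(ltW (half0 n))// lerDr mulr_ge0// invr_ge0 ltW.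
Qed.

(** With u = g^(1/q), the case q >= 1 is [mulr_powR_le]. For q < 1 the exponent q - 1 is negative,
    so u must dominate a multiple C |e_k|^2; then |e_k|^2 u^(q-1) <= C^(q-1) |e_k|^(2q). *)
Lemma exists_density : exists g : density mu,
  forall k, Lw mu (fun x => (g x `^ q^-1) `^ (q - 1)) (e k).
Proof.
have [E [iE E0 aeE Esq]] := exists_positive.
(* A density is positive everywhere, so [E] is altered on a null set. *)
pose h x := if 0 < E x then E x else 1.
have mE : measurable_fun [set: T] E by exact: itg_measurable iE.
have mh : measurable_fun [set: T] h.
  by apply: measurable_fun_ifT => //; exact: measurable_fun_ltr.
have h0 x : 0 < h x by rewrite /h; case: ifPn.
have aeh : {ae mu, forall x, h x = E x} by apply: filterS aeE => x; rewrite /h => ->.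
have ih : itg mu h.
  by apply: (itg_ae_le mh iE); apply: filterS aeh => x <-; rewrite ger0_norm// ltW.
have Zh : 0 < J h.
  have [c c0 ae0] := Esq 0%N.
  apply: (@lt_le_trans _ _ (c * Isq 0)); first exact: mulr_gt0.
  rewrite -(JZ _ (isq 0)); apply: J_ae_le => //; first exact: itgZ.
  by apply: filterS2 ae0 aeh => x ? ->.
have [g gE] := exists_normalized_density ih h0 Zh.
have g0 x : 0 < g x by exact: density_gt0.
have mg : measurable_fun [set: T] g by exact: density_measurable.
have ig : itg mu g by exact: density_itg.
exists g => k.
have [me _] := Lpv_cLp (e k); split=> //.
have ms := measurable_sqc me.
have mw : measurable_fun [set: T] (fun x => sqc (e k x) * (g x `^ q^-1) `^ (q - 1)).
  by apply: measurable_funM => //; do 2 apply: measurable_powRf.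
have uq x : (g x `^ q^-1) `^ q = g x by rewrite -powRrM mulVf// powRr1// ltW.
have [qge1|qlt1] := leP 1 q.
  apply: (itg_le mw (itgD (isq k) ig)) => x.
  rewrite ger0_norm ?mulr_ge0 ?sqc_ge0 ?powR_ge0//=.
  by rewrite -[X in _ <= _ + X]uq; apply: mulr_powR_le => //; rewrite ?sqc_ge0 ?powR_ge0.
have [c c0 aec] := Esq k; pose c' := (J h)^-1 * c.
have c'0 : 0 < c' by rewrite mulr_gt0 ?invr_gt0.
pose C := c' `^ q^-1; have C0 : 0 < C by exact: powR_gt0.
apply: (itg_ae_le mw (itgZ (C `^ (q - 1)) (isq k))).
apply: filterS2 aec aeh => x h1 h2.
rewrite ger0_norm ?mulr_ge0 ?sqc_ge0 ?powR_ge0//.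
have := sqc_ge0 (e k x); rewrite le_eqVlt => /predU1P[<-|S0].
  by rewrite mul0r mulr_ge0 ?powR_ge0.
have CS : C * sqc (e k x) <= g x `^ q^-1.
  have -> : C * sqc (e k x) = (c' * sq k x) `^ q^-1.
    rewrite powRM ?powR_ge0 ?(ltW c'0)// /sq -powRrM mulfV// powRr1// ltW//.
  apply: powR_le2; [by rewrite invr_ge0 ltW|by apply: mulr_ge0; [exact: ltW|exact: powR_ge0]|].
  by rewrite /c' gE -mulrA ler_wpM2l ?invr_ge0 ?(ltW Zh)// h2.
apply: (@le_trans _ _ (sqc (e k x) * (C * sqc (e k x)) `^ (q - 1))).
  apply: ler_wpM2l; first exact: ltW.
  rewrite -(opprB 1 q) !powRN lef_pV2 ?posrE; last 2 first.
  - by apply: powR_gt0; apply: powR_gt0.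
  - by apply: powR_gt0; apply: mulr_gt0.
  by apply: powR_le2 => //; [lra|rewrite mulr_ge0// ltW].
by rewrite powRM ?(ltW C0) ?(ltW S0)// mulrCA mulr_powRB1// ltW.
Qed.

Hypothesis basis_e : is_unconditional_basis setT (fun f => (LptN f)%:E) e.
Variable a : X -> nat -> R[i].
Hypothesis a_sums : forall f, sums_to (fun f => (LptN f)%:E) (fun k => a f k *: e k) f.
Hypothesis a_unique : forall f c,
  sums_to (fun f => (LptN f)%:E) (fun k => c k *: e k) f -> c = a f.

Let max_divr (y u : R) : 0 < u -> (Num.max 0 (y / u)) `^ q * u `^ q = (Num.max 0 y) `^ q.
Proof.
move=> u0; rewrite -powRM ?le_max ?lexx ?(ltW u0)//; congr (_ `^ _).
have [y0|y0] := leP 0 y.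
  by rewrite (max_idPr _) ?divr_ge0 ?(ltW u0)// divfK// gt_eqF.
by rewrite (max_idPl _) ?mul0r// ler_pdivrMr// mul0r ltW.
Qed.

(** Turns the square function bound into the hypothesis [DDle]. With k^q = 2(K + 1), wherever the
    positive part of 2k h - h' is below k h one has h' > k h. Thus k^q h^q is at most the sum of the
    q-th powers of that part and of h', and integration leaves at least K + 2 times the integral of
    h^q. *)
Let negative_part_le (K : R) : 0 <= K -> exists2 K0 : R, 0 <= K0 &
  forall h h' : T -> R, (forall x, 0 <= h x) -> (forall x, 0 <= h' x) ->
   measurable_fun [set: T] h -> measurable_fun [set: T] h' ->
   itg mu (fun x => h x `^ q) -> itg mu (fun x => h' x `^ q) ->
   J (fun x => h' x `^ q) <= K * J (fun x => h x `^ q) ->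
   J (fun x => (Num.max 0 (- (K0 * h x - h' x))) `^ q)
     <= J (fun x => (Num.max 0 (K0 * h x - h' x)) `^ q).
Proof.
move=> K0; pose t := 2 * (K + 1); have t0 : 0 < t by rewrite mulr_gt0// ltr_wpDl.
pose k := t `^ q^-1; have k0 : 0 < k by exact: powR_gt0.
have kq : k `^ q = t by rewrite -powRrM mulVf// powRr1// ltW.
exists (2 * k) => [|h h' h0 h'0 mh mh' ih ih' hh']; first by rewrite mulr_ge0// ltW.
pose A x := Num.max 0 (2 * k * h x - h' x); pose B x := Num.max 0 (- (2 * k * h x - h' x)).
have A0 x : 0 <= A x by rewrite le_max lexx.
have B0 x : 0 <= B x by rewrite le_max lexx.
have mD : measurable_fun [set: T] (fun x => 2 * k * h x - h' x).
  by apply: measurable_funB => //; apply: measurable_funM => //; exact: measurable_cst.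
have Bh x : B x `^ q <= h' x `^ q.
  apply: powR_le2; rewrite ?(ltW q0)// ge_max h'0/= opprB gerBl.
  by rewrite !mulr_ge0// ltW.
have iB : itg mu (fun x => B x `^ q).
  apply: (itg_le _ ih') => [|x]; last by rewrite ger0_norm ?powR_ge0.
  apply/measurable_powRf/measurable_maxr; first exact: measurable_cst.
  exact: measurableT_comp.
have iA : itg mu (fun x => A x `^ q).
  apply: (itg_le _ (itgZ ((2 * k) `^ q) ih)) => [|x].
    by apply/measurable_powRf/measurable_maxr => //; exact: measurable_cst.
  rewrite ger0_norm ?powR_ge0// -powRM ?mulr_ge0 ?(ltW k0)//.
  apply: powR_le2; rewrite ?(ltW q0)// ge_max gerBl h'0 andbT.
  by rewrite !mulr_ge0// ltW.
have hA x : t * h x `^ q <= A x `^ q + h' x `^ q.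
  rewrite -kq -powRM ?(ltW k0)//.
  have [le1|le1] := leP (k * h x) (A x).
    apply: (@le_trans _ _ (A x `^ q)); last by rewrite lerDl powR_ge0.
    by apply: powR_le2; rewrite ?(ltW q0)// mulr_ge0// ltW.
  apply: (@le_trans _ _ (h' x `^ q)); last by rewrite lerDr powR_ge0.
  apply: powR_le2; rewrite ?(ltW q0)// ?mulr_ge0 ?(ltW k0)//.
  have : 2 * k * h x - h' x <= A x by rewrite le_max lexx orbT.
  lra.
have := J_le (itgZ t ih) (itgD iA ih') hA; rewrite (JZ _ ih) (JD iA ih') => h1.
apply: (le_trans (J_le iB ih' Bh)); apply: (le_trans hh').
have : 0 <= J (fun x => h x `^ q) by apply: J_ge0 => x; exact: powR_ge0.
move: h1 hh' K0; rewrite /t; set a1 := J _; set a2 := J _; set a3 := J _; nra.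
Qed.

(* [convex_cone_weight] is applied to the measure of density [u `^ q] and to the
   functions [(K0 * \sum_j |f_j|^2 - \sum_j |P_j f_j|^2) / u], where the [P_j] are
   coordinate projections; they form a cone because finite families of pairs
   [(f_j, P_j)] can be concatenated. *)
Lemma weight_exists : exists u v : T -> R,
  [/\ measurable_fun [set: T] u, measurable_fun [set: T] v, forall x, 0 < u x,
      forall x, u x <= v x & itg mu (fun x => v x `^ q)] /\
  [/\ forall k, Lw mu (fun x => u x `^ (q - 1)) (e k),
      forall f : X, Lw mu (fun x => u x `^ (q - 1)) f -> Lw mu (fun x => v x `^ (q - 1)) f &
      exists2 C : R, 0 <= C & forall f : X, Lw mu (fun x => u x `^ (q - 1)) f ->
        forall m b, Iw mu (fun x => v x `^ (q - 1)) (Lproj e a m b f)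
          <= C * Iw mu (fun x => v x `^ (q - 1)) f].
Proof.
have [g hg] := exists_density.
pose u x := g x `^ q^-1.
have g0 x : 0 < g x by exact: density_gt0.
have u0 x : 0 < u x by exact: powR_gt0.
have uq x : u x `^ q = g x by rewrite -powRrM mulVf// powRr1// ltW.
have mg : measurable_fun [set: T] g by exact: density_measurable.
have mu_ : measurable_fun [set: T] u by exact: measurable_powRf.
have uu x : (u x)^-1 * g x = u x `^ (q - 1).
  rewrite -uq -(mulr_powRB1 (ltW (u0 x)) q0) mulrA mulVf ?mul1r// gt_eqF//.
pose wu x := u x `^ (q - 1).
have mwu : measurable_fun [set: T] wu by exact: measurable_powRf.
have wu0 x : 0 <= wu x by exact: powR_ge0.
have LwP m b f : Lw mu wu (Lproj e a m b f).
  have -> : (Lproj e a m b f : T -> R[i]) = \sum_(k < m | b k) a f k *: (e k : T -> R[i]).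
    by apply/funext => x; rewrite Lpt_sumE fct_sumE.
  by apply: Lw_sum => // k _; apply: LwZ; exact: hg.
have [K K_ge0 hK] := square_function_bound basis_e a_sums a_unique.
have [K0 K00 hK0] := negative_part_le K_ge0.
pose h n (f : nat -> X) x := \sum_(j < n) sqc (f j x).
have h0 n f x : 0 <= h n f x by apply: sumr_ge0 => j _; exact: sqc_ge0.
have mh n f : measurable_fun [set: T] (h n f).
  by apply: measurable_sum => j; exact: Lpt_measurable.
have ih n f : itg mu (fun x => h n f x `^ q).
  apply: (@itg_sum_powR _ _ _ mu p p1 n (fun j x => sqc (f j x))) => [j|j x|j].
  - exact: Lpt_measurable.
  - exact: sqc_ge0.
  - exact: Lpt_itg.
have ihw n f : (forall j, Lw mu wu (f j : X)) -> itg mu (fun x => h n f x * wu x).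
  move=> Lf; have := @itg_sum _ _ _ mu _ (index_enum 'I_n) xpredT
    (fun j x => sqc (f j x) * wu x) (fun j _ => (Lf j).2).
  by apply: eq_integrable => // x _ /=; rewrite mulr_suml.
pose Pf m (b : nat -> pred nat) (f : nat -> X) j := Lproj e a m (b j) (f j).
(* Dividing by [u] matches the measure: |F|^q g = |u F|^q because g = u^q, so integrals of q-th
   powers against g dmu become unweighted ones. *)
pose D n f m b x := (K0 * h n f x - h n (Pf m b f) x) / u x.
pose DD : set (T -> R) := [set F | exists n f m b,
  (forall j, Lw mu wu (f j : X)) /\ F = D n f m b].
have mD n f m b : measurable_fun [set: T] (D n f m b).
  apply: measurable_funM.
    by apply: measurable_funB => //; apply: measurable_funM => //; exact: measurable_cst.
  under eq_fun do rewrite -powR_inv1 ?(ltW (u0 _))//.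
  exact: measurable_powRf.
have goodD F : DD F -> itg (density_measure g) F /\
    itg (density_measure g) (fun x => `|F x| `^ q).
  move=> [n [f [m [b [Lf ->]]]]]; split.
    apply/itg_density => //.
    have := itgB (itgZ K0 (ihw n f Lf)) (ihw n (Pf m b f) (fun j => LwP m (b j) (f j))).
    by apply: eq_integrable => // x _ /=; rewrite /D -mulrA uu -/(wu x); congr (_%:E); ring.
  apply/itg_density; first by apply/measurable_powRf/measurableT_comp.
  apply: (itg_le _ (itgZ (2 `^ q) (itgD (itgZ (K0 `^ q) (ih n f)) (ih n (Pf m b f))))) => [|x /=].
    by apply: measurable_funM => //; apply/measurable_powRf/measurableT_comp.
  rewrite -{1}uq -powRM ?(ltW (u0 x))// ger0_norm ?powR_ge0// -powRM//.
  apply: le_trans (powR_le_add q0 (mulr_ge0 K00 (h0 n f x)) (h0 _ _ x)).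
  apply: powR_le2; rewrite ?(ltW q0)// ?mulr_ge0 ?(ltW (u0 x))//.
  rewrite /D normrM [`|_^-1|]ger0_norm ?invr_ge0 ?(ltW (u0 x))// divfK ?gt_eqF//.
  apply: (le_trans (ler_normB _ _)).
  by rewrite !ger0_norm// mulr_ge0.
have DD0 : DD (cst 0).
  exists 0%N, (fun=> 0), 0%N, (fun _ _ => false); split=> [j|]; first exact: Lw0.
  by apply/funext => x; rewrite /D /h !big_ord0 mulr0 subrr mul0r.
have DDD F G : DD F -> DD G -> DD (F \+ G).
  move=> [n [f [m [b [Lf ->]]]]] [n' [f' [m' [b' [Lf' ->]]]]].
  pose f'' j := if (j < n)%N then f j else f' (j - n)%N.
  (* The two families are truncated at different lengths; the conditions on [k] preserve their
     projections at the common length. *)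
  pose b'' j k := if (j < n)%N then b j k && (k < m)%N else b' (j - n)%N k && (k < m')%N.
  exists (n + n')%N, f'', (maxn m m'), b''; split=> [j|].
    by rewrite /f''; case: ifP.
  have proj l l' (c : pred nat) F' : (l <= l')%N ->
      Lproj e a l' (fun k => c k && (k < l)%N) F' = Lproj e a l c F'.
    by move=> ll; rewrite /Lproj (big_ord_widen_cond l' c (fun k => a F' k *: e k)).
  have hs x : h (n + n')%N f'' x = h n f x + h n' f' x.
    rewrite /h big_split_ord/=; congr (_ + _); apply: eq_bigr => j _.
      by rewrite /f'' ltn_ord.
    by rewrite /f'' ltnNge leq_addr/= addKn.
  have hs' x : h (n + n')%N (Pf (maxn m m') b'' f'') x = h n (Pf m b f) x + h n' (Pf m' b' f') x.
    rewrite /h big_split_ord/=; congr (_ + _); apply: eq_bigr => j _.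
      rewrite /Pf /f'' /b'' ltn_ord -(proj m (maxn m m')) ?leq_maxl//.
    rewrite /Pf /f'' /b'' ltnNge leq_addr/= addKn -(proj m' (maxn m m')) ?leq_maxr//.
  by apply/funext => x /=; rewrite /D hs hs'; ring.
have DDZ (c : R) F : 0 <= c -> DD F -> DD (fun x => c * F x).
  move=> c0 [n [f [m [b [Lf ->]]]]].
  pose r : R[i] := (Num.sqrt c)%:C.
  have sr : sqc r = c by rewrite -sqr_normc normc_real ?sqrtr_ge0// sqr_sqrtr.
  exists n, (fun j => r *: f j), m, b; split=> [j|]; first exact: (LwZ r (Lf j)).
  have hs (f' : nat -> X) x : h n (fun j => r *: f' j) x = c * h n f' x.
    by rewrite /h mulr_sumr; apply: eq_bigr => j _; rewrite -sr -sqcM.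
  have PE : Pf m b (fun j => r *: f j) = (fun j => r *: Pf m b f j).
    apply/funext => j; rewrite /Pf /Lproj scaler_sumr; apply: eq_bigr => k _.
    rewrite scalerA; congr (_ *: _).
    exact: (coefZ (@LptN_ge0 _ _ _ mu p p1) (@LptNZ _ _ _ mu p p1) a_sums a_unique).
  by apply/funext => x; rewrite /D PE !hs; ring.
have DDle F : DD F ->
    \int[density_measure g]_x ((Num.max 0 (- F x)) `^ q) <=
    \int[density_measure g]_x ((Num.max 0 (F x)) `^ q).
  move=> DF; have [iF iFq] := goodD F DF.
  have mF := itg_measurable iF.
  have iM (s : T -> R) : measurable_fun [set: T] s -> (forall x, s x <= `|F x|) ->
      itg (density_measure g) (fun x => Num.max 0 (s x) `^ q).
    move=> ms sF; apply: (itg_le _ iFq) => [|x].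
      by apply/measurable_powRf/measurable_maxr => //; exact: measurable_cst.
    rewrite ger0_norm ?powR_ge0//; apply: powR_le2; rewrite ?(ltW q0)// ?le_max ?lexx//.
    by rewrite ge_max normr_ge0 sF.
  rewrite (Rintegral_density (iM _ _ _)); last 2 first.
  - exact: measurableT_comp.
  - by move=> x; rewrite -normrN ler_norm.
  rewrite (Rintegral_density (iM _ mF _)); last by move=> x; exact: ler_norm.
  have [n [f [m [b [Lf FE]]]]] := DF.
  have E1 x : Num.max 0 (- F x) `^ q * g x =
     Num.max 0 (- (K0 * h n f x - h n (Pf m b f) x)) `^ q.
    by rewrite -uq FE /D -mulNr max_divr.
  have E2 x : Num.max 0 (F x) `^ q * g x =
     Num.max 0 (K0 * h n f x - h n (Pf m b f) x) `^ q.
    by rewrite -uq FE /D max_divr.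
  rewrite (J_eq mu E1) (J_eq mu E2); apply: hK0 => //.
  exact: (hK n f m b).
have nuT : (density_measure g [set: T] < +oo)%E by rewrite density_measureT ltry.
have [x [mx x1 ix hx]] := convex_cone_weight nuT q0 goodD DD0 DDD DDZ DDle.
(* The weight against g dmu is x^(q-1), and u^-1 g = u^(q-1), so the condition on the cone becomes
   one with v^(q-1) against mu. *)
pose v t := u t * x t.
have x0 t : 0 < x t by exact: lt_le_trans (x1 t).
have v0 t : 0 < v t by exact: mulr_gt0.
have uv t : u t <= v t by rewrite /v ler_peMr// ltW.
have mv : measurable_fun [set: T] v by exact: measurable_funM.
have iv : itg mu (fun t => v t `^ q).
  have := (itg_density g (itg_measurable ix)).1 ix.
  by apply: eq_integrable => // t _ /=; rewrite /v powRM ?ltW// uq mulrC.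
have LwV (f : X) : Lw mu wu f -> Lw mu (fun t => v t `^ (q - 1)) f.
  move=> [mf fi]; split=> //.
  have mfv : measurable_fun [set: T] (fun t => sqc (f t) * v t `^ (q - 1)).
    by apply: measurable_funM; [exact: measurable_sqc|exact: measurable_powRf].
  have [q1|q1] := leP 1 q.
    apply: (itg_le mfv (itgD (Lpt_itg f) iv)) => t /=.
    rewrite ger0_norm ?mulr_ge0 ?sqc_ge0 ?powR_ge0//.
    by apply: mulr_powR_le => //; rewrite ?sqc_ge0// ltW.
  apply: (itg_le mfv fi) => t; rewrite ger0_norm ?mulr_ge0 ?sqc_ge0 ?powR_ge0//.
  rewrite ler_wpM2l ?sqc_ge0// /wu -(opprB 1 q) !powRN lef_pV2 ?posrE ?powR_gt0//.
  by apply: powR_le2 => //; [lra|exact: ltW].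
exists u, v; split; first by split.
split=> //; exists K0 => // f Lf m b.
(* A family with one member: nonnegativity of its integral is the required estimate. *)
have [|iD JD0] := hx (D 1%N (fun=> f) m (fun=> b)).
  by exists 1%N, (fun=> f), m, (fun=> b).
rewrite (Rintegral_density iD) in JD0.
have [_ i1] := LwV f Lf; have [_ i2] := LwV _ (LwP m b f).
move: JD0; rewrite (@J_eq _ _ _ mu _
  ((fun t => K0 * (sqc (f t) * v t `^ (q - 1))) \-
   (fun t => sqc (Lproj e a m b f t) * v t `^ (q - 1)))).
  by rewrite (JB (itgZ K0 i1) i2) (JZ _ i1) subr_ge0.
move=> t /=; rewrite /D /h !big_ord1 /Pf /v powRM ?ltW// -uu; ring.
Qed.

End weight.

(** * Convergence of expansions in the weighted norm *)

Section weighted_expansion.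
Context {d : measure_display} {T : measurableType d} {R : realType}.
Variable mu : {measure set T -> \bar R}.
Variables (p : R) (p1 : 1 <= p).
Local Notation q := (p / 2).
Local Notation J f := (Rintegral mu [set: T] f).
Local Notation X := (Lpt mu p1).

Let p0 : 0 < p. Proof. exact: lt_le_trans p1. Qed.

Variable e : nat -> X.
Variable a : X -> nat -> R[i].
Hypothesis a_sums : forall f, sums_to (fun f => (LptN f)%:E) (fun k => a f k *: e k) f.
Hypothesis a_unique : forall f c,
  sums_to (fun f => (LptN f)%:E) (fun k => c k *: e k) f -> c = a f.

Local Notation P m b f := (Lproj e a m b f).

Let N0 := @LptN_ge0 _ _ _ mu p p1.
Let ND := @LptND _ _ _ mu p p1.
Let NZ := @LptNZ _ _ _ mu p p1.
Let aZ := coefZ N0 NZ a_sums a_unique.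
Let asum := coef_sum N0 ND NZ a_sums a_unique.
Let abasis := coef_basis N0 NZ a_unique.

Lemma coef_span (c : nat -> R[i]) m k :
  a (\sum_(i < m) c i *: e i) k = if (k < m)%N then c k else 0.
Proof.
rewrite asum; case: ltnP => km.
  rewrite (bigD1 (Ordinal km))//= aZ abasis eqxx mulr1 big1 ?addr0// => j.
  by rewrite -val_eqE/= aZ abasis => /negbTE ->; rewrite mulr0.
rewrite big1// => j _; rewrite aZ abasis ltn_eqF ?mulr0//.
exact: leq_trans (ltn_ord j) km.
Qed.

Lemma Lproj_span (c : nat -> R[i]) m (b : pred nat) :
  P m b (\sum_(i < m) c i *: e i) = \sum_(i < m | b i) c i *: e i.
Proof. by apply: eq_bigr => k _; rewrite coef_span ltn_ord. Qed.

(** [fast_ae_cvg] applied to the partial sums of the moduli, whose increments are the moduli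
    themselves. *)
Lemma ae_cvg_of_LptN (h : nat -> X) : (forall j, LptN (h j) <= 4^-1 ^+ j) ->
  exists K : T -> R, {ae mu, forall x, forall j, normc (h j x) <= K x * 2^-1 ^+ j}.
Proof.
move=> hN; pose F n x := \sum_(j < n) normc (h j x).
have FS n x : `|F n.+1 x - F n x| = normc (h n x).
  by rewrite /F big_ord_recr/= addrAC subrr add0r ger0_norm// normc_ge0.
have mF n : measurable_fun [set: T] (F n).
  by apply: measurable_sum => j; apply: measurable_normc; have [] := Lpv_cLp (h j).
have FE n : (fun x => `|F n.+1 x - F n x| `^ p) = (fun x => sqc (h n x) `^ q).
  by apply/funext => x; rewrite FS normc_powR.
have [n|n|E [f [_ _ _ aeE]]] := @fast_ae_cvg _ _ _ mu p 1 F p0 mF.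
- by rewrite FE; exact: Lpt_itg.
- rewrite mul1r (J_eq mu (fun x => congr1 (@^~ x) (FE n))) -LptN_powR.
  rewrite (_ : _ ^+ n = (4^-1 ^+ n) `^ p).
    by apply: powR_le2; [exact: ltW|exact: N0|exact: hN].
  rewrite -(@powR_mulrn _ 4^-1 n); last by rewrite invr_ge0.
  rewrite powRAC powR_mulrn ?powR_ge0//; congr (_ ^+ _).
  by rewrite -[in RHS](@powR_inv1 _ 4)// -powRrM mulN1r powRN.
exists (fun x => 4 * E x `^ p^-1); apply: filterS aeE => x hx j.
rewrite -FS (_ : F j.+1 x - F j x = (F j.+1 x - f x) - (F j x - f x)); last by ring.
apply: (le_trans (ler_normB _ _)); have h1 := hx j; have := hx j.+1.
rewrite exprS; have : 0 <= E x `^ p^-1 * 2^-1 ^+ j.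
  by rewrite mulr_ge0 ?powR_ge0// exprn_ge0// invr_ge0.
move: h1; set y := E x `^ _; set t := _ ^+ j => h1 h2 h3; nra.
Qed.

Variable w : T -> R.
Hypothesis mw : measurable_fun [set: T] w.
Hypothesis w0 : forall x, 0 <= w x.
(** Instantiated by membership in L^2(u^(q-1) dmu), the functions for which the projection estimate
    is available. *)
Variable good : X -> Prop.
Hypothesis good_Lw : forall f, good f -> Lw mu w f.
Hypothesis good_span : forall (c : nat -> R[i]) m, good (\sum_(k < m) c k *: e k).
Variable C : R.
Hypothesis C0 : 0 <= C.
Hypothesis hC : forall f, good f -> forall m b, Iw mu w (P m b f) <= C * Iw mu w f.

Let Lproj_good m b f : good (P m b f).
Proof.
rewrite /Lproj (_ : \sum_(k < m | _) _ = \sum_(k < m) (if b k then a f k else 0) *: e k).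
  exact: (good_span (fun k => if b k then a f k else 0) m).
by rewrite big_mkcond; apply: eq_bigr => k _; case: (b k); rewrite ?scale0r.
Qed.

Let D (t : nat -> bool) (m : nat) (f : X) : X := \sum_(k < m) ((-1) ^+ t k * a f k) *: e k.

Let D_E t m f x : D t m f x = \sum_(k < m) (-1) ^+ t k * (a f k * e k x).
Proof. by rewrite Lpt_sumE; apply: eq_bigr => k _; rewrite mulrA. Qed.

Let D_good t m f : good (D t m f).
Proof. exact: (good_span (fun k => (-1) ^+ t k * a f k) m). Qed.

Let D_bound t m f : good f -> Iw mu w (D t m f) <= 4 * C * Iw mu w f.
Proof.
move=> gf; have h1 := hC gf m (fun k => ~~ t k); have h2 := hC gf m t.
have -> : (D t m f : T -> R[i]) = (P m (fun k => ~~ t k) f : T -> R[i]) + (- (P m t f : X) : X).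
  suff -> : D t m f = P m (fun k => ~~ t k) f - P m t f by [].
  rewrite /Lproj /D [X in X - _]big_mkcond [X in _ - X]big_mkcond -sumrB.
  apply: eq_bigr => k _; case: (t k) => /=; first by rewrite expr1 sub0r mulN1r scaleNr.
  by rewrite expr0 subr0 mul1r.
have L1 := good_Lw (Lproj_good m (fun k => ~~ t k) f); have L2 := good_Lw (Lproj_good m t f).
apply: (le_trans (IwD mw w0 L1 (LwN L2))).
rewrite (_ : Iw mu w (- P m t f : X) = Iw mu w (P m t f)); last exact: IwN.
by move: h1 h2; lra.
Qed.

Let c k := Iw mu w (e k).

Let e_good k : good (e k).
Proof.
have := good_span (fun i => (i == k)%:R) k.+1.
rewrite big_ord_recr/= eqxx scale1r big1 ?add0r// => i _.
by rewrite ltn_eqF// scale0r.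
Qed.

Let D_average m f : \sum_(t <- signs m) Iw mu w (D t m f) =
  2 ^+ m * \sum_(k < m) sqc (a f k) * c k.
Proof.
rewrite /Iw -J_sum; last by move=> t _; have [] := good_Lw (D_good t m f).
have i2 k : itg mu (fun x => sqc (a f k) * (sqc (e k x) * w x)).
  by apply: itgZ; have [] := good_Lw (e_good k).
transitivity (J (fun x => 2 ^+ m * \sum_(k < m) sqc (a f k) * (sqc (e k x) * w x))).
  apply: J_eq => x; rewrite -mulr_suml.
  under eq_bigr do rewrite D_E.
  rewrite (sum_signs_sqc m (fun k => a f k * e k x)) -mulrA; congr (_ * _).
  by rewrite mulr_suml; apply: eq_bigr => k _; rewrite sqcM mulrA.
rewrite JZ; last by apply: itg_sum.
rewrite J_sum//; congr (_ * _); apply: eq_bigr => k _.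
by rewrite JZ//; have [] := good_Lw (e_good k).
Qed.

Let e2 m : 0 < 2 ^+ m :> R. Proof. by rewrite exprn_gt0. Qed.

Let coef_sum_le m f : good f ->
  \sum_(k < m) sqc (a f k) * c k <= 4 * C * Iw mu w f.
Proof.
move=> gf; rewrite -(ler_pM2l (e2 m)) -D_average.
rewrite -natrX [leRHS]mulr_natl -(sum_signs_cst m (4 * C * Iw mu w f)).
by apply: ler_sum => t _; exact: D_bound.
Qed.

(** [D t m] is an involution on the span of the first [m] vectors, so [D_bound] also bounds a vector
    by each of its sign changes; then average over the signs. *)
Let Iw_le_coef m b f :
  Iw mu w (P m b f) <= 4 * C * \sum_(k < m | b k) sqc (a f k) * c k.
Proof.
set y := P m b f; have gy : good y by exact: Lproj_good.
have ay k : (k < m)%N -> a y k = if b k then a f k else 0.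
  move=> km; have -> : y = \sum_(k < m) (if b k then a f k else 0) *: e k.
    by rewrite /y /Lproj big_mkcond; apply: eq_bigr => i _; case: (b i); rewrite ?scale0r.
  by rewrite (coef_span (fun k => if b k then a f k else 0)) km.
have DD t : D t m (D t m y) = y.
  have E k : (k < m)%N -> a (D t m y) k = (-1) ^+ t k * a y k.
    by move=> km; rewrite /D (coef_span (fun k => (-1) ^+ t k * a y k)) km.
  rewrite {1}/D {2}/y /Lproj [RHS]big_mkcond; apply: eq_bigr => k _.
  rewrite E ?ltn_ord// mulrA -expr2 sqrr_sign mul1r ay ?ltn_ord//.
  by case: (b k); rewrite ?scale0r.
have : 2 ^+ m * Iw mu w y <= 4 * C * \sum_(t <- signs m) Iw mu w (D t m y).
  rewrite -natrX mulr_natl -(sum_signs_cst m (Iw mu w y)) mulr_sumr; apply: ler_sum => t _.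
  by rewrite -{1}(DD t); apply: D_bound; exact: D_good.
rewrite D_average mulrCA ler_pM2l// => /le_trans; apply.
rewrite ler_wpM2l ?mulr_ge0// [leRHS]big_mkcond; apply: ler_sum => k _.
rewrite ay ?ltn_ord//; case: (b k) => //.
by rewrite /sqc /= expr0n/= addr0 mul0r.
Qed.

Let c0 k : 0 <= c k. Proof. exact: Iw_ge0. Qed.

(* Averaging over signs shows that [f |-> Iw mu w f] is equivalent on the span to
   the square sum of the weighted coefficients. The partial sums are thus Cauchy,
   and Fatou's lemma along an a.e. convergent subsequence identifies the limit. *)
Lemma Lproj_cvg f (eps : R) : good f -> 0 < eps ->
  exists m, Iw mu w ((f : T -> R[i]) - (P m xpredT f : T -> R[i])) < eps.
Proof.
move=> gf eps0; pose s m := \sum_(k < m) sqc (a f k) * c k.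
have snd : {homo s : m n / (m <= n)%N >-> m <= n}.
  apply: homo_leq => [x|y x z|n]; [exact: lexx|exact: le_trans|].
  by rewrite /s big_ord_recr/= lerDl mulr_ge0// sqc_ge0.
have hs : has_sup (range s).
  by split; [exists (s 0%N), 0%N|exists (4 * C * Iw mu w f) => _ [m _ <-]; exact: coef_sum_le].
pose eta := eps / (2 * (4 * C + 1)).
have C1 : 0 < 4 * C + 1 by rewrite ltr_wpDl// mulr_ge0.
have eta0 : 0 < eta by rewrite divr_gt0// mulr_gt0.
have [_ [n _ <-] hn] := sup_adherent eta0 hs.
have tail m : (n <= m)%N -> Iw mu w (P m (fun k => (n <= k)%N) f) <= 4 * C * eta.
  move=> nm; apply: (le_trans (Iw_le_coef _ _ _)); rewrite ler_wpM2l ?mulr_ge0//.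
  have smS : s m <= sup (range s) by apply: ub_le_sup; [exact: hs.2|exists m].
  suff -> : \sum_(k < m | (n <= k)%N) sqc (a f k) * c k = s m - s n by lra.
  rewrite /s [in X in X - _](bigID (fun k : 'I_m => (n <= k)%N))/=.
  rewrite -[LHS]addr0 -addrA; congr (_ + _); apply/esym/eqP; rewrite subr_eq0; apply/eqP.
  rewrite (big_ord_widen m (fun k => sqc (a f k) * c k) nm).
  by apply: eq_bigl => k; rewrite ltnNge.
(* Convergence in L^p at this rate along a subsequence gives a.e. convergence, which lets the
   uniform tail bound pass to f - P_n f by Fatou's lemma. *)
have /choice[l hl] j : exists l, (n <= l)%N /\ LptN (f - P l xpredT f) <= 4^-1 ^+ j.
  have e4 : 0 < (4^-1 : R) ^+ j by rewrite exprn_gt0// invr_gt0.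
  have [m hm] := (sums_toP N0 _ _).1 (a_sums f) _ e4.
  exists (maxn n m); split; first exact: leq_maxl.
  exact/ltW/hm/leq_maxr.
have [K aeK] := ae_cvg_of_LptN (fun j => (hl j).2).
exists n.
have PB j : P (l j) xpredT f - P n xpredT f = P (l j) (fun k => (n <= k)%N) f.
  rewrite /Lproj (big_ord_widen_cond (l j) xpredT (fun k => a f k *: e k) (hl j).1).
  rewrite (bigID (fun k : 'I_(l j) => (n <= k)%N))/= -addrA -[RHS]addr0; congr (_ + _).
  apply/eqP; rewrite subr_eq0; apply/eqP.
  by apply: eq_bigl => k; rewrite -ltnNge.
set z := f - P n xpredT f.
have zE j x : P (l j) (fun k => (n <= k)%N) f x = z x - (f - P (l j) xpredT f : X) x.
  by rewrite -PB /z !LptB_E; ring.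
have [Lz0 Lz1] := good_Lw (Lproj_good n xpredT f).
suff [_ zle] : itg mu (fun x => sqc (z x) * w x) /\ Iw mu w z <= 4 * C * eta.
  apply: (le_lt_trans zle); rewrite /eta mulrA ltr_pdivrMr ?mulr_gt0//.
  have : 0 <= C * eps by rewrite mulr_ge0// ltW.
  nra.
apply: (@itg_fatou _ _ _ mu (fun j x => sqc (P (l j) (fun k => (n <= k)%N) f x) * w x)).
- by move=> j; have [] := good_Lw (Lproj_good (l j) (fun k => (n <= k)%N) f).
- by move=> j x; rewrite mulr_ge0// sqc_ge0.
- by move=> j; exact/tail/(hl j).1.
- by apply: measurable_funM => //; exact: Lpt_measurable.
- by move=> x; rewrite mulr_ge0// sqc_ge0.
apply: filterS aeK => x hx; apply: cvgM; last exact: cvg_cst.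
rewrite (_ : (fun j => _) = fun j => sqc (z x - (f - P (l j) xpredT f : X) x)).
  exact: sqc_cvg hx.
by apply/funext => j; rewrite zE.
Qed.
End weighted_expansion.

(** * The map [phi] and the weighted norm *)

Section phi_isometry.
Context {d : measure_display} {T : measurableType d} {R : realType}.
Variable mu : {sigma_finite_measure set T -> \bar R}.
Variables (p : R) (p1 : 1 <= p) (g : density mu).
Local Notation q := (p / 2).
Local Notation nu := (density_measure g).
Variables (v : T -> R) (Z : R).
Hypothesis Z0 : 0 < Z.
Hypothesis gE : forall x, g x = Z^-1 * v x `^ q.
Local Notation w := (fun x => v x `^ (q - 1)).
(** |phi f|^2 g = |f|^2 g^(1 - 1/q), and with g = v^q / Z the power of g is v^(q-1) times this
    constant. *)
Definition phi_factor : R := Z^-1 `^ (1 - q^-1).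

Let p0 : 0 < p. Proof. exact: lt_le_trans p1. Qed.
Let q0 : 0 < q. Proof. by rewrite divr_gt0. Qed.
Let g0 x : 0 < g x. Proof. exact: density_gt0. Qed.
Let mg : measurable_fun [set: T] g. Proof. exact: density_measurable. Qed.
Let one2 : 1 <= 2 :> R. Proof. by rewrite ler1n. Qed.

Lemma phi_factor_gt0 : 0 < phi_factor.
Proof. by rewrite powR_gt0// invr_gt0. Qed.

Lemma sqc_phi (f : T -> R[i]) x : sqc (phi g p f x) * g x = phi_factor * (sqc (f x) * w x).
Proof.
rewrite /phi sqcM sqc_real mulrAC [RHS]mulrCA mulrC; congr (_ * _).
rewrite -powR_mulrn ?powR_ge0// -powRrM.
have -> : - p^-1 * 2 = - q^-1 by rewrite invf_div mulNr mulrC.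
rewrite mulrC -{1}[g x]powRr1 ?(ltW (g0 x))// -powRD; last by rewrite (gt_eqF (g0 x)) implybT.
rewrite gE powRM ?powR_ge0 ?invr_ge0 ?(ltW Z0)// -powRrM mulrBr mulr1 mulfV//.
by rewrite gt_eqF.
Qed.

Lemma phi_inv (F : T -> R[i]) : phi g p (fun x => (g x `^ p^-1)%:C * F x) = F.
Proof.
apply/funext => x; rewrite /phi mulrA -rmorphM/= -powRD; last by rewrite (gt_eqF (g0 x)) implybT.
by rewrite addNr powRr0 mul1r.
Qed.

Lemma cmeasurable_phi f : cmeasurable (phi g p f) <-> cmeasurable f.
Proof.
have mr r : cmeasurable (fun x => (g x `^ r)%:C).
  by apply: cmeasurable_real; exact: measurable_powRf.
split=> mf; last exact: cmeasurableM.
have -> : f = fun x => (g x `^ p^-1)%:C * phi g p f x; last exact: cmeasurableM.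
apply/funext => x; rewrite /phi mulrA -rmorphM/= -powRD; last by rewrite (gt_eqF (g0 x)) implybT.
by rewrite addrN powRr0 mul1r.
Qed.

Let sqc1 (F : T -> R[i]) x : sqc (F x) `^ (2 / 2) = sqc (F x).
Proof. by rewrite divff// powRr1// sqc_ge0. Qed.

Lemma phi_cLpP f : cLp nu 2 (phi g p f) <-> Lw mu w f.
Proof.
rewrite (cLpP nu one2) /Lw cmeasurable_phi.
suff h : cmeasurable f -> itg nu (fun x => sqc (phi g p f x) `^ (2 / 2)) <->
    itg mu (fun x => sqc (f x) * w x) by split=> -[mf hf]; split=> //; exact/h.
move=> mf; have mphi := (cmeasurable_phi f).2 mf.
have -> : (fun x => sqc (phi g p f x) `^ (2 / 2)) = (fun x => sqc (phi g p f x)).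
  by apply/funext => x; rewrite sqc1.
rewrite itg_density; last exact: measurable_sqc.
have -> : (fun x => sqc (phi g p f x) * g x) = (fun x => phi_factor * (sqc (f x) * w x)).
  by apply/funext => x; rewrite sqc_phi.
split=> [h|h]; last exact: itgZ.
have := itgZ phi_factor^-1 h.
rewrite (_ : (fun x => _) = (fun x => sqc (f x) * w x))//.
by apply/funext => x; rewrite mulKf// gt_eqF// phi_factor_gt0.
Qed.

Lemma phi_norm f : Lw mu w f -> Lpn nu 2 (phi g p f) ^+ 2 = phi_factor * Iw mu w f.
Proof.
move=> Lf; have hf := (phi_cLpP f).2 Lf.
rewrite -powR_mulrn ?Lpn_ge0// (Lpn_powR one2 hf).
have /(cLpP nu one2)[_ hi] := hf.
rewrite Rintegral_density// /Iw -JZ; last exact: Lf.2.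
by apply: J_eq => x; rewrite sqc1 sqc_phi.
Qed.

End phi_isometry.

(** * Density of the span in the weighted space *)

Section weighted_density.
Context {d : measure_display} {T : measurableType d} {R : realType}.
Variable mu : {measure set T -> \bar R}.
Variables (p : R) (p1 : 1 <= p).
Local Notation q := (p / 2).
Local Notation X := (Lpt mu p1).
Variables u v : T -> R.
Hypothesis mu_ : measurable_fun [set: T] u.
Hypothesis mv : measurable_fun [set: T] v.
Hypothesis u0 : forall x, 0 < u x.
Hypothesis uv : forall x, u x <= v x.
Hypothesis iv : itg mu (fun x => v x `^ q).
Local Notation w := (fun x => v x `^ (q - 1)).

Let q0 : 0 < q. Proof. by rewrite divr_gt0// (lt_le_trans _ p1). Qed.

Let uq_le x : u x `^ q <= v x `^ q.
Proof. by apply: powR_le2; [exact: ltW|exact: ltW|exact: uv]. Qed.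

(** [f] is cut off where |f|^2 > n u. The bound |f|^2 <= n u and the integrability of u^q place the
    rest in both spaces, and as u > 0 everywhere, the cut-off part vanishes at each point for large
    n. *)
Lemma truncation f (eps : R) : Lw mu w f -> 0 < eps ->
  exists f' : X, Lw mu (fun x => u x `^ (q - 1)) f' /\ Iw mu w (f - (f' : T -> R[i])) < eps.
Proof.
move=> [mf fi] eps0; have ms := measurable_sqc mf.
pose h n x : R := if sqc (f x) <= n%:R * u x then 1 else 0.
have mh n : measurable_fun [set: T] (h n).
  apply: measurable_fun_ifT; [|exact: measurable_cst|exact: measurable_cst].
  by apply: measurable_fun_ler => //; apply: measurable_funM => //; exact: measurable_cst.
pose F n : T -> R[i] := fun x => (h n x)%:C * f x.
have mF n : cmeasurable (F n) by apply: cmeasurableM => //; exact: cmeasurable_real.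
have sF n x : sqc (F n x) <= n%:R * u x.
  rewrite /F sqcM sqc_real /h; case: ifPn => [h1|_]; first by rewrite expr1n mul1r.
  by rewrite expr0n/= mul0r mulr_ge0// ltW.
have FX n : cLp mu p (F n).
  apply/(cLpP mu p1); split=> //.
  apply: (itg_le _ (itgZ (n%:R `^ q) iv)) => [|x].
    exact/measurable_powRf/measurable_sqc.
  rewrite ger0_norm ?powR_ge0//; apply: (@le_trans _ _ ((n%:R * u x) `^ q)).
    by apply: powR_le2; [exact: ltW|exact: sqc_ge0|].
  by rewrite powRM ?(ltW (u0 x))// ler_wpM2l ?powR_ge0.
have FL n : Lw mu (fun x => u x `^ (q - 1)) (F n).
  split=> //; apply: (itg_le _ (itgZ n%:R iv)) => [|x].
    by apply: measurable_funM; [exact: measurable_sqc|exact: measurable_powRf].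
  rewrite ger0_norm ?mulr_ge0 ?sqc_ge0 ?powR_ge0//.
  apply: (@le_trans _ _ (n%:R * (u x * u x `^ (q - 1)))).
    by rewrite mulrA ler_wpM2r ?powR_ge0.
  by rewrite mulr_powRB1// ?(ltW (u0 x))// ler_wpM2l.
have FE n x : (f - F n) x = (1 - h n x)%:C * f x.
  by rewrite rmorphB rmorph1 mulrBl mul1r.
have [_ Icvg] : itg mu (cst 0) /\ Iw mu w (f - F n) @[n --> \oo] --> Rintegral mu [set: T] (cst 0).
  apply: (itg_dominated (g := fun x => sqc (f x) * w x)) => //.
  - move=> n; apply: measurable_funM; last exact: measurable_powRf.
    by apply: measurable_sqc; rewrite -scaleN1r; apply: cmeasurableD => //; exact: cmeasurableZ.
  - apply: nearW => x n.
    rewrite FE sqcM sqc_real ger0_norm; last first.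
      by rewrite mulr_ge0 ?powR_ge0// mulr_ge0 ?sqc_ge0// sqr_ge0.
    rewrite ler_wpM2r ?powR_ge0// /h; case: ifPn => _.
      by rewrite subrr expr0n/= mul0r sqc_ge0.
    by rewrite subr0 expr1n mul1r.
  - apply: nearW => x; apply: cvg_near_cst; near=> n.
    rewrite FE sqcM sqc_real /h ifT ?subrr ?expr0n/= ?mul0r//.
    rewrite -ler_pdivrMr//; near: n; exact: nbhs_infty_ger.
move: Icvg; rewrite /Rintegral integral0/= => /cvgrPdist_lt/(_ _ eps0)[m _ hm].
exists (mkLpt p1 (FX m)); split; first exact: FL.
have := hm m (leqnn m); rewrite sub0r normrN ger0_norm//.
by apply: Iw_ge0 => x; exact: powR_ge0.
Unshelve. all: by end_near. Qed.

Variable e : nat -> X.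
Hypothesis ek_Lw : forall k, Lw mu (fun x => u x `^ (q - 1)) (e k).
Hypothesis Lw_uv : forall f : X,
  Lw mu (fun x => u x `^ (q - 1)) f -> Lw mu w f.
Variable a : X -> nat -> R[i].
Hypothesis a_sums : forall f, sums_to (fun f => (LptN f)%:E) (fun k => a f k *: e k) f.
Hypothesis a_unique : forall f c,
  sums_to (fun f => (LptN f)%:E) (fun k => c k *: e k) f -> c = a f.
Variable C : R.
Hypothesis C0 : 0 <= C.
Hypothesis hC : forall f : X, Lw mu (fun x => u x `^ (q - 1)) f ->
  forall m b, Iw mu w (Lproj e a m b f) <= C * Iw mu w f.

Lemma span_Lw (c : nat -> R[i]) m (b : pred nat) :
  Lw mu (fun x => u x `^ (q - 1)) (\sum_(k < m | b k) c k *: e k : X).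
Proof.
have -> : ((\sum_(k < m | b k) c k *: e k : X) : T -> R[i]) =
    \sum_(k < m | b k) c k *: (e k : T -> R[i]).
  by apply/funext => x; rewrite Lpt_sumE fct_sumE.
apply: Lw_sum => [|x|k _]; [exact: measurable_powRf|exact: powR_ge0|].
by apply: LwZ; exact: ek_Lw.
Qed.

Lemma span_projection (c : nat -> R[i]) m (b : pred nat) :
  Iw mu w (\sum_(k < m | b k) c k *: e k : X) <= C * Iw mu w (\sum_(k < m) c k *: e k : X).
Proof.
rewrite -(Lproj_span a_sums a_unique); apply: hC.
exact: (span_Lw c m xpredT).
Qed.

Lemma span_dense f (eps : R) : Lw mu w f -> 0 < eps ->
  exists (c : nat -> R[i]) m,
    Iw mu w (f - ((\sum_(k < m) c k *: e k : X) : T -> R[i])) < eps.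
Proof.
(* Each of the two errors, from truncation and from expansion, is doubled by [IwD]. *)
move=> Lf eps0; have e4 : 0 < eps / 4 by rewrite divr_gt0.
have [f' [f'L f'e]] := truncation Lf e4.
have mw : measurable_fun [set: T] w by exact: measurable_powRf.
have w0 x : 0 <= w x by exact: powR_ge0.
have [m hm] := Lproj_cvg a_sums a_unique mw w0 Lw_uv
  (fun c m => span_Lw c m xpredT) C0 hC f'L e4.
exists (a f'), m; set S : T -> R[i] := (\sum_(k < m) _ : X).
have LS : Lw mu w S by apply: Lw_uv; exact: (span_Lw (a f') m xpredT).
have Lf' := Lw_uv f'L.
have -> : f - S = (f - (f' : T -> R[i])) + ((f' : T -> R[i]) - S) by rewrite addrA subrK.
have sub f1 f2 : Lw mu w f1 -> Lw mu w f2 -> Lw mu w (f1 - f2).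
  by move=> L1 L2; apply: LwD => //; exact: LwN.
apply: (le_lt_trans (IwD mw w0 (sub _ _ Lf Lf') (sub _ _ Lf' LS))).
by move: hm f'e; rewrite -/S; lra.
Qed.

End weighted_density.

Theorem theorem5p4 (d : measure_display) (T : measurableType d) (R : realType)
    (mu : {sigma_finite_measure set T -> \bar R}) (p : R) (hp : 1 <= p)
    (e : nat -> T -> R[i]) (he : is_Lp_unconditional_basis mu p e) :
  exists g : density mu,
    (forall k, cLp (density_measure g) 2 (phi g p (e k))) /\
    is_Lp_unconditional_basis (density_measure g) 2 (fun k => phi g p (e k)).
Proof.
pose E k : Lpt mu hp := mkLpt hp (he.1.1 k).
have bE : is_unconditional_basis setT (fun x => (LptN x)%:E) E by exact/Lpt_basis.
have [a [a_sums a_unique]] := exists_coef bE.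
have E0 := basis_norm_gt0 (@LptN_ge0 _ _ _ mu p hp) (@LptND _ _ _ mu p hp)
  (@LptNZ _ _ _ mu p hp) a_sums a_unique.
have [u [v [[mu_ mv u0 uv iv] [Eu Luv [C C0 hC]]]]] := weight_exists E0 bE a_sums a_unique.
have v0 x : 0 < v x by exact: lt_le_trans (uv x).
have q0 : 0 < p / 2 by rewrite divr_gt0// (lt_le_trans _ hp).
have E0p k : 0 < \int[mu]_x sqc (E k x) `^ (p / 2) by rewrite -LptN_powR powR_gt0.
(* The basis vector [E 0] has positive norm, so mu is not the zero measure, and [v] is positive
   everywhere. *)
have Z0 : 0 < \int[mu]_x v x `^ (p / 2).
  apply: (J_gt0 (Lpt_itg (E 0%N)) iv _ _ (E0p 0%N)) => x; first exact: powR_ge0.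
  by move=> vx; move: (powR_gt0 (p / 2) (v0 x)); rewrite vx ltxx.
have [g gE] := exists_normalized_density iv (fun x => powR_gt0 (p / 2) (v0 x)) Z0.
have two1 : 1 <= 2 :> R by rewrite ler1n.
pose w x := v x `^ (p / 2 - 1).
have w0 x : 0 < w x by exact: powR_gt0.
have LE k : Lw mu w (E k) by apply: Luv; exact: Eu.
have phiE k : cLp (density_measure g) 2 (phi g p (e k)) by apply/(phi_cLpP hp Z0 gE _); exact: LE.
exists g; split=> //.
pose Y := Lpt (density_measure g) two1.
pose e' k : Y := mkLpt two1 (phiE k).
set kappa := phi_factor p (\int[mu]_x v x `^ (p / 2)).
have k0 : 0 < kappa by exact: phi_factor_gt0.
have normY (y : Y) f : Lw mu w f -> (y : T -> R[i]) = phi g p f -> LptN y ^+ 2 = kappa * Iw mu w f.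
  by move=> Lf yf; rewrite /LptN yf; exact: phi_norm.
have sumY (c : nat -> R[i]) m (b : pred nat) :
    ((\sum_(k < m | b k) c k *: e' k : Y) : T -> R[i]) =
    phi g p (\sum_(k < m | b k) c k *: E k : Lpt mu hp).
  apply/funext => x; rewrite /phi !Lpt_sumE mulr_sumr; apply: eq_bigr => k _.
  by rewrite mulrCA.
have LS (c : nat -> R[i]) m (b : pred nat) : Lw mu w (\sum_(k < m | b k) c k *: E k : Lpt mu hp).
  by apply: Luv; exact: span_Lw.
suff : is_unconditional_basis setT (fun y : Y => (LptN y)%:E) e' by move/Lpt_basis.
apply: (unconditional_basis_of_dense (@LptN_ge0 _ _ _ _ _ two1) (@LptND _ _ _ _ _ two1)
  (@LptNZ _ _ _ _ _ two1) (C := C + 1)).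
- move=> k; rewrite lt_neqAle LptN_ge0 andbT eq_sym -sqrf_eq0 (normY _ (E k))//.
  rewrite mulf_neq0 ?gt_eqF//; apply: (J_gt0 (Lpt_itg (E k)) _ _ _ (E0p k)) => [|x|x].
  + by have [] := LE k.
  + by rewrite mulr_ge0 ?sqc_ge0// ltW.
  + move/eqP; rewrite mulf_eq0 (gt_eqF (w0 x)) orbF => /eqP ->.
    by rewrite powR0// gt_eqF.
- by rewrite addr_ge0.
- move=> c m b; rewrite -(@ler_sqr R) ?nnegrE ?mulr_ge0 ?addr_ge0 ?LptN_ge0//.
  rewrite exprMn (normY _ _ (LS c m b) (sumY c m b)) (normY _ _ (LS c m xpredT) (sumY c m xpredT)).
  rewrite [leRHS]mulrCA (ler_pM2l k0).
  have h := span_projection mu_ Eu a_sums a_unique hC c m b.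
  apply: le_trans h _.
  (* [Iw] is a squared norm, and [C <= (C + 1) ^ 2] gives the constant [C + 1] for the norm
     itself. *)
  apply: ler_wpM2r; last nra.
  by apply: Iw_ge0 => x; exact: powR_ge0.
- move=> y eps eps0.
  pose f x := (g x `^ p^-1)%:C * y x.
  have yf : (y : T -> R[i]) = phi g p f by rewrite phi_inv.
  have Lf : Lw mu w f.
    by apply: (phi_cLpP hp Z0 gE f).1; rewrite -yf; exact: Lpv_cLp.
  (* The squared norm of [phi f] is [kappa] times [Iw], so this is the accuracy needed before
     [phi]. *)
  have e2 : 0 < eps ^+ 2 / kappa by rewrite divr_gt0// exprn_gt0.
  have [c [m hm]] := span_dense mu_ mv u0 uv iv Eu Luv a_sums a_unique C0 hC Lf e2.
  exists c, m; rewrite -(@ltr_sqr R) ?nnegrE ?LptN_ge0 ?(ltW eps0)//.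
  rewrite (normY _ (f - ((\sum_(k < m) c k *: E k : Lpt mu hp) : T -> R[i]))).
  + by rewrite mulrC -ltr_pdivlMr.
  + apply: LwD; [exact: measurable_powRf|by move=> x; exact: ltW|by []|].
    by apply: LwN; exact: (LS c m xpredT).
  + apply/funext => x; rewrite LptB_E (sumY c m xpredT) yf.
    by rewrite /phi -mulrBr.
Qed.
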